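(* Let $n\geq2$ and $n/2<\beta\leq n/2+2$, let $\omega(x)=1+|x|^2$ on $\mathbb{R}^n$, let $\mu_\beta$ be the generalised Cauchy probability measure with density proportional to $\omega^{-\beta}$, and let $Lf=\omega\Delta f-2(\beta-1)\langle x,df\rangle$, with associated semigroup $(\mathbf{P}_t)_{t\geq0}$. Set $\varepsilon_0=\frac n2+2-\beta$. Then $\lambda_1(-L)\geq(\beta-n/2)^2$, and for all $f\in\mathcal{C}_c^\infty(\mathbb{R}^n)$, writing $f_t=\mathbf{P}_tf$, $$\Big(\beta-\frac n2\Big)^2\mathrm{Var}_{\mu_\beta}(f)-\int_{\mathbb{R}^n}|df|^2(1+|x|^2)\,d\mu_\beta=-2\int_0^{+\infty}\!\int_{\mathbb{R}^n}\Big\{\frac{n}{n-1}\Big\|\omega\,\mathrm{Hess}f_t+\varepsilon_0\frac{\nabla f_t\otimes x+x\otimes\nabla f_t}{2}\Big\|^2_{HS}-\frac{1}{n-1}\big(\omega\Delta f_t+\varepsilon_0\langle df_t,x\rangle\big)^2$$ $$+\frac{(n-2)\left[4(\beta-1)^2-4(n-2)(\beta-1)+(n+2)^2\right]}{8(n-1)}\Big[|df_t|^2|x|^2-\langle df_t,x\rangle^2\Big]+\Big(\frac n2+2-\beta\Big)\Big(\beta+\frac n2\Big)|df_t|^2\Big\}\,d\mu_\beta\,dt.$$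
   Context: $d\mu_\beta=\frac{1}{Z_{n,\beta}}(1+|x|^2)^{-\beta}dx$, with $Z_{n,\beta}$ the normalising constant. The operator $L$, defined on $\mathcal{C}_c^\infty(\mathbb{R}^n)$, is symmetric and essentially self-adjoint in $L^2(\mu_\beta)$; its self-adjoint extension, still denoted $L$, has domain $\mathcal{D}(L)\subset L^2(\mu_\beta)$, and $\mathbf{P}_t=e^{tL}$ is the $L^2(\mu_\beta)$-semigroup it generates. $\|\cdot\|_{HS}$ is the Hilbert-Schmidt norm. The spectral gap is $$\lambda_1(-L)=\inf\left\{\frac{\int_{\mathbb{R}^n}-f\,Lf\,d\mu_\beta}{\mathrm{Var}_{\mu_\beta}(f)}\ :\ f\in\mathcal{D}(L),\ \mathrm{Var}_{\mu_\beta}(f)\neq0\right\}.$$ *)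

(* Defs.v *)
From HB Require Import structures.
From mathcomp Require Import all_boot all_order all_algebra.
From mathcomp Require Import all_classical all_reals all_analysis.
From mathcomp Require Import measurable_realfun.

Set Implicit Arguments.
Unset Strict Implicit.
Unset Printing Implicit Defensive.

Import Order.TTheory GRing.Theory Num.Theory.
Import numFieldTopology.Exports numFieldNormedType.Exports.

Local Open Scope classical_set_scope.
Local Open Scope ring_scope.

Section measurable_rV.
Context (R : realType) (n : nat).

Let coord (i : 'I_n) (x : 'rV[R]_n) : R := x ord0 i.

Let rV_set0 : g_sigma_preimage coord set0.
Proof. exact: sigma_algebra0. Qed.

Let rV_setC A : g_sigma_preimage coord A -> g_sigma_preimage coord (~` A).
Proof. exact: sigma_algebraC. Qed.

Let rV_bigcup (F : (set 'rV[R]_n)^nat) :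
  (forall i, g_sigma_preimage coord (F i)) ->
  g_sigma_preimage coord (\bigcup_i (F i)).
Proof. exact: sigma_algebra_bigcup. Qed.

HB.instance Definition _ := @isMeasurable.Build default_measure_display
  'rV[R]_n (g_sigma_preimage coord) rV_set0 rV_setC rV_bigcup.

End measurable_rV.

Section measurable_coordinates.
Context (R : realType).

Lemma measurable_coord n (i : 'I_n) :
  measurable_fun setT (fun x : 'rV[R]_n => x ord0 i).
Proof.
move=> _ Y mY; rewrite setTI; apply: sub_sigma_algebra => /=.
rewrite -bigcup_seq/=; exists i => /=; first by rewrite mem_index_enum.
by exists Y => //; rewrite setTI.
Qed.

Lemma measurable_fun_coordP d (T : measurableType d) n (f : T -> 'rV[R]_n) :
  (forall i, measurable_fun setT (fun t => f t ord0 i)) -> measurable_fun setT f.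
Proof.
move=> mf _ A mA; rewrite setTI.
suff : preimage_set_system setT f measurable `<=` measurable.
  by move=> /(_ (f @^-1` A)); apply; exists A => //; rewrite setTI.
rewrite [X in preimage_set_system _ _ X](_ : measurable =
  g_sigma_preimage (fun (i : 'I_n) (x : 'rV[R]_n) => x ord0 i))//.
rewrite -g_sigma_preimage_comp; apply: smallest_sub.
  exact: sigma_algebra_measurable.
move=> B; rewrite -bigcup_seq/= => -[i _ [C mC <-]].
exact: mf.
Qed.

End measurable_coordinates.

Section lebesgue_rV.
Context (R : realType).

Definition rV_cons n (z : R * 'rV[R]_n) : 'rV[R]_n.+1 :=
  \row_i oapp (z.2 ord0) z.1 (unlift ord0 i).

Lemma measurable_rV_cons n : measurable_fun setT (@rV_cons n).
Proof.
apply: measurable_fun_coordP => i.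
under eq_fun do rewrite mxE.
case: (unlift ord0 i) => [j|]/=; last exact: measurable_fst.
exact: (measurableT_comp (measurable_coord j) measurable_snd).
Qed.

Section step.
Context n (mu : {sigma_finite_measure set 'rV[R]_n -> \bar R}).
Local Open Scope ereal_scope.

Definition lebesgue_rV_step (A : set 'rV[R]_n.+1) : \bar R :=
  ((@lebesgue_measure R) \x mu) (@rV_cons n @^-1` A).

Let mcons (A : set 'rV[R]_n.+1) : measurable A -> measurable (@rV_cons n @^-1` A).
Proof. by move=> mA; rewrite -[X in measurable X]setTI; exact: measurable_rV_cons. Qed.

Let step0 : lebesgue_rV_step set0 = 0.
Proof. by rewrite /lebesgue_rV_step preimage_set0 measure0. Qed.

Let step_ge0 A : 0 <= lebesgue_rV_step A.
Proof. exact: measure_ge0. Qed.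

Let step_sigma_additive : semi_sigma_additive lebesgue_rV_step.
Proof.
move=> F mF tF mUF; rewrite /lebesgue_rV_step preimage_bigcup.
apply: measure_semi_sigma_additive.
- by move=> k; exact: mcons.
- apply/trivIsetP => /= i j _ _ ij; rewrite -preimage_setI.
  by move/trivIsetP : tF => /(_ _ _ _ _ ij) ->//; rewrite preimage_set0.
- by rewrite -preimage_bigcup; exact: mcons.
Qed.

HB.instance Definition _ := isMeasure.Build _ _ _ lebesgue_rV_step
  step0 step_ge0 step_sigma_additive.

Let uncons (x : 'rV[R]_n.+1) : R * 'rV[R]_n :=
  (x ord0 ord0, \row_j x ord0 (lift ord0 j)).

Let measurable_uncons : measurable_fun setT uncons.
Proof.
apply/measurable_fun_prod => /=; first exact: measurable_coord.
apply: measurable_fun_coordP => j.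
by under eq_fun do rewrite mxE; exact: measurable_coord.
Qed.

Let consK : cancel (@rV_cons n) uncons.
Proof.
move=> [a x]; rewrite /uncons /rV_cons mxE unlift_none /=; congr (_, _).
by apply/rowP => j; rewrite !mxE liftK.
Qed.

Let step_sigma_finite : sigma_finite setT lebesgue_rV_step.
Proof.
have /sigma_finiteP[F [FT ndF Foo]] := sigma_finiteT (@lebesgue_measure R).
have /sigma_finiteP[G [GT ndG Goo]] := sigma_finiteT mu.
exists (fun k => uncons @^-1` (F k `*` G k)).
  apply/esym; rewrite -subTset => x _ /=.
  have : [set: R] (uncons x).1 by [].
  rewrite FT => -[i _ Fi]; have : [set: 'rV[R]_n] (uncons x).2 by [].
  rewrite GT => -[j _ Gj]; exists (maxn i j) => //; split.
    by move: Fi; exact/subsetPset/ndF/leq_maxl.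
  by move: Gj; exact/subsetPset/ndG/leq_maxr.
move=> k; have [mF Fkoo] := Foo k; have [mG Gkoo] := Goo k; split.
  rewrite -[X in measurable X]setTI.
  by apply: measurable_uncons => //; exact: measurableX.
rewrite /lebesgue_rV_step (_ : _ @^-1` _ = F k `*` G k); last first.
  rewrite -comp_preimage (_ : uncons \o _ = id) ?preimage_id//.
  exact/funext/consK.
by rewrite product_measure1E// lte_mul_pinfty// ge0_fin_numE.
Qed.

HB.instance Definition _ := Measure_isSigmaFinite.Build _ _ _ lebesgue_rV_step
  step_sigma_finite.

End step.

(* n-dimensional Lebesgue measure, as an iterated product. *)
Fixpoint lebesgue_rV n : {sigma_finite_measure set 'rV[R]_n -> \bar R} :=
  if n is m.+1 then [the {sigma_finite_measure set _ -> \bar R} of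
                     lebesgue_rV_step (lebesgue_rV m)]
  else [the {sigma_finite_measure set _ -> \bar R} of \d_(0 : 'rV[R]_0)].

End lebesgue_rV.

Section euclidean.
Context (R : realType) (n : nat).

(* The library norm `|x| on 'rV[R]_n is the sup norm, hence these definitions. *)
Definition dot (x y : 'rV[R]_n) : R := \sum_(i < n) x ord0 i * y ord0 i.
Definition enorm (x : 'rV[R]_n) : R := Num.sqrt (dot x x).
Definition hs_norm (A : 'M[R]_n) : R :=
  Num.sqrt (\sum_(i < n) \sum_(j < n) A i j ^+ 2).
Definition tensor (x y : 'rV[R]_n) : 'M[R]_n := x^T *m y.
Definition omega (x : 'rV[R]_n) : R := 1 + enorm x ^+ 2.

End euclidean.

Section derivatives.
Context (R : realType) (n : nat).
Implicit Types f : 'rV[R]_n -> R.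

Definition partial (i : 'I_n) f : 'rV[R]_n -> R :=
  fun x => 'D_(delta_mx ord0 i) f x.

Definition grad f (x : 'rV[R]_n) : 'rV[R]_n := \row_i partial i f x.
Definition hess f (x : 'rV[R]_n) : 'M[R]_n :=
  \matrix_(i, j) partial i (partial j f) x.
Definition laplacian f (x : 'rV[R]_n) : R := \tr (hess f x).

Definition smooth f := forall s : seq 'I_n,
  continuous (foldr partial f s) /\
  forall i x, derivable (foldr partial f s) x (delta_mx ord0 i).

Definition Cc_infty f := smooth f /\ compact (closure [set x | f x != 0]).

(* Weak (distributional) derivatives.  As for ['D_v f], the operator
   [weak_partial] is total and returns 0 when there is no derivative; a weak
   derivative is unique up to a Lebesgue-null set. *)
Definition loc_integrable f := measurable_fun setT f /\
  forall K, compact K -> (@lebesgue_rV R n).-integrable K (EFin \o f).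

Definition is_weak_partial (i : 'I_n) f g :=
  [/\ loc_integrable f, loc_integrable g &
      forall phi, Cc_infty phi ->
        \int[@lebesgue_rV R n]_x (f x * partial i phi x) =
        - \int[@lebesgue_rV R n]_x (g x * phi x)].

Definition weak_partial (i : 'I_n) f : 'rV[R]_n -> R :=
  xget (cst 0) [set g | is_weak_partial i f g].

Definition weak_grad f (x : 'rV[R]_n) : 'rV[R]_n :=
  \row_i weak_partial i f x.
Definition weak_hess f (x : 'rV[R]_n) : 'M[R]_n :=
  \matrix_(i, j) weak_partial i (weak_partial j f) x.

End derivatives.

Section cauchy.
Context (R : realType) (n : nat) (beta : R).
Local Notation rV := 'rV[R]_n.

Definition cauchy_Z : R :=
  fine (\int[@lebesgue_rV R n]_x (omega x `^ (- beta))%:E)%E.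

Definition cauchy_pdf (x : rV) : R := cauchy_Z^-1 * omega x `^ (- beta).

Lemma cauchy_pdf_ge0 x : 0 <= cauchy_pdf x.
Proof.
rewrite mulr_ge0 ?powR_ge0// invr_ge0 fine_ge0// integral_ge0// => y _.
by rewrite lee_fin powR_ge0.
Qed.

Lemma measurable_omega : measurable_fun setT (@omega R n).
Proof.
rewrite (_ : @omega R n = fun x => 1 + \sum_(i < n) x ord0 i * x ord0 i).
  apply: measurable_funD => //; apply: measurable_sum => i.
  by apply: measurable_funM; exact: measurable_coord.
apply/funext => x; rewrite /omega /enorm sqr_sqrtr//.
by apply: sumr_ge0 => i _; rewrite -expr2 sqr_ge0.
Qed.

Lemma measurable_cauchy_pdf : measurable_fun setT cauchy_pdf.
Proof.
apply: measurable_funM => //.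
exact: (measurableT_comp (measurable_powR _) measurable_omega).
Qed.

Definition cauchy_measure (A : set rV) : \bar R :=
  (\int[@lebesgue_rV R n]_(x in A) (cauchy_pdf x)%:E)%E.

Let cauchy0 : cauchy_measure set0 = 0%E.
Proof. by rewrite /cauchy_measure integral_set0. Qed.

Let cauchy_ge0 A : (0 <= cauchy_measure A)%E.
Proof. by apply: integral_ge0 => x _; rewrite lee_fin cauchy_pdf_ge0. Qed.

Let cauchy_sigma_additive : semi_sigma_additive cauchy_measure.
Proof.
move=> /= F mF tF mUF; rewrite /cauchy_measure; apply: cvg_toP.
  apply: ereal_nondecreasing_is_cvgn => m k mk.
  apply: lee_sum_nneg_natr => // j _ _.
  by apply: integral_ge0 => /= x Fkx; rewrite lee_fin cauchy_pdf_ge0.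
rewrite ge0_integral_bigcup//=.
- apply: measurable_funTS; apply: measurableT_comp => //.
  exact: measurable_cauchy_pdf.
- by move=> x _; rewrite lee_fin cauchy_pdf_ge0.
Qed.

HB.instance Definition _ := isMeasure.Build _ _ _ cauchy_measure
  cauchy0 cauchy_ge0 cauchy_sigma_additive.

End cauchy.
Arguments cauchy_measure {R} n beta A.

Definition variance_of d (T : measurableType d) (R : realType)
    (mu : {measure set T -> \bar R}) (f : T -> R) : R :=
  \int[mu]_x (f x - \int[mu]_y f y) ^+ 2.

(* Unbounded operators on L^2(mu) are given by their graphs, on functions
   rather than on classes modulo equality almost everywhere. *)

Definition L2norm d (T : measurableType d) (R : realType)
    (mu : {measure set T -> \bar R}) (f : T -> R) : \bar R :=
  ('N[mu]_2%:E[EFin \o f])%E.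

(* [P] is the strongly continuous semigroup on L^2(mu) whose infinitesimal
   generator (with its domain) is the operator of graph [A]. *)
Record semigroup_generated_by d (T : measurableType d) (R : realType)
    (mu : {measure set T -> \bar R}) (A : (T -> R) -> (T -> R) -> Prop)
    (P : R -> (T -> R) -> (T -> R)) : Prop := {
  sg_L2 : forall t f, 0 <= t -> f \in Lfun mu 2%:E -> P t f \in Lfun mu 2%:E ;
  sg_linear : forall t a f g, 0 <= t ->
    f \in Lfun mu 2%:E -> g \in Lfun mu 2%:E ->
    {ae mu, forall x, P t (fun y => a * f y + g y) x = a * P t f x + P t g x} ;
  sg_bounded : forall t, 0 <= t -> exists M : R,
    forall f, f \in Lfun mu 2%:E ->
      (L2norm mu (P t f) <= M%:E * L2norm mu f)%E ;
  sg_0 : forall f, f \in Lfun mu 2%:E -> {ae mu, forall x, P 0 f x = f x} ;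
  sg_add : forall s t f, 0 <= s -> 0 <= t -> f \in Lfun mu 2%:E ->
    {ae mu, forall x, P (s + t) f x = P s (P t f) x} ;
  sg_continuous : forall f, f \in Lfun mu 2%:E ->
    L2norm mu (fun x => P t f x - f x) @[t --> 0^'+] --> 0%E ;
  sg_generator : forall f g, A f g <->
    [/\ f \in Lfun mu 2%:E, g \in Lfun mu 2%:E &
        L2norm mu (fun x => t^-1 * (P t f x - f x) - g x)
          @[t --> 0^'+] --> 0%E] }.

Section cauchy_operator.
Context (R : realType) (n : nat) (beta : R).
Local Notation rV := 'rV[R]_n.
Local Notation mu := (@cauchy_measure R n beta).

Definition cauchy_L (f : rV -> R) : rV -> R := fun x =>
  omega x * laplacian f x - 2 * (beta - 1) * dot x (grad f x).

(* [cauchy_dom f g] means that [f] is in D(L) and [Lf = g]: this is the closure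
   in L^2(mu) of [cauchy_L] on [Cc_infty], i.e. the self-adjoint extension of
   this essentially self-adjoint operator. *)
Definition cauchy_dom (f g : rV -> R) :=
  [/\ f \in Lfun mu 2%:E, g \in Lfun mu 2%:E &
    exists u : nat -> (rV -> R),
    [/\ forall k, Cc_infty (u k),
        L2norm mu (fun x => u k x - f x) @[k --> \oo] --> 0%E &
        L2norm mu (fun x => cauchy_L (u k) x - g x)
          @[k --> \oo] --> 0%E]].

Definition spectral_gap : \bar R :=
  ereal_inf [set q | exists f g, [/\ cauchy_dom f g, variance_of mu f != 0 &
    q = ((\int[mu]_x (- f x * g x)) / variance_of mu f)%:E]].

End cauchy_operator.
Arguments cauchy_dom {R} n beta f g.
Arguments spectral_gap {R} n beta.

(* Main.v *)
(** Write lambda = (beta - n/2)^2 and let Q f be the integrand on the right-hand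
    side. Integrating by parts the divergences of omega^(2-beta) Hess f grad f and
    of two similar fields gives, for f in C_c^oo,
      int Q f dmu = int (L f)^2 dmu + lambda int f L f dmu,
    and Q f >= 0 by Cauchy-Schwarz, for the traces and for grad f and x. Moreover
    L(C_c^oo) together with the constants is dense in L^2(mu), as one sees by
    applying L to p omega^(-s) with p a homogeneous polynomial; writing f up to a
    small error as L phi + c then yields the Poincare inequality with constant
    lambda. Everything passes to the L^2-closure of L, the gradient and the Hessian
    becoming weak derivatives, because omega^(1/2) df and omega Hess f are bounded
    in L^2(mu) by the graph norm of L. Along f_t = P_t f the quantity
    G(t) = lambda Var(f_t) + int f_t L f_t dmu has derivative 2 int Q f_t dmu and
    tends to 0 at infinity, so that G(0) = -2 int_0^oo int Q f_t dmu dt. *)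

Require Import Defs.
From HB Require Import structures.
From mathcomp Require Import all_boot all_order all_algebra.
From mathcomp Require Import all_classical all_reals all_analysis.
From mathcomp Require Import measurable_realfun.
From mathcomp Require Import ring lra.

Set Implicit Arguments.
Unset Strict Implicit.
Unset Printing Implicit Defensive.

Import Order.TTheory GRing.Theory Num.Theory.
Import numFieldTopology.Exports numFieldNormedType.Exports.

Local Open Scope classical_set_scope.
Local Open Scope ring_scope.

(** * Square-integrable functions *)

(** The closure of [L] is handled as a symmetric operator only. The bound lambda int omega |du|^2
    dmu <= int (L u)^2 dmu speaks of functions of the form L u; to become a Poincare inequality it
    must be dualised, and this is what density of the range is for. On p omega^(-s), with p of
    degree l, [L] is a two-term recursion in s, up to the Laplacian of p, whose degree is l - 2.
    Induction on l with a well chosen first exponent reaches p times every power of 1/omega beyond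
    it, and a monotone class argument in bounded coordinates, replacing the Weierstrass theorem,
    reaches all of L^2(mu). The semigroup is known only by its generator and by the boundedness of
    each single P_t. Differentiating along it needs a bound uniform for t near 0, which a gliding
    hump provides, and derivatives in t must be two-sided although the generator is a limit from the
    right. The weak derivatives of the statement are chosen representatives. The quadratic form is
    therefore taken to the limit in the variables omega^(1/2) du and omega Hess u, in which its
    coefficients are bounded, and identified almost everywhere only at the end. *)

Section square_integrable.
Context d (T : measurableType d) (R : realType).
Variable mu : {measure set T -> \bar R}.
Implicit Types f g h : T -> R.

(** Stated with an explicit integrable square, so that [ip] and [nrm] below are real numbers and can
    be computed with; [Lfun2P] and [L2norm_nrm] translate to the spaces and norms of the
    statement. *)
Definition sqi f := measurable_fun setT f /\
  mu.-integrable setT (fun x => (f x ^+ 2)%:E).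

Definition ip f g : R := \int[mu]_x (f x * g x).

Definition nrm f : R := Num.sqrt (ip f f).

Lemma sqi_integrableM f g : sqi f -> sqi g ->
  mu.-integrable setT (fun x => (f x * g x)%:E).
Proof.
move=> [mf if2] [mg ig2].
apply: (@le_integrable _ _ _ mu setT measurableT _
    (fun x => (f x ^+ 2)%:E + (g x ^+ 2)%:E)%E).
- by apply/measurable_EFinP; exact: measurable_funM.
- move=> x _; rewrite -EFinD /= lee_fin normrM.
  rewrite (ger0_norm (addr_ge0 (sqr_ge0 _) (sqr_ge0 _))).
  rewrite -(real_normK (num_real (f x))) -(real_normK (num_real (g x))).
  have := sqr_ge0 (`|f x| - `|g x|); have := normr_ge0 (f x).
  by have := normr_ge0 (g x); nra.
- exact: integrableD.
Qed.

Lemma sqiD f g : sqi f -> sqi g -> sqi (fun x => f x + g x).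
Proof.
move=> sf sg; have [mf if2] := sf; have [mg ig2] := sg.
split; first exact: measurable_funD.
have -> : (fun x => ((f x + g x) ^+ 2)%:E) =
    (fun x => ((f x ^+ 2)%:E + (g x ^+ 2)%:E) + 2%:E * (f x * g x)%:E)%E.
  by apply/funext => x; rewrite -EFinM -!EFinD; congr EFin; ring.
apply: integrableD => //; first exact: integrableD.
by apply: integrableZl => //; exact: sqi_integrableM.
Qed.

Lemma sqiZ c f : sqi f -> sqi (fun x => c * f x).
Proof.
move=> [mf if2]; split; first exact: measurable_funM.
under eq_fun do rewrite exprMn EFinM.
exact: integrableZl.
Qed.

Lemma sqiN f : sqi f -> sqi (fun x => - f x).
Proof. by move=> /(@sqiZ (-1)); under eq_fun do rewrite mulN1r. Qed.

Lemma sqiB f g : sqi f -> sqi g -> sqi (fun x => f x - g x).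
Proof. by move=> sf /sqiN; exact: sqiD. Qed.

Lemma sqi0 : sqi (fun=> 0).
Proof.
split; first exact: measurable_cst.
by under eq_fun do rewrite expr0n; exact: integrable0.
Qed.

Lemma le_sqi f g : measurable_fun setT f -> (forall x, `|f x| <= `|g x|) ->
  sqi g -> sqi f.
Proof.
move=> mf fg [mg ig2]; split => //; apply: le_integrable ig2 => //.
  by apply/measurable_EFinP; exact: measurable_funX.
by move=> x _ /=; rewrite lee_fin !normrX lerXn2r// nnegrE.
Qed.

Lemma ipC f g : ip f g = ip g f.
Proof. by apply: eq_Rintegral => x _; rewrite mulrC. Qed.

Lemma ipDl f g h : sqi f -> sqi g -> sqi h ->
  ip (fun x => f x + g x) h = ip f h + ip g h.
Proof.
move=> sf sg sh; rewrite /ip -RintegralD//; try exact: sqi_integrableM.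
by apply: eq_Rintegral => x _; rewrite mulrDl.
Qed.

Lemma ipZl c f h : sqi f -> sqi h -> ip (fun x => c * f x) h = c * ip f h.
Proof.
move=> sf sh; rewrite /ip -RintegralZl//; try exact: sqi_integrableM.
by apply: eq_Rintegral => x _; rewrite mulrA.
Qed.

Lemma ipBl f g h : sqi f -> sqi g -> sqi h ->
  ip (fun x => f x - g x) h = ip f h - ip g h.
Proof.
move=> sf sg sh; rewrite /ip -RintegralB//; try exact: sqi_integrableM.
by apply: eq_Rintegral => x _; rewrite mulrBl.
Qed.

Lemma ipDr f g h : sqi f -> sqi g -> sqi h ->
  ip h (fun x => f x + g x) = ip h f + ip h g.
Proof. by move=> *; rewrite ipC ipDl// !(ipC h). Qed.

Lemma ipBr f g h : sqi f -> sqi g -> sqi h ->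
  ip h (fun x => f x - g x) = ip h f - ip h g.
Proof. by move=> *; rewrite ipC ipBl// !(ipC h). Qed.

Lemma ipZr c f h : sqi f -> sqi h -> ip h (fun x => c * f x) = c * ip h f.
Proof. by move=> *; rewrite ipC ipZl// (ipC h). Qed.

Lemma ip0l h : ip (fun=> 0) h = 0.
Proof.
rewrite /ip; under eq_Rintegral do rewrite mul0r.
by rewrite Rintegral_cst// mul0r.
Qed.

Lemma ip_ge0 f : 0 <= ip f f.
Proof. by apply: Rintegral_ge0 => x _; rewrite -expr2 sqr_ge0. Qed.

Lemma nrm_ge0 f : 0 <= nrm f.
Proof. exact: sqrtr_ge0. Qed.

Lemma sqr_nrm f : nrm f ^+ 2 = ip f f.
Proof. by rewrite sqr_sqrtr// ip_ge0. Qed.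

Lemma ipDD f g c : sqi f -> sqi g ->
  ip (fun x => f x + c * g x) (fun x => f x + c * g x) =
  ip f f + 2 * c * ip f g + c ^+ 2 * ip g g.
Proof.
move=> sf sg; have scg := sqiZ c sg; have sfcg := sqiD sf scg.
rewrite ipDl// !ipDr// !ipZl// !ipZr// (ipC g f); ring.
Qed.

(** The polynomial |f + c g|^2 in c is nonnegative; its value at the minimiser gives the inequality
    when |g| is not 0. *)
Lemma CauchySchwarz f g : sqi f -> sqi g -> `|ip f g| <= nrm f * nrm g.
Proof.
move=> sf sg; rewrite -(@ler_pXn2r _ 2)//; last first.
  by rewrite nnegrE mulr_ge0// nrm_ge0.
rewrite exprMn !sqr_nrm real_normK ?num_real//.
have H c : 0 <= ip f f + 2 * c * ip f g + c ^+ 2 * ip g g.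
  by rewrite -ipDD//; exact: ip_ge0.
have [g0|g0] := eqVneq (ip g g) 0.
  rewrite g0 mulr0; have [->|fg0] := eqVneq (ip f g) 0; first by rewrite expr0n.
  (* For |g| = 0 the polynomial is affine in c, and this c gives it the value -1. *)
  have := H (- (ip f f + 1) / (2 * ip f g)); rewrite g0 mulr0 addr0.
  have -> : 2 * (- (ip f f + 1) / (2 * ip f g)) * ip f g = - (ip f f + 1).
    by field.
  by have := ip_ge0 f; lra.
have gp : 0 < ip g g by rewrite lt_def g0 ip_ge0.
have := H (- ip f g / ip g g).
have -> : ip f f + 2 * (- ip f g / ip g g) * ip f g +
    (- ip f g / ip g g) ^+ 2 * ip g g = (ip f f * ip g g - ip f g ^+ 2) / ip g g.
  by field.
by rewrite pmulr_lge0 ?invr_gt0// subr_ge0.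
Qed.

Lemma nrmD f g : sqi f -> sqi g -> nrm (fun x => f x + g x) <= nrm f + nrm g.
Proof.
move=> sf sg; rewrite -(@ler_pXn2r _ 2)// ?nnegrE ?addr_ge0 ?nrm_ge0//.
have := ipDD 1 sf sg; under [in X in X = _]eq_fun do rewrite mul1r.
rewrite sqr_nrm => ->; rewrite sqrrD !sqr_nrm expr1n mul1r mulr1.
rewrite lerD2r lerD2l -[leRHS]mulr_natl ler_pM2l//.
exact: le_trans (ler_norm _) (CauchySchwarz sf sg).
Qed.

Lemma nrmZ c f : sqi f -> nrm (fun x => c * f x) = `|c| * nrm f.
Proof.
move=> sf; rewrite /nrm ipZl ?ipZr//; last exact: sqiZ.
by rewrite mulrA -expr2 sqrtrM ?sqr_ge0// sqrtr_sqr.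
Qed.

Lemma nrmN f : sqi f -> nrm (fun x => - f x) = nrm f.
Proof.
by move=> _; rewrite /nrm /ip; under eq_Rintegral do rewrite mulrNN.
Qed.

Lemma nrmB f g : sqi f -> sqi g -> nrm (fun x => f x - g x) <= nrm f + nrm g.
Proof. by move=> sf sg; rewrite -(nrmN sg); apply: nrmD => //; exact: sqiN. Qed.

Lemma nrmBC f g : nrm (fun x => f x - g x) = nrm (fun x => g x - f x).
Proof.
by rewrite /nrm /ip; under eq_Rintegral do rewrite -mulrNN !opprB.
Qed.

Lemma nrm_subxx f : nrm (fun x => f x - f x) = 0.
Proof.
rewrite (_ : (fun x => _) = fun=> 0); last by apply/funext => x; rewrite subrr.
by rewrite /nrm ip0l sqrtr0.
Qed.

Lemma nrm_triangle f g h : sqi f -> sqi g -> sqi h ->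
  nrm (fun x => f x - h x) <=
  nrm (fun x => f x - g x) + nrm (fun x => g x - h x).
Proof.
move=> sf sg sh.
have -> : (fun x => f x - h x) = (fun x => (f x - g x) + (g x - h x)).
  by apply/funext => x; rewrite subrKA.
by apply: nrmD; exact: sqiB.
Qed.

Lemma ip_ae_eq f f' g g' : {ae mu, forall x, f x = f' x} ->
  {ae mu, forall x, g x = g' x} ->
  measurable_fun setT f -> measurable_fun setT f' ->
  measurable_fun setT g -> measurable_fun setT g' ->
  ip f g = ip f' g'.
Proof.
move=> ff' gg' mf mf' mg mg'; rewrite /ip /Rintegral; congr fine.
apply: ae_eq_integral => //.
- by apply/measurable_EFinP; exact: measurable_funM.
- by apply/measurable_EFinP; exact: measurable_funM.
- by apply: filterS2 ff' gg' => x -> -> _.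
Qed.

Lemma nrm_ae_eq f g : {ae mu, forall x, f x = g x} ->
  measurable_fun setT f -> measurable_fun setT g -> nrm f = nrm g.
Proof. by move=> fg mf mg; rewrite /nrm (ip_ae_eq fg fg). Qed.

End square_integrable.

(** * Convergence and completeness in L^2 *)

Section L2_convergence.
Context d (T : measurableType d) (R : realType).
Variable mu : {measure set T -> \bar R}.
Implicit Types f g h : T -> R.
Local Notation sqi := (sqi mu).
Local Notation ip := (ip mu).
Local Notation nrm := (nrm mu).

Lemma Lfun2P f : f \in Lfun mu 2%:E <-> sqi f.
Proof.
split=> [fL|[mf if2]].
  split; last exact: Lfun2_integrable_sqr.
  by move: fL; rewrite inE => /andP[]; rewrite inE.
rewrite inE; apply/andP; split; rewrite inE//= /finite_norm unlock.
apply: poweR_lty; move/integrableP : if2 => [_].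
apply: le_lt_trans; rewrite le_eqVlt; apply/orP; left; apply/eqP.
apply: eq_integral => x _ /=.
by rewrite powR_mulrn// normrX.
Qed.

Lemma L2norm_nrm f : sqi f -> L2norm mu f = (nrm f)%:E.
Proof.
move=> sf; have [mf if2] := sf; rewrite /L2norm unlock /=.
have -> : (\int[mu]_x (`|(f x)%:E| `^ 2))%E = (ip f f)%:E.
  have fin := integrable_fin_num measurableT if2.
  rewrite /ip /Rintegral fineK; last by under eq_integral do rewrite -expr2.
  apply: eq_integral => x _ /=.
  by rewrite powR_mulrn// real_normK ?num_real// expr2.
by rewrite poweR_EFin powR12_sqrt// ip_ge0.
Qed.

(** Stated for any proper filter because it serves sequences as well as one-sided and punctured
    limits in time. The difference of the two inner products splits into three terms, each
    controlled by Cauchy-Schwarz. *)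
Lemma cvg_nrm_ip (I : Type) (F : set_system I) {FF : ProperFilter F}
    (u v : I -> T -> R) f g :
  (\forall k \near F, sqi (u k)) -> (\forall k \near F, sqi (v k)) ->
  sqi f -> sqi g ->
  nrm (fun x => u k x - f x) @[k --> F] --> 0 ->
  nrm (fun x => v k x - g x) @[k --> F] --> 0 ->
  ip (u k) (v k) @[k --> F] --> ip f g.
Proof.
move=> su sv sf sg uf vg; apply/subr_cvg0/norm_cvg0P.
pose w k := nrm (fun x => u k x - f x) * nrm (fun x => v k x - g x) +
  nrm (fun x => u k x - f x) * nrm g + nrm f * nrm (fun x => v k x - g x).
have w0 : w k @[k --> F] --> 0.
  have -> : (0 : R) = 0 * 0 + 0 * nrm g + nrm f * 0 by ring.
  by apply: cvgD; [apply: cvgD; apply: cvgM => //; exact: cvg_cst|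
    apply: cvgM => //; exact: cvg_cst].
apply: (@squeeze_cvgr _ _ _ _ (fun=> 0) w) => //; last exact: cvg_cst.
near=> k; have suk : sqi (u k) by near: k.
have svk : sqi (v k) by near: k.
have sa := sqiB suk sf; have sb := sqiB svk sg.
rewrite normr_ge0 /=.
have -> : ip (u k) (v k) - ip f g =
    ip (fun x => u k x - f x) (fun x => v k x - g x) +
    ip (fun x => u k x - f x) g + ip f (fun x => v k x - g x).
  by rewrite ipBl// !ipBr// ipBl//; ring.
rewrite (le_trans (ler_normD _ _))// lerD//.
  rewrite (le_trans (ler_normD _ _))// lerD//; exact: CauchySchwarz.
exact: CauchySchwarz.
Unshelve. all: by end_near. Qed.

Lemma dominated_cvg_nrm (u : nat -> T -> R) f g :
  (forall k, measurable_fun setT (u k)) -> measurable_fun setT f ->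
  sqi g -> (forall k x, `|u k x| <= g x) ->
  (forall x, u k x @[k --> \oo] --> f x) ->
  sqi f /\ nrm (fun x => u k x - f x) @[k --> \oo] --> 0.
Proof.
move=> mu_ mf sg ug uf.
have fg x : `|f x| <= g x.
  apply: (@cvgr_to_le _ \oo _ _ (fun k => `|u k x|)); last exact: nearW.
  by apply: cvg_norm; exact: uf.
have sf : sqi f.
  apply: (le_sqi mf) sg => x; apply: (le_trans (fg x)).
  exact: ler_norm.
split=> //.
(* Both [u k] and the limit are bounded by [g], hence the dominating function 4 g^2 for the squared
   difference. *)
have [] := @dominated_convergence _ _ _ mu setT measurableT
  (fun k x => ((u k x - f x) ^+ 2)%:E) (fun=> 0%E)
  (fun x => 4%:E * (g x ^+ 2)%:E)%E.
- move=> k; apply/measurable_EFinP; apply: measurable_funX.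
  exact: measurable_funB.
- exact: measurable_cst.
- apply/aeW => x _; apply: cvg_EFin; first exact: nearW.
  rewrite [X in _ --> X](_ : 0 = (f x - f x) ^+ 2); last by rewrite subrr expr0n.
  apply: (@cvg_comp _ _ _ (fun k => u k x - f x) (fun y => y ^+ 2)); last first.
    exact: exprn_continuous.
  by apply: cvgB => //; exact: cvg_cst.
- by apply: integrableZl => //; case: sg.
- apply/aeW => x k _; rewrite /= lee_fin ger0_norm ?sqr_ge0//.
  have := ug k x; have := fg x; rewrite !ler_norml => /andP[a b] /andP[c e].
  by nra.
move=> _ _ h.
rewrite /nrm -[X in _ --> X](@sqrtr0 R).
apply: (@cvg_comp _ _ _ (fun k => ip (fun x => u k x - f x)
  (fun x => u k x - f x)) Num.sqrt); last exact: sqrt_continuous.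
rewrite integral0 in h.
have h2 : (fine \o (fun n => \int[mu]_x ((u n x - f x) ^+ 2)%:E)%E) n
  @[n --> \oo] --> (0 : R) by exact: fine_cvg h.
exact: h2.
Unshelve. all: by end_near. Qed.

(** The sequence a_j + 2 c / 2^j is nonincreasing and bounded below, hence convergent, and the
    telescoped bound passes to the limit with its explicit rate. *)
Lemma geometric_cauchy_cvg (a : nat -> R) (c : R) :
  (forall j, `|a j.+1 - a j| <= c / 2 ^+ j) ->
  exists2 l : R, a j @[j --> \oo] --> l &
    forall j, `|a j - l| <= 2 * c / 2 ^+ j.
Proof.
move=> ac.
have h j m : `|a (j + m)%N - a j| <= 2 * c / 2 ^+ j - 2 * c / 2 ^+ (j + m).
  elim: m => [|m IH]; first by rewrite addn0 !subrr normr0.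
  rewrite addnS -(subrKA (a (j + m)%N)) (le_trans (ler_normD _ _))//.
  have := ac (j + m)%N; rewrite exprS invfM; set e := 2 ^+ _ => h.
  by move: h IH; rewrite -/e; lra.
have c0 : 0 <= c by have := ac 0%N; rewrite expr0 divr1; exact: le_trans.
have p j : 0 <= 2 * c / 2 ^+ j by rewrite mulr_ge0 ?mulr_ge0// invr_ge0 exprn_ge0.
have cv : cvgn (fun j => a j + 2 * c / 2 ^+ j).
  apply: nonincreasing_is_cvgn.
    move=> j k jk; rewrite -(subnKC jk); have := h j (k - j)%N.
    by rewrite ler_norml => /andP[_]; lra.
  exists (a 0%N - 2 * c) => _ [j _ <-]; have := h 0%N j; have := p j.
  by rewrite add0n expr0 divr1 ler_norml => ? /andP[+ _]; lra.
have z : 2 * c / 2 ^+ j @[j --> \oo] --> (0 : R).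
  rewrite (_ : (fun j => _) = geometric (2 * c) 2^-1).
    by apply: cvg_geometric; rewrite ger0_norm//; lra.
  by apply/funext => j; rewrite /= exprVn.
have [l al] : exists l : R, a j @[j --> \oo] --> l.
  exists (limn (fun j => a j + 2 * c / 2 ^+ j) - 0).
  rewrite (_ : (fun j => a j) = fun j => (a j + 2 * c / 2 ^+ j) - 2 * c / 2 ^+ j).
    exact: cvgB cv z.
  by apply/funext => j; rewrite addrK.
exists l => // j; apply: (@cvgr_to_le _ \oo _ _ (fun k => `|a j - a k|)).
  by apply: cvg_norm; apply: cvgB => //; exact: cvg_cst.
near=> k; have jk : (j <= k)%N by near: k; exact: nbhs_infty_ge.
by rewrite -(subnKC jk) distrC (le_trans (h _ _))// gerBl.
Unshelve. all: by end_near. Qed.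

(** With increments w_j of norm at most 4^(-j), the weighted series S = sum 4^j w_j^2 has integral
    at most sum 4^(-j) <= 2, so S is finite almost everywhere. There |w_j| <= S^(1/2) / 2^j, which
    gives the pointwise limit and, after integration, the rate in norm. *)
Lemma L2_complete_fast (v : nat -> T -> R) : (forall j, sqi (v j)) ->
  (forall j, nrm (fun x => v j.+1 x - v j x) <= 4^-1 ^+ j) ->
  exists2 f, sqi f & exists c : R, forall j, nrm (fun x => v j x - f x) <= c / 2 ^+ j.
Proof.
move=> sv vv; pose w j x := v j.+1 x - v j x.
have sw j : sqi (w j) by exact: sqiB.
pose S x : \bar R := (\sum_(0 <= j <oo) (4 ^+ j * w j x ^+ 2)%:E)%E.
have wge0 j x : (0 <= (4 ^+ j * w j x ^+ 2)%:E)%E.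
  by rewrite lee_fin mulr_ge0// ?sqr_ge0// exprn_ge0.
have mw j : measurable_fun setT (fun x => (4 ^+ j * w j x ^+ 2)%:E).
  apply/measurable_EFinP; apply: measurable_funM => //.
  by apply: measurable_funX; case: (sw j).
have S0 x : (0 <= S x)%E by apply: nneseries_ge0 => n _ _; exact: wge0.
have mS : measurable_fun setT S by apply: ge0_emeasurable_sum => //.
have iS : (\int[mu]_x S x <= 2%:E)%E.
  rewrite integral_nneseries//; apply: lime_le.
    by apply: is_cvg_nneseries => n _ _; exact: integral_ge0.
  apply: nearW => n.
  apply: (@le_trans _ _ (\sum_(0 <= j < n) (4^-1 ^+ j)%:E)%E).
    apply: lee_sum => j _; have [mwj iwj] := sw j.
    under eq_integral do rewrite EFinM.
    rewrite integralZl//; have fin := integrable_fin_num measurableT iwj.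
    rewrite -(fineK fin) -EFinM lee_fin.
    have -> : fine (\int[mu]_x (w j x ^+ 2)%:E)%E = nrm (w j) ^+ 2.
      by rewrite sqr_nrm.
    have : nrm (w j) ^+ 2 <= (4^-1 ^+ j) ^+ 2.
      have h := vv j; have p := nrm_ge0 mu (w j).
      by rewrite !expr2; apply: ler_pM.
    rewrite [in leRHS]expr2; set e := 4^-1 ^+ j => h.
    have -> : 4 ^+ j = e^-1 by rewrite /e exprVn invrK.
    have e0 : 0 < e by rewrite exprn_gt0// invr_gt0.
    by rewrite mulrC ler_pdivrMr// (le_trans h).
  rewrite sumEFin lee_fin.
  have -> : \sum_(0 <= i < n) 4^-1 ^+ i = 4 / 3 * (1 - 4^-1 ^+ n) :> R.
    elim: n => [|n IH]; first by rewrite big_nil expr0 subrr mulr0.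
    by rewrite big_nat_recr//= IH exprS; field.
  have : 0 <= 4^-1 ^+ n :> R by rewrite exprn_ge0// invr_ge0.
  by move: (4^-1 ^+ n) => q; lra.
have intS : mu.-integrable setT S.
  apply/integrableP; split => //; under eq_integral => x _ do rewrite gee0_abs//.
  exact: le_lt_trans iS (ltry _).
have finS := integrable_ae measurableT intS.
(* An upper limit, so that [f] is defined and measurable everywhere; it is the actual limit wherever
   [S] is finite. *)
pose f x : R := fine (limn_esup (fun j => (v j x)%:E)).
have mf : measurable_fun setT f.
  apply: (measurableT_comp (fine_measurable _)) => //.
  apply: measurable_fun_limn_esup => j; apply/measurable_EFinP.
  by case: (sv j).
have key : {ae mu, forall x, forall j,
    ((v j x - f x) ^+ 2)%:E <= ((2 / 2 ^+ j) ^+ 2)%:E * S x}%E.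
  apply: filterS finS => x /(_ I) fx j.
  have wS i : `|v i.+1 x - v i x| <= Num.sqrt (fine (S x)) / 2 ^+ i.
    have h : 4 ^+ i * w i x ^+ 2 <= fine (S x).
      rewrite -lee_fin fineK//; apply: le_trans (nneseries_lim_ge i.+1 _) => //.
      by rewrite big_nat_recr//= leeDr// sume_ge0.
    rewrite ler_pdivlMr ?exprn_gt0// -(@ler_pXn2r _ 2)//; first last.
    - by rewrite nnegrE sqrtr_ge0.
    - by rewrite nnegrE mulr_ge0// exprn_ge0.
    rewrite exprMn real_normK ?num_real// sqr_sqrtr ?fine_ge0//.
    by rewrite -exprM mulnC exprM (_ : 2 ^+ 2 = 4) 1?mulrC//; ring.
  have [l vl dl] := geometric_cauchy_cvg wS.
  have fl : f x = l.
    rewrite /f (@cvg_limn_einf_sup _ _ l%:E)//.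
    by apply: cvg_EFin => //; exact: nearW.
  rewrite fl -[X in (_ <= _ * X)%E](fineK fx) -EFinM lee_fin.
  have := dl j; have h0 := normr_ge0 (v j x - l).
  move=> h; have := ler_pM h0 h0 h h; rewrite -!expr2 real_normK ?num_real//.
  move=> {}h; apply: (le_trans h); rewrite mulrAC !exprMn sqr_sqrtr ?fine_ge0//.
have le2 j : (\int[mu]_x ((v j x - f x) ^+ 2)%:E <= ((2 / 2 ^+ j) ^+ 2 * 2)%:E)%E.
  rewrite EFinM; apply: (@le_trans _ _ (((2 / 2 ^+ j) ^+ 2)%:E * \int[mu]_x S x)%E).
    rewrite -integralZl//; apply: ae_ge0_le_integral => //.
    - by move=> x _; rewrite lee_fin sqr_ge0.
    - apply/measurable_EFinP; apply: measurable_funX; apply: measurable_funB => //.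
      by case: (sv j).
    - by move=> x _; rewrite mule_ge0// lee_fin sqr_ge0.
    - exact: measurable_funeM.
    - by apply: filterS key => x + _; apply.
  by rewrite lee_pmul// ?integral_ge0// lee_fin sqr_ge0.
have svf j : sqi (fun x => v j x - f x).
  split; first by apply: measurable_funB => //; case: (sv j).
  apply/integrableP; split.
    apply/measurable_EFinP; apply: measurable_funX; apply: measurable_funB => //.
    by case: (sv j).
  under eq_integral => x _ do rewrite gee0_abs ?lee_fin ?sqr_ge0//.
  exact: le_lt_trans (le2 j) (ltry _).
exists f.
  have := sqiB (sv 0%N) (svf 0%N).
  by under eq_fun do rewrite subKr.
exists (2 * Num.sqrt 2) => j.
rewrite -(@ler_pXn2r _ 2)// ?nnegrE ?nrm_ge0//.
rewrite sqr_nrm -lee_fin /ip /Rintegral fineK; last first.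
  by under eq_integral do rewrite -expr2; exact: integrable_fin_num (svf j).2.
under eq_integral do rewrite -expr2.
apply: le_trans (le2 j) _; rewrite lee_fin.
by rewrite [X in _ <= X ^+ 2]mulrAC [leRHS]exprMn sqr_sqrtr.
Qed.

Lemma L2_complete (u : nat -> T -> R) : (forall k, sqi (u k)) ->
  (forall e : R, 0 < e -> exists N, forall m k, (N <= m)%N -> (N <= k)%N ->
    nrm (fun x => u m x - u k x) <= e) ->
  exists2 f, sqi f & nrm (fun x => u k x - f x) @[k --> \oo] --> 0.
Proof.
move=> su cu.
have p j : 0 < 4^-1 ^+ j :> R by rewrite exprn_gt0// invr_gt0.
have /choice[N hN] : forall j, exists N, forall m k, (N <= m)%N -> (N <= k)%N ->
    nrm (fun x => u m x - u k x) <= 4^-1 ^+ j by move=> j; exact: cu.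
(* Taking the maximum with the previous index makes [n j] and [n j.+1] both at least [N j], as the
   bound on consecutive differences requires. *)
pose n := fix n j := if j is i.+1 then maxn (N j) (n i) else N 0%N.
have nN j : (N j <= n j)%N by case: j => [//|j]; exact: leq_maxl.
have nn j : (N j <= n j.+1)%N.
  by rewrite (leq_trans (nN j))//; exact: leq_maxr.
have [f sf [c hc]] := @L2_complete_fast (fun j => u (n j)) (fun j => su _)
  (fun j => hN j _ _ (nn j) (nN j)).
exists f => //; apply/cvgrPdist_le => e e0.
have e20 : 0 < e / 2 by rewrite divr_gt0.
have [j hj1 hj2] : exists2 j, c / 2 ^+ j <= e / 2 & 4^-1 ^+ j <= e / 2.
  have z a r : 0 <= r -> r < 1 -> \forall j \near \oo, a * r ^+ j <= e / 2 :> R.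
    move=> r0 r1; have := @cvg_geometric R a r.
    rewrite ger0_norm// => /(_ r1) /cvgr_le h.
    by have := h _ e20; apply: filterS.
  have z1 : \forall j \near \oo, c * 2^-1 ^+ j <= e / 2 by apply: z; lra.
  have z2 : \forall j \near \oo, 1 * 4^-1 ^+ j <= e / 2 by apply: z; lra.
  have [j [h1 h2]] := @filter_ex _ _ _ _ (filterI z1 z2).
  by exists j; rewrite -?exprVn// -[leLHS]mul1r.
near=> k; rewrite sub0r normrN ger0_norm ?nrm_ge0//.
have sn := su (n j).
rewrite (le_trans (nrm_triangle (su k) sn sf))// (splitr e) lerD//.
  apply: le_trans hj2; apply: hN; last exact: nN.
  by near: k; exact: nbhs_infty_ge.
exact: le_trans (hc j) hj1.
Unshelve. all: by end_near. Qed.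

End L2_convergence.

(** * Lebesgue measure on row vectors *)

Section measurability.
Context (R : realType) (n : nat).
Local Notation rV := 'rV[R]_n.

Lemma measurable_coords (A : 'I_n -> set R) : (forall i, measurable (A i)) ->
  measurable [set x : rV | forall i, A i (x ord0 i)].
Proof.
move=> mA.
rewrite (_ : [set x : rV | _] = \big[setI/setT]_(i < n) ((fun x : rV => x ord0 i) @^-1` A i)).
  apply: bigsetI_measurable => i _; rewrite -[X in measurable X]setTI.
  exact: measurable_coord.
rewrite -bigcap_seq; apply/seteqP; split=> x /= h i; first by move=> _; exact: h.
by apply: h; rewrite /= mem_index_enum.
Qed.

(** The measurable sets are generated by the coordinates alone, so an open set is written as a
    countable union of open cubes with rational centre and half-side 1/(k+1). *)
Lemma open_measurable_rV (U : set rV) : open U -> measurable U.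
Proof.
move=> oU.
pose B (p : 'rV[rat]_n * nat) : set rV :=
  [set x | forall i, `](ratr (p.1 ord0 i) - p.2.+1%:R^-1), (ratr (p.1 ord0 i) + p.2.+1%:R^-1)[%classic (x ord0 i)].
rewrite (_ : U = \bigcup_(p in [set p | B p `<=` U]) B p).
  rewrite bigcup_mkcond; apply: countable_bigcupT_measurable; first exact: countableP.
  move=> p; case: ifP => _ //.
  apply: (@measurable_coords (fun i => `](ratr (p.1 ord0 i) - p.2.+1%:R^-1), (ratr (p.1 ord0 i) + p.2.+1%:R^-1)[%classic)) => i.
  exact: measurable_itv.
apply/seteqP; split=> [x Ux|x [p]]; last by apply.
have /nbhs_ballP[e /= e0 he] : nbhs x U by exact: open_nbhs_nbhs.
have [k hk] : exists k : nat, 2 / k.+1%:R < e.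
  exists (Num.bound (2 / e)); rewrite ltr_pdivrMr//.
  rewrite mulrC -ltr_pdivrMr//; have := archi_boundP (ltW (divr_gt0 (ltr0Sn _ 1) e0)).
  by move/lt_trans; apply; rewrite ltr_nat.
have k0 : 0 < k.+1%:R^-1 :> R by rewrite invr_gt0.
have /choice[q hq] : forall i, exists q : rat, ratr q \in `](x ord0 i - k.+1%:R^-1), (x ord0 i + k.+1%:R^-1)[.
  by move=> i; apply: rat_in_itvoo; move: k0; move: (k.+1%:R^-1) => d; lra.
exists (\row_i q i, k) => /=.
  move=> y hy; apply: he; split=> // j i; have -> : j = ord0 by apply/val_inj; case: j => [[]].
  rewrite /ball /=.
  have := hy i; have := hq i; rewrite /= !mxE !in_itv /= ltr_norml => h1 h2.
  by move: h1 h2 hk; move: (k.+1%:R^-1) => d; lra.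
move=> i; have := hq i; rewrite /= mxE !in_itv /=.
by move: (k.+1%:R^-1) => d; lra.
Qed.

Lemma closed_measurable_rV (A : set rV) : closed A -> measurable A.
Proof.
by move=> cA; rewrite -(setCK A); apply: measurableC; apply: open_measurable_rV;
  exact: closed_openC.
Qed.

Lemma compact_measurable_rV (A : set rV) : compact A -> measurable A.
Proof.
move=> cA; apply: closed_measurable_rV; apply: compact_closed => //.
Qed.

Lemma continuous_measurable_rV (f : rV -> R) : continuous f ->
  measurable_fun setT f.
Proof.
move=> cf; apply: (measurability _ (RGenOpens.measurableE R)) => _ [_ [a [b ->]] <-].
rewrite setTI; apply: open_measurable_rV; apply: open_comp => //.
Qed.

(** Open lower orthants are stable under intersection and generate the measurable sets. Both the
    density argument and the fundamental lemma on weak derivatives test orthants first and conclude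
    by this induction. *)
Lemma orthant_dynkin (H : set (set rV)) : lambda_system setT H ->
  (forall b : rV, H [set x | forall i, x ord0 i < b ord0 i]) ->
  forall A, measurable A -> H A.
Proof.
move=> lH Hb.
pose G := [set A : set rV | exists b : rV, A = [set x | forall i, x ord0 i < b ord0 i]].
have IG : setI_closed G.
  move=> A B [a ->] [b ->]; exists (\row_i Num.min (a ord0 i) (b ord0 i)).
  apply/seteqP; split=> x /=.
    by move=> [xa xb] i; rewrite mxE lt_min xa xb.
  by move=> h; split=> i; have := h i; rewrite mxE lt_min => /andP[].
have := @lambda_system_subset _ G IG setT H lH _ _.
have GH : G `<=` H by move=> _ [b ->].
move=> /(_ GH (fun _ _ => @subsetT _ _)) sub A mA; apply: sub.
move: A mA; apply: smallest_sub; first exact: smallest_sigma_algebra.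
move=> A; rewrite -bigcup_seq/= => -[i _ [Y mY <-]]; rewrite setTI.
pose S := [set Y : set R | <<s G >> ((fun x : rV => x ord0 i) @^-1` Y)].
suff : measurable `<=` S by apply.
have -> : (measurable : set (set R)) = (@RGenInftyO.G R).-sigma.-measurable.
  exact: RGenInftyO.measurableE.
apply: smallest_sub.
  have [s0 sC sU] := smallest_sigma_algebra setT G.
  split; rewrite /S/=.
  - by rewrite preimage_set0.
  - by move=> B SB; rewrite setTD preimage_setC -setTD; exact: sC.
  - by move=> F SF; rewrite preimage_bigcup; exact: sU.
move=> _ [c ->]; rewrite /S/=.
(* A half-space x_i < c is the union over k of the orthants bounded by c in direction i and by k in
   the other directions. *)
rewrite (_ : _ @^-1` _ = \bigcup_k [set x : rV | forall j, x ord0 j < (\row_j (if j == i then c else k%:R)) ord0 j]).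
  have [s0 sC sU] := smallest_sigma_algebra setT G.
  apply: sU => k; apply: sub_gen_smallest; by eexists.
apply/seteqP; split=> [x /=|x [k _] /= /(_ i)]; last first.
  by rewrite mxE eqxx in_itv.
rewrite in_itv/= => xc.
exists (Num.bound `|x|) => // j; rewrite mxE; case: ifPn => [/eqP->//|_].
rewrite (le_lt_trans (ler_norm _))//.
apply: le_lt_trans (archi_boundP (normr_ge0 x)).
by rewrite [leRHS]/Num.Def.normr/= mx_normrE; apply: le_trans (le_bigmax _ _ (ord0, j)).
Qed.

End measurability.

(** * Iterated integrals, boxes and integrals of partial derivatives *)

Section lebesgue_rV_fubini.
Context (R : realType).

Lemma rV_cons0 n (z : R * 'rV[R]_n) : rV_cons z ord0 ord0 = z.1.
Proof. by rewrite mxE unlift_none. Qed.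

Lemma rV_cons_lift n (z : R * 'rV[R]_n) j : rV_cons z ord0 (lift ord0 j) = z.2 ord0 j.
Proof. by rewrite mxE liftK. Qed.

Lemma ge0_integral_rV_cons n (f : 'rV[R]_n.+1 -> \bar R) :
  measurable_fun setT f -> (forall x, 0 <= f x)%E ->
  (\int[@lebesgue_rV R n.+1]_x f x =
   \int[@lebesgue_measure R \x @lebesgue_rV R n]_z f (rV_cons z))%E.
Proof.
move=> mf f0.
rewrite (@eq_measure_integral _ _ _ _
  (pushforward (@lebesgue_measure R \x @lebesgue_rV R n)%E (@rV_cons R n)))//.
  exact: measurable_rV_cons.
by move=> mc; rewrite (ge0_integral_pushforward mc).
Qed.

Lemma integrable_rV_cons n (f : 'rV[R]_n.+1 -> \bar R) :
  (@lebesgue_rV R n.+1).-integrable setT f ->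
  ((@lebesgue_measure R \x @lebesgue_rV R n)%E.-integrable setT (f \o @rV_cons R n))
  /\ (\int[@lebesgue_rV R n.+1]_x f x =
   \int[@lebesgue_measure R \x @lebesgue_rV R n]_z f (rV_cons z))%E.
Proof.
move=> /integrableP[mf lf]; have mc := @measurable_rV_cons R n.
have i : (@lebesgue_measure R \x @lebesgue_rV R n)%E.-integrable setT (f \o @rV_cons R n).
  apply/integrableP; split; first exact: measurableT_comp mf mc.
  move: lf; rewrite ge0_integral_rV_cons//; exact: measurableT_comp.
split=> //; clear mc.
rewrite (@eq_measure_integral _ _ _ _
  (pushforward (@lebesgue_measure R \x @lebesgue_rV R n)%E (@rV_cons R n)))//.
  exact: measurable_rV_cons.
by move=> mc; rewrite (integral_pushforward mc).
Qed.

(** Tonelli, one coordinate at a time. Only finiteness is recorded: it yields the finite measure of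
    boxes and the integrability of powers of omega. *)
Lemma ge0_lebesgue_rV_prod n (g : 'I_n -> R -> R) :
  (forall i, measurable_fun setT (g i)) -> (forall i t, 0 <= g i t) ->
  (forall i, \int[@lebesgue_measure R]_t (g i t)%:E < +oo)%E ->
  (\int[@lebesgue_rV R n]_x (\prod_(i < n) g i (x ord0 i))%:E < +oo)%E.
Proof.
elim: n g => [|n IH] g mg g0 gi.
  rewrite /= integral_dirac//; last by under eq_fun do rewrite big_ord0; exact: measurable_cst.
  by rewrite big_ord0 diracT mul1e ltry.
have mc m (h : 'I_m -> R -> R) : (forall i, measurable_fun setT (h i)) ->
    measurable_fun setT (fun x : 'rV[R]_m => (\prod_(i < m) h i (x ord0 i))%:E).
  move=> mh; apply/measurable_EFinP; apply: measurable_prod => i _.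
  exact: measurableT_comp (mh i) (measurable_coord i).
rewrite ge0_integral_rV_cons//; last 2 first.
- exact: mc.
- by move=> x; rewrite lee_fin prodr_ge0.
pose h i := g (lift ord0 i).
under eq_integral => z _.
  rewrite big_ord_recl rV_cons0.
  under eq_bigr do rewrite rV_cons_lift.
  over.
rewrite fubini_tonelli1 /fubini_F /=; last 2 first.
- apply/measurable_EFinP; apply: measurable_funM.
    exact: measurableT_comp (mg _) measurable_fst.
  apply: measurable_prod => i _.
  apply: (measurableT_comp (mg _)).
  exact: (measurableT_comp (measurable_coord i) measurable_snd).
- by move=> z; rewrite lee_fin mulr_ge0 ?prodr_ge0.
under eq_integral => t _.
  under eq_integral do rewrite EFinM.
  rewrite ge0_integralZl//; last 3 first.
  - by apply: (mc n h) => i; exact: mg.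
  - by move=> y _; rewrite lee_fin prodr_ge0.
  - by rewrite lee_fin.
  over.
rewrite ge0_integralZr//; last 3 first.
- by apply/measurable_EFinP; exact: mg.
- by move=> t _; rewrite lee_fin.
- by apply: integral_ge0 => y _; rewrite lee_fin prodr_ge0.
apply: lte_mul_pinfty; rewrite ?integral_ge0//.
- by move=> t _; rewrite lee_fin.
- rewrite ge0_fin_numE; first exact: gi.
  by apply: integral_ge0 => t _; rewrite lee_fin.
- by apply: (IH h) => i *; [exact: mg|exact: g0|exact: gi].
Qed.

Definition box n (M : R) : set 'rV[R]_n := [set x | forall i, `|x ord0 i| <= M].

Arguments box : clear implicits.

Lemma measurable_box n M : measurable (box n M).
Proof.
rewrite (_ : box n M = [set x : 'rV[R]_n | forall i, `[-M, M]%classic (x ord0 i)]).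
  by apply: (@measurable_coords _ _ (fun=> `[-M, M]%classic)) => i; exact: measurable_itv.
by apply/seteqP; split=> x h i; have := h i; rewrite /= in_itv/= ler_norml.
Qed.

Lemma compact_box n M : compact (box n M).
Proof.
rewrite (_ : box n M = [set x : 'rV[R]_n | forall i, `[-M, M]%classic (x ord0 i)]).
  by apply: (@rV_compact _ _ (fun=> _)) => i; exact: segment_compact.
by apply/seteqP; split=> x h i; have := h i; rewrite /= in_itv/= ler_norml.
Qed.

Lemma lebesgue_box_lty n M : (@lebesgue_rV R n (box n M) < +oo)%E.
Proof.
pose g : 'I_n -> R -> R := fun=> \1_(`[-M, M]%classic).
have := @ge0_lebesgue_rV_prod n g _ _ _.
have -> : (\int[@lebesgue_rV R n]_x (\prod_(i < n) g i (x ord0 i))%:E)%E =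
    @lebesgue_rV R n (box n M).
  rewrite -[in RHS](setIT (box n M)) -integral_indic//; last exact: measurable_box.
  apply: eq_integral => x _; congr EFin; rewrite /g.
  have [bx|bx] := pselect (box n M x).
    rewrite indicE mem_set// big1// => i _; rewrite indicE mem_set//=.
    by rewrite in_itv/= -ler_norml.
  rewrite indicE memNset//; apply/eqP/prodf_eq0.
  have /existsNP[i xi] := bx; exists i => //; rewrite indicE memNset//=.
  by rewrite in_itv/= -ler_norml.
apply=> i; first exact: measurable_indic.
  by move=> t; rewrite /g indicE.
rewrite /g integral_indic//= setIT lebesgue_measure_itv/=.
by case: ifP => _; rewrite ?ltry// -EFinB ltry.
Qed.

(** A working form of compact support: it is stable under sums, products and partial derivatives by
    pointwise arguments. [bsupp_compact] gives the equivalence. *)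
Definition bsupp n (F : 'rV[R]_n -> R) :=
  exists M, forall x, F x != 0 -> box n M x.

Lemma bsupp_gt0 n (F : 'rV[R]_n -> R) : bsupp F ->
  exists2 M, 0 < M & forall x, F x != 0 -> box n M x.
Proof.
move=> [M hM]; exists (`|M| + 1) => [|x /hM h i]; first by rewrite ltr_wpDl.
by apply: le_trans (h i) _; rewrite (le_trans (ler_norm _))// lerDl.
Qed.

Lemma continuous_bounded_bsupp n (F : 'rV[R]_n -> R) : continuous F -> bsupp F ->
  exists2 C, 0 <= C & forall x, `|F x| <= C.
Proof.
move=> cF [M hM].
have /compact_bounded[C0 [_ hC]] : compact (F @` box n M).
  apply: continuous_compact; last exact: compact_box.
  exact: continuous_subspaceT.
have hC' : forall y, (F @` box n M) y -> `|y| <= `|C0| + 1.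
  by apply: hC; rewrite (le_lt_trans (ler_norm _))// ltrDl.
exists (`|C0| + 1); first by rewrite addr_ge0.
move=> x; have [->|Fx] := eqVneq (F x) 0; first by rewrite normr0 addr_ge0.
by apply: hC'; exists x => //; exact: hM.
Qed.

Lemma integrable_bsupp n (F : 'rV[R]_n -> R) : continuous F -> bsupp F ->
  (@lebesgue_rV R n).-integrable setT (EFin \o F).
Proof.
move=> cF bF; have [C C0 hC] := continuous_bounded_bsupp cF bF.
have [M hM] := bF.
apply: (@le_integrable _ _ _ _ setT measurableT _ (fun x => (C * \1_(box n M) x)%:E)).
- by apply/measurable_EFinP; exact: continuous_measurable_rV.
- move=> x _ /=; rewrite lee_fin normrM (ger0_norm C0).
  have [->|Fx] := eqVneq (F x) 0; first by rewrite normr0 mulr_ge0.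
  by rewrite indicE mem_set ?normr1 ?mulr1//; exact: hM.
- under eq_fun do rewrite EFinM; apply: integrableZl => //.
  have mb : measurable_fun setT (fun x => (\1_(box n M) x : R)%:E).
    by apply/measurable_EFinP; apply: measurable_indic; exact: measurable_box.
  apply/integrableP; split=> //.
  under eq_integral => x _ do rewrite gee0_abs ?lee_fin//.
  rewrite integral_indic//; last exact: measurable_box.
  by rewrite setIT; exact: lebesgue_box_lty.
Qed.

Lemma delta_lift_cons n (j : 'I_n) (t h : R) (y : 'rV[R]_n) :
  rV_cons (t, h *: delta_mx ord0 j + y) =
  h *: delta_mx ord0 (lift ord0 j) + rV_cons (t, y).
Proof.
apply/rowP => k; rewrite !mxE.
case: unliftP => [l ->|->] /=; rewrite ?mxE ?eqxx /=.
  by rewrite (inj_eq lift_inj).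
by rewrite mulr0 add0r.
Qed.

Lemma delta_ord0_cons n (t h : R) (y : 'rV[R]_n) :
  rV_cons (h + t, y) = h *: delta_mx ord0 ord0 + rV_cons (t, y).
Proof.
apply/rowP => k; rewrite !mxE.
case: unliftP => [l ->|->] /=; rewrite ?mxE ?eqxx /=.
  by rewrite mulr0 add0r.
by rewrite mulr1.
Qed.

Lemma cvg_rV (T : Type) (G : set_system T) {FG : Filter G} m
    (f : T -> 'rV[R]_m) (l : 'rV[R]_m) :
  (forall i, f t ord0 i @[t --> G] --> l ord0 i) -> f t @[t --> G] --> l.
Proof.
move=> fl; apply/cvgrPdist_le => e e0; near=> t.
rewrite [leLHS]/Num.Def.normr/= mx_normrE (bigmax_le _ (ltW e0))//= => -[i0 i] _.
rewrite !mxE/=; have {i0}-> : i0 = ord0 by apply/val_inj; case: i0 => [[]].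
move: i; near: t; apply: filter_forall => /= i.
by have /cvgrPdist_le := fl i; apply.
Unshelve. all: by end_near. Qed.

Lemma bsupp_partial n (F : 'rV[R]_n -> R) i : bsupp F -> bsupp (partial i F).
Proof.
move=> [M hM]; exists M => x; apply: contra_neqP => /existsNP[j /negP].
rewrite -ltNge => xj.
rewrite /partial (@near_eq_derive _ _ _ F (cst 0)) ?derive_cst//.
near=> y; apply/eqP; apply: contraT => /hM /(_ j); rewrite leNgt => /negP[].
near: y; apply: (@cvgr_gt _ _ _ _ (fun y : 'rV[R]_n => `|y ord0 j|) `|x ord0 j|) => //.
by apply: cvg_norm; exact: coord_continuous.
Unshelve. all: by end_near. Qed.

(** The fundamental theorem of calculus on an interval [-A, A] reaching beyond the support, where
    both boundary values vanish. *)
Lemma integral_line0 (F : R -> R) : (forall t, derivable F t 1) ->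
  continuous (fun t => 'D_1 F t) -> (exists M, forall t, F t != 0 -> `|t| <= M) ->
  (\int[@lebesgue_measure R]_t ('D_1 F t)%:E = 0)%E.
Proof.
move=> dF cdF [M hM].
have F0 t : M < `|t| -> F t = 0.
  by move=> Mt; apply/eqP; apply: contraT => /hM; rewrite leNgt Mt.
have dF0 t : M < `|t| -> 'D_1 F t = 0.
  move=> Mt; rewrite (@near_eq_derive _ _ _ F (cst 0)) ?derive_cst//.
  near=> y; apply: F0; near: y.
  apply: (@cvgr_gt _ _ _ _ (fun y : R => `|y|) `|t|) => //.
  by apply: cvg_norm; exact: cvg_id.
have cF : continuous F.
  by move=> t; apply: differentiable_continuous; apply/derivable1_diffP.
pose A := `|M| + 1.
have A0 : 0 < A by rewrite ltr_wpDl.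
have MA : M < A by rewrite (le_lt_trans (ler_norm _))// ltrDl.
have -> : (fun t => ('D_1 F t)%:E) = (fun t => ('D_1 F t)%:E) \_ `[- A, A].
  apply/funext => t; rewrite patchE; case: ifPn => //; rewrite notin_setE/= in_itv/=.
  rewrite -ler_norml => /negP; rewrite -ltNge => At; rewrite dF0//.
  exact: lt_trans At.
rewrite -integral_mkcond (@continuous_FTC2 _ _ F).
- by rewrite !F0 ?subee ?normrN// gtr0_norm.
- by lra.
- by apply: continuous_subspaceT.
- split; [by move=> ? _; exact: dF|apply: cvg_at_right_filter; exact: cF|].
  by apply: cvg_at_left_filter; exact: cF.
- by move=> t _; rewrite derive1E.
Unshelve. all: by end_near. Qed.

(** Fubini in the order dictated by the variable: for the first coordinate the inner integral is
    over that line and vanishes; for another coordinate the first one is frozen and the induction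
    hypothesis applies to the slice. *)
Lemma integral_partial0 n (i : 'I_n) (F : 'rV[R]_n -> R) :
  continuous F -> (forall x, derivable F x (delta_mx ord0 i)) ->
  continuous (partial i F) -> bsupp F ->
  (\int[@lebesgue_rV R n]_x (partial i F x)%:E = 0)%E.
Proof.
elim: n i F => [|n IH] i F cF dF cdF bF; first by case: (i) => [[]].
have ip := integrable_bsupp cdF (bsupp_partial i bF).
have [ic ->] := integrable_rV_cons ip.
have [M M0 hM] := bsupp_gt0 bF.
case: (unliftP ord0 i) => [j|] ei; rewrite {i}ei in dF cdF ip ic *.
  rewrite -(integral12_prod_meas1 ic) /fubini_F /=.
  apply: integral0_eq => t _.
  pose G (y : 'rV[R]_n) := F (rV_cons (t, y)).
  have cons_t : continuous (fun y : 'rV[R]_n => rV_cons (t, y)).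
    move=> y; apply: (@cvg_rV _ (nbhs y) _) => i; rewrite !mxE; under eq_fun do rewrite mxE.
    case: (unlift ord0 i) => [k|]/=; last exact: cvg_cst.
    exact: coord_continuous.
  have dq (y : 'rV[R]_n) :
      (fun h => h^-1 *: ((G \o shift y) (h *: delta_mx ord0 j) - G y)) =
      (fun h => h^-1 *: ((F \o shift (rV_cons (t, y)))
         (h *: delta_mx ord0 (lift ord0 j)) - F (rV_cons (t, y)))).
    by apply/funext => h; rewrite /= /G delta_lift_cons.
  have pG (y : 'rV[R]_n) : partial j G y = partial (lift ord0 j) F (rV_cons (t, y)).
    by rewrite /partial /derive dq.
  have -> : (fun y => (partial (lift ord0 j) F (rV_cons (t, y)))%:E) =
      (fun y => (partial j G y)%:E) by apply/funext => y; rewrite pG.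
  apply: IH.
  - by move=> y; apply: (continuous_comp (cons_t y)); exact: cF.
  - by move=> y; rewrite /derivable dq; exact: dF.
  - rewrite (_ : partial j G = partial (lift ord0 j) F \o (fun y => rV_cons (t, y))).
      by move=> y; apply: (continuous_comp (cons_t y)); exact: cdF.
    by apply/funext => y; rewrite pG.
  - exists M => y /hM h k; have := h (lift ord0 k).
    by rewrite rV_cons_lift.
rewrite -(integral21_prod_meas1 ic) /fubini_G /=.
apply: integral0_eq => y _.
pose G t := F (rV_cons (t, y)).
have dq t : (fun h => h^-1 *: ((G \o shift t) (h *: 1) - G t)) =
    (fun h => h^-1 *: ((F \o shift (rV_cons (t, y)))
       (h *: delta_mx ord0 ord0) - F (rV_cons (t, y)))).
  by apply/funext => h; rewrite /= /G -delta_ord0_cons [_%:A]mulr1.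
have pG t : 'D_1 G t = partial ord0 F (rV_cons (t, y)).
  by rewrite /partial /derive dq.
have -> : (fun t => (partial ord0 F (rV_cons (t, y)))%:E) =
    (fun t => ('D_1 G t)%:E) by apply/funext => t; rewrite pG.
apply: integral_line0.
- by move=> t; rewrite /derivable dq; exact: dF.
- rewrite (_ : (fun t => 'D_1 G t) = partial ord0 F \o (fun t => rV_cons (t, y))).
    move=> t; apply: continuous_comp; last exact: cdF.
    apply: (@cvg_rV _ (nbhs t) _) => i; rewrite !mxE; under eq_fun do rewrite mxE.
    by case: (unlift ord0 i) => [k|]/=; [exact: cvg_cst|exact: cvg_id].
  by apply/funext => t; rewrite pG.
- by exists M => t /hM /(_ ord0); rewrite rV_cons0.
Qed.

End lebesgue_rV_fubini.
Arguments box : clear implicits.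

(** * Smooth functions *)

Section line_derivatives.
Context (R : realType).

(** Directional derivatives become derivatives in one real variable along a line, where the chain
    rule and the mean value theorem apply. *)
Lemma derive1P (V : normedModType R) (f : V -> R) x v :
  'D_1 (fun h : R => f (h *: v + x)) 0 = 'D_v f x.
Proof.
rewrite /derive; apply: (congr1 (fun g => lim (g @ (0 : R)^'))).
by apply/funext => h /=; rewrite addr0 scale0r add0r [_%:A]mulr1.
Qed.

Lemma is_derive_line (V : normedModType R) (f : V -> R) x v t :
  derivable f (t *: v + x) v ->
  is_derive t 1 (fun h : R => f (h *: v + x)) ('D_v f (t *: v + x)).
Proof.
move=> df.
have e : (fun h => h^-1 *: (((fun h : R => f (h *: v + x)) \o shift t) (h *: 1) -
      f (t *: v + x))) =
    (fun h => h^-1 *: ((f \o shift (t *: v + x)) (h *: v) - f (t *: v + x))).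
  by apply/funext => h /=; rewrite [_%:A]mulr1 scalerDl addrA.
by apply: DeriveDef; rewrite /derivable /derive e.
Qed.

Lemma is_derive_comp_line (V : normedModType R) (f : V -> R) (g : R -> R) x v :
  derivable f x v -> derivable g (f x) 1 ->
  is_derive x v (fun y => g (f y)) ('D_1 g (f x) * 'D_v f x).
Proof.
move=> /derivable1P df dg.
have dg' : derivable g ((fun h : R => f (h *: v + x)) 0) 1.
  by rewrite scale0r add0r.
have [d1 d2] := is_derive1_comp (derivableP dg') (derivableP df).
apply: DeriveDef; first exact/derivable1P.
rewrite -(derive1P (fun y => g (f y))) -(derive1P f).
by rewrite -[X in 'D_1 g (f X)]add0r -(scale0r v) -d2.
Qed.

Lemma MVT_line (V : normedModType R) (f : V -> R) x v (h : R) :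
  0 < h -> (forall y, derivable f y v) ->
  exists2 t, 0 < t < h & f (h *: v + x) - f x = 'D_v f (t *: v + x) * h.
Proof.
move=> h0 df; pose F t := f (t *: v + x).
have [||c] := @MVT R F (fun t => 'D_v f (t *: v + x)) 0 h h0.
- by move=> t _; exact: is_derive_line.
- apply: continuous_subspaceT => t; apply: differentiable_continuous.
  by apply/derivable1_diffP; case: (is_derive_line (df (t *: v + x))).
rewrite in_itv/= => ch; rewrite subr0 /F scale0r add0r => e.
by exists c.
Qed.

End line_derivatives.

(** * Smooth functions of one variable, flat at the origin *)

Section theta.
Context (R : realType).
Implicit Types q : {poly R}.

Definition smooth1 (g : R -> R) := forall k t, derivable (derive1n k g) t 1.

Lemma smooth1_derive g : smooth1 g -> smooth1 (fun t => 'D_1 g t).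
Proof.
move=> sg k t; have := sg k.+1 t; rewrite derive1Sn.
by rewrite (_ : g^`()%classic = fun t => 'D_1 g t)//; apply/funext => s; rewrite derive1E.
Qed.

(** Smoothness by coinduction: it suffices to find a class of derivable functions stable under
    differentiation, without computing iterated derivatives. *)
Lemma smooth1_coind (S : (R -> R) -> Prop) :
  (forall g, S g -> (forall t, derivable g t 1) /\ S (fun t => 'D_1 g t)) ->
  forall g, S g -> smooth1 g.
Proof.
move=> H g Sg k; suff [] : (forall t, derivable (derive1n k g) t 1) /\ S (derive1n k g) by [].
elim: k => [|k [d IH]]; first by split=> //; exact: (H g Sg).1.
have e : derive1n k.+1 g = (fun t => 'D_1 (derive1n k g) t).
  by apply/funext => t; rewrite derive1nS derive1E.
have Sk := (H _ IH).2; rewrite e.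
by split; [exact: (H _ Sk).1|exact: Sk].
Qed.

(** The classical exp(-1/t) with a polynomial factor in 1/t. The factor makes the family stable
    under differentiation, so that smoothness follows by coinduction. *)
Definition theta q (t : R) : R := if 0 < t then q.[t^-1] * expR (- t^-1) else 0.

Lemma expn_expR_bounded m : exists C : R, forall s, 0 <= s -> s ^+ m * expR (- s) <= C.
Proof.
exists (m`!%:R + 1) => s s0; rewrite expRN ler_pdivrMr ?expR_gt0//.
case: m => [|m].
  by rewrite expr0 fact0; have := expR_ge1Dx s; nra.
have := expR_ge1Dxn m s0 => h; have e0 := expR_gt0 s.
have f0 : 0 < m.+1`!%:R :> R by rewrite ltr0n fact_gt0.
have : s ^+ m.+1 <= m.+1`!%:R * expR s.
  by rewrite -ler_pdivrMl// mulrC (le_trans _ h)// lerDr.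
by move: h; nra.
Qed.

Lemma poly_expR_bounded q : exists C : R, forall s, 0 <= s -> `|q.[s]| * expR (- s) <= C.
Proof.
(* The additional power of s absorbs the factor X produced by the induction on q. *)
suff H m : exists C : R, forall s, 0 <= s -> s ^+ m * `|q.[s]| * expR (- s) <= C.
  by have [C hC] := H 0%N; exists C => s s0; have := hC _ s0; rewrite mul1r.
elim/poly_ind: q m => [|q c IH] m.
  by exists 0 => s _; rewrite horner0 normr0 mulr0 mul0r.
have [C1 h1] := IH m.+1; have [C2 h2] := expn_expR_bounded m.
exists (C1 + `|c| * C2) => s s0; have := h1 _ s0; have := h2 _ s0.
move=> /(ler_wpM2l (normr_ge0 c)) => a b.
apply: le_trans (lerD b a); rewrite mulrA -mulrDl ler_wpM2r ?expR_ge0//.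
rewrite hornerMXaddC exprSr -mulrA (mulrC `|c|) -mulrDr ler_wpM2l ?exprn_ge0//.
by rewrite (le_trans (ler_normD _ _))// normrM (ger0_norm s0) mulrC.
Qed.

(** The quadratic decay makes the difference quotient at 0 vanish in the limit. It comes from the
    boundedness of q(s) s^2 exp(-s) at s = 1/t. *)
Lemma theta_bound q : exists2 C, 0 <= C & forall t, `|theta q t| <= C * t ^+ 2.
Proof.
have [C hC] := poly_expR_bounded (q * 'X^2).
have C0 : 0 <= C by have := hC 0 (lexx 0); apply: le_trans; rewrite mulr_ge0 ?expR_ge0.
exists C => // t; rewrite /theta; case: ifPn => [t0|_]; last first.
  by rewrite normr0 mulr_ge0 ?sqr_ge0.
have ti : 0 <= t^-1 by rewrite invr_ge0 ltW.
have := hC _ ti; rewrite hornerM hornerXn !normrM (ger0_norm (expR_ge0 _)).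
rewrite (ger0_norm ti) => h.
by rewrite -ler_pdivrMr ?exprn_gt0// -exprVn expr2 mulrAC.
Qed.

(** Differentiating q(1/t) exp(-1/t) gives the factor 1/t^2 times (q - q')(1/t). The same formula
    holds for t < 0, where all is 0, and at 0 by [theta_bound]. *)
Lemma is_derive_theta q (t : R) :
  is_derive t (1 : R) (theta q) (theta ((q - q^`()) * 'X^2) t).
Proof.
have [t0|t0|->] := ltgtP t 0.
- rewrite /theta ltNge (ltW t0) /=.
  apply: (@near_eq_is_derive _ _ _ (cst 0) _ t 1 0 _ (@is_derive_cst R R R 0 t 1)).
  near=> s; rewrite /theta ifF//; apply/negbTE; rewrite -leNgt.
  by near: s; apply: (@cvgr_le _ _ _ _ id t) => //; exact: cvg_id.
- have tn0 : t != 0 by rewrite gt_eqF.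
  have nr : \forall s \near t, q.[s^-1] * expR (- s^-1) = theta q s.
    near=> s; rewrite /theta ifT//; near: s.
    by apply: (@cvgr_gt _ _ _ _ id t) => //; exact: cvg_id.
  apply: (near_eq_is_derive nr).
  rewrite [X in is_derive _ _ _ X]/theta t0.
  have d1 : is_derive t 1 (fun s : R => s^-1) (- t ^- 2).
    have [a b] := @is_deriveV R id t 1 1 tn0 (is_derive_id _ _).
    by apply: DeriveDef => //; rewrite b [_ *: _]mulr1.
  have d2 : is_derive t 1 (fun s => q.[s^-1]) (q^`().[t^-1] * - t ^- 2).
    have dq : is_derive t^-1 1 (horner q) (q^`().[t^-1]).
      apply: DeriveDef; first exact: derivable_horner.
      by rewrite -derive1E -derivE.
    have [a b] := @is_derive1_comp R (horner q) (fun s : R => s^-1) t _ _ dq d1.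
    exact: DeriveDef.
  have d3 : is_derive t 1 (fun s : R => expR (- s^-1)) (expR (- t^-1) * (t ^- 2)).
    have d4 : is_derive t 1 (fun s : R => - s^-1) (t ^- 2).
      by have := is_deriveN d1; rewrite opprK.
    have [a b] := @is_derive1_comp R expR (fun s : R => - s^-1) t _ _ (is_derive_expR _) d4.
    exact: DeriveDef.
  have [h1 h2] := is_deriveM d2 d3.
  apply: DeriveDef; first exact: h1.
  apply: (etrans h2).
  rewrite /GRing.scale /= hornerM hornerXn hornerD hornerN exprVn; ring.
have -> : theta ((q - q^`()) * 'X^2) 0 = 0 by rewrite /theta ltxx.
have [C C0 hC] := theta_bound q.
have th0 : theta q 0 = 0 by rewrite /theta ltxx.
have cv : h^-1 *: (theta q (h *: 1 + 0) - theta q 0) @[h --> 0^'] --> (0 : R).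
  apply: norm_cvg0.
  apply: (@squeeze_cvgr _ _ _ _ (fun=> 0) (fun h => C * `|h|)).
  - near=> h; rewrite normr_ge0 /=.
    have h0 : h != 0 by near: h; exact: nbhs_dnbhs_neq.
    rewrite th0 subr0 addr0 [_%:A]mulr1 [_ *: _]/(_ * _) normrM normfV.
    rewrite ler_pdivrMl ?normr_gt0// (le_trans (hC h))// -(real_normK (num_real h)).
    by rewrite expr2 mulrCA.
  - exact: cvg_cst.
  - rewrite -[X in _ --> X](mulr0 C); apply: cvgM; first exact: cvg_cst.
    by apply/norm_cvg0P; exact: cvg_within.
apply: DeriveDef; first by apply/cvg_ex; exists 0.
exact: cvg_lim cv.
Unshelve. all: by end_near. Qed.

Lemma smooth1_theta q : smooth1 (theta q).
Proof.
apply: (smooth1_coind (S := fun g => exists q, g = theta q)); last by exists q.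
move=> _ [p ->]; split=> [t|]; first by case: (is_derive_theta p t).
exists ((p - p^`()) * 'X^2); apply/funext => t.
exact: (@derive_val _ _ _ _ _ _ _ (is_derive_theta p t)).
Qed.

End theta.

(** * Calculus of smooth and of test functions of several variables *)

Section smooth_functions.
Context (R : realType) (n : nat).
Local Notation rV := 'rV[R]_n.
Implicit Types f g : rV -> R.
Local Notation "''e_' i" := (delta_mx ord0 i : rV) (at level 8, i at level 2).

Lemma smooth_coind (S : (rV -> R) -> Prop) :
  (forall f, S f -> [/\ continuous f, forall i x, derivable f x 'e_i &
     forall i, S (partial i f)]) -> forall f, S f -> smooth f.
Proof.
move=> H f Sf s; suff Ss : S (foldr (@partial R n) f s).
  by have [c d _] := H _ Ss; split.
by elim: s => [//|i s IH] /=; have [_ _] := H _ IH; exact.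
Qed.

Lemma smooth_continuous f : smooth f -> continuous f.
Proof. by move=> /(_ [::]) []. Qed.

Lemma smooth_derivable f i x : smooth f -> derivable f x 'e_i.
Proof. by move=> /(_ [::]) []. Qed.

Lemma smooth_partial i f : smooth f -> smooth (partial i f).
Proof. by move=> sf s; have := sf (s ++ [:: i]); rewrite foldr_cat. Qed.

Lemma omegaE (x : rV) : omega x = 1 + \sum_(i < n) x ord0 i ^+ 2.
Proof.
by rewrite /omega /enorm sqr_sqrtr ?sumr_ge0// => i _; rewrite -expr2 sqr_ge0.
Qed.

Lemma omega_ge1 (x : rV) : 1 <= omega x.
Proof. by rewrite omegaE lerDl sumr_ge0// => i _; rewrite sqr_ge0. Qed.

Lemma omega_gt0 (x : rV) : 0 < omega x.
Proof. exact: lt_le_trans (omega_ge1 x). Qed.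

Definition coord i (x : rV) : R := x ord0 i.

Lemma is_derive_coord i j x : is_derive x 'e_i (coord j) (i == j)%:R.
Proof.
have e (h : R) : h != 0 -> h^-1 *: ((coord j \o shift x) (h *: 'e_i) - coord j x) = (i == j)%:R.
  by move=> h0; rewrite /= /coord !mxE eqxx /= addrK /GRing.scale/= mulKf// eq_sym.
have cv : h^-1 *: ((coord j \o shift x) (h *: 'e_i) - coord j x) @[h --> 0^'] --> ((i == j)%:R : R).
  apply: cvg_near_cst; near=> h; rewrite e//; near: h; exact: nbhs_dnbhs_neq.
apply: DeriveDef; first by apply/cvg_ex; eexists; exact: cv.
exact: cvg_lim cv.
Unshelve. all: by end_near. Qed.

Lemma is_derive_omega i x : is_derive x 'e_i (@omega R n) (2 * x ord0 i).
Proof.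
have -> : @omega R n = cst 1 + \sum_(j < n) (coord j * coord j).
  apply/funext => y; rewrite omegaE.
  rewrite -[RHS]/(1 + (\sum_(j < n) (coord j * coord j)) y) fct_sumE.
  by congr (_ + _); apply: eq_bigr => j _; rewrite expr2.
have d1 j : derivable (coord j) x 'e_i by case: (is_derive_coord i j x).
have d2 j : derivable (coord j * coord j) x 'e_i by exact: derivableM.
have d3 : derivable (\sum_(j < n) (coord j * coord j)) x 'e_i by exact: derivable_sum.
have d0 : derivable (cst 1 : rV -> R) x 'e_i by exact: derivable_cst.
apply: DeriveDef; first exact: (derivableD d0 d3).
apply: (etrans (deriveD d0 d3)); rewrite derive_cst add0r.
rewrite (derive_sum d2) (bigD1 i)//= big1 => [|j ji].
  rewrite (deriveM (d1 i) (d1 i)) (@derive_val _ _ _ _ _ _ _ (is_derive_coord i i x)).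
  by rewrite eqxx addr0 /coord /GRing.scale/= mulr1 mulr2n mulrDl mul1r.
rewrite (deriveM (d1 j) (d1 j)) (@derive_val _ _ _ _ _ _ _ (is_derive_coord i j x)).
by rewrite eq_sym (negbTE ji) scaler0 addr0.
Qed.

Lemma is_derive_omega_pow a i x :
  is_derive x 'e_i (fun y => omega y `^ a) (2 * a * x ord0 i * omega x `^ (a - 1)).
Proof.
have [d1 d2] := is_derive_omega i x.
have [p1 p2] := @is_derive1_powR R a _ (omega_gt0 x).
have [c1 c2] := is_derive_comp_line d1 p1.
apply: DeriveDef; first exact: c1.
by rewrite c2 p2 d2; ring.
Qed.

(** The formal closure of smooth functions under the operations in use. It is stable under partial
    derivatives, so all closure properties of [smooth] follow at once by coinduction, with no
    Leibniz formula for iterated derivatives. *)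
Inductive smooth_gen : (rV -> R) -> Prop :=
| smooth_gen_base f : smooth f -> smooth_gen f
| smooth_gen_cst c : smooth_gen (fun=> c)
| smooth_gen_coord i : smooth_gen (coord i)
| smooth_gen_omega a : smooth_gen (fun x => omega x `^ a)
| smooth_gen_add f g : smooth_gen f -> smooth_gen g -> smooth_gen (fun x => f x + g x)
| smooth_gen_mul f g : smooth_gen f -> smooth_gen g -> smooth_gen (fun x => f x * g x)
| smooth_gen_comp h f : smooth1 h -> smooth_gen f -> smooth_gen (fun x => h (f x)).

Lemma continuous_bigsum (I : Type) (s : seq I) (F : I -> rV -> R) :
  (forall i, continuous (F i)) -> continuous (fun x => \sum_(i <- s) F i x).
Proof.
move=> cF; elim: s => [|i s IH].
  by under eq_fun do rewrite big_nil; exact: cst_continuous.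
under eq_fun do rewrite big_cons.
by move=> x; apply: continuousD; [exact: cF|exact: IH].
Qed.

Lemma continuous_omega : continuous (@omega R n).
Proof.
have -> : @omega R n = fun x => 1 + \sum_(j < n) coord j x * coord j x.
  by apply/funext => y; rewrite omegaE; congr (_ + _); apply: eq_bigr => j _; rewrite expr2.
move=> x; apply: continuousD; first exact: cst_continuous.
apply: continuous_bigsum => j y.
by apply: continuousM; exact: coord_continuous.
Qed.

Lemma smooth_gen_step f : smooth_gen f ->
  [/\ continuous f, forall i x, derivable f x 'e_i & forall i, smooth_gen (partial i f)].
Proof.
elim=> {f} [f sf|c|i|a|f g gf [cf df pf] gg [cg dg pg]|f g gf [cf df pf] gg [cg dg pg]|h f sh gf [cf df pf]].
- split; [exact: smooth_continuous|by move=> i x; exact: smooth_derivable|].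
  by move=> i; apply: smooth_gen_base; exact: smooth_partial.
- split=> [|i x|i]; [exact: cst_continuous|exact: derivable_cst|].
  rewrite (_ : partial i _ = fun=> 0); first exact: smooth_gen_cst.
  by apply/funext => x; exact: derive_cst.
- split=> [|j x|j]; [exact: coord_continuous|by case: (is_derive_coord j i x)|].
  rewrite (_ : partial j _ = fun=> (j == i)%:R); first exact: smooth_gen_cst.
  by apply/funext => x; case: (is_derive_coord j i x).
- split=> [x|i x|i]; last 1 first.
  + rewrite (_ : partial i _ = fun x => (2 * a * x ord0 i) * omega x `^ (a - 1)).
      apply: smooth_gen_mul; last exact: smooth_gen_omega.
      by apply: smooth_gen_mul; [exact: smooth_gen_cst|exact: smooth_gen_coord].
    by apply/funext => x; case: (is_derive_omega_pow a i x).
  + apply: (@continuous_comp _ _ _ (@omega R n) (fun y => y `^ a)).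
      exact: continuous_omega.
    apply: differentiable_continuous; apply/derivable1_diffP.
    by case: (@is_derive1_powR R a _ (omega_gt0 x)).
  + by case: (is_derive_omega_pow a i x).
- split=> [x|i x|i]; [exact: continuousD (cf x) (cg x)|exact: derivableD|].
  rewrite (_ : partial i _ = fun x => partial i f x + partial i g x).
    exact: smooth_gen_add.
  by apply/funext => x; exact: deriveD.
- split=> [x|i x|i]; [exact: continuousM (cf x) (cg x)|exact: derivableM|].
  rewrite (_ : partial i _ = fun x => f x * partial i g x + g x * partial i f x).
    by apply: smooth_gen_add; exact: smooth_gen_mul.
  by apply/funext => x; exact: deriveM.
- split=> [x|i x|i].
  + apply: continuous_comp; first exact: cf.
    apply: differentiable_continuous; apply/derivable1_diffP; exact: (sh 0%N).
  + by case: (is_derive_comp_line (df i x) (sh 0%N (f x))).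
  + rewrite (_ : partial i _ = fun x => 'D_1 h (f x) * partial i f x).
      apply: smooth_gen_mul => //.
      by apply: (@smooth_gen_comp (fun t => 'D_1 h t) f) => //; exact: smooth1_derive.
    by apply/funext => x; case: (is_derive_comp_line (df i x) (sh 0%N (f x))).
Qed.

Lemma smooth_genP f : smooth_gen f -> smooth f.
Proof. by apply: smooth_coind => g; exact: smooth_gen_step. Qed.

Lemma smoothD f g : smooth f -> smooth g -> smooth (fun x => f x + g x).
Proof. by move=> *; apply: smooth_genP; apply: smooth_gen_add; exact: smooth_gen_base. Qed.

Lemma smoothM f g : smooth f -> smooth g -> smooth (fun x => f x * g x).
Proof. by move=> *; apply: smooth_genP; apply: smooth_gen_mul; exact: smooth_gen_base. Qed.

Lemma smooth_cst c : smooth (fun _ : rV => c).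
Proof. by apply: smooth_genP; exact: smooth_gen_cst. Qed.

Lemma smoothZ c f : smooth f -> smooth (fun x => c * f x).
Proof. by apply: smoothM; exact: smooth_cst. Qed.

Lemma smoothB f g : smooth f -> smooth g -> smooth (fun x => f x - g x).
Proof.
move=> sf sg; have -> : (fun x => f x - g x) = (fun x => f x + -1 * g x).
  by apply/funext => x; rewrite mulN1r.
exact: smoothD sf (smoothZ (-1) sg).
Qed.

Lemma smooth_coord i : smooth (coord i).
Proof. by apply: smooth_genP; exact: smooth_gen_coord. Qed.

Lemma smooth_omega_pow a : smooth (fun x : rV => omega x `^ a).
Proof. by apply: smooth_genP; exact: smooth_gen_omega. Qed.

Lemma smooth_omega : smooth (@omega R n).
Proof.
have -> : @omega R n = fun x => omega x `^ 1.
  by apply/funext => x; rewrite powRr1// ltW// omega_gt0.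
exact: smooth_omega_pow.
Qed.

Lemma smooth_comp h f : smooth1 h -> smooth f -> smooth (fun x => h (f x)).
Proof. by move=> *; apply: smooth_genP; apply: smooth_gen_comp => //; exact: smooth_gen_base. Qed.

Lemma smooth_sum (I : Type) (s : seq I) (F : I -> rV -> R) :
  (forall i, smooth (F i)) -> smooth (fun x => \sum_(i <- s) F i x).
Proof.
move=> sF; elim: s => [|i s IH].
  by under eq_fun do rewrite big_nil; exact: smooth_cst.
have -> : (fun x => \sum_(k <- i :: s) F k x) = (fun x => F i x + \sum_(k <- s) F k x).
  by apply/funext => x; rewrite big_cons.
exact: smoothD (sF i) IH.
Qed.

Lemma smooth_prod (I : Type) (s : seq I) (F : I -> rV -> R) :
  (forall i, smooth (F i)) -> smooth (fun x => \prod_(i <- s) F i x).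
Proof.
move=> sF; elim: s => [|i s IH].
  by under eq_fun do rewrite big_nil; exact: smooth_cst.
have -> : (fun x => \prod_(k <- i :: s) F k x) = (fun x => F i x * \prod_(k <- s) F k x).
  by apply/funext => x; rewrite big_cons.
exact: smoothM (sF i) IH.
Qed.

Lemma partialD i f g x : smooth f -> smooth g ->
  partial i (fun x => f x + g x) x = partial i f x + partial i g x.
Proof. by move=> sf sg; apply: deriveD; exact: smooth_derivable. Qed.

Lemma partialM i f g x : smooth f -> smooth g ->
  partial i (fun x => f x * g x) x = f x * partial i g x + g x * partial i f x.
Proof. by move=> sf sg; apply: deriveM; exact: smooth_derivable. Qed.

Lemma partial_cst i c x : partial i (fun _ : rV => c) x = 0.
Proof. exact: derive_cst. Qed.

Lemma partialZ i c f x : smooth f -> partial i (fun x => c * f x) x = c * partial i f x.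
Proof.
by move=> sf; rewrite (partialM _ _ (@smooth_cst c) sf) partial_cst mulr0 addr0.
Qed.

Lemma partialB i f g x : smooth f -> smooth g ->
  partial i (fun x => f x - g x) x = partial i f x - partial i g x.
Proof. by move=> sf sg; apply: deriveB; exact: smooth_derivable. Qed.

Lemma partial_coord i j x : partial i (coord j) x = (i == j)%:R.
Proof. by case: (is_derive_coord i j x). Qed.

Lemma partial_omega i x : partial i (@omega R n) x = 2 * x ord0 i.
Proof. by case: (is_derive_omega i x). Qed.

Lemma partial_omega_pow a i (x : rV) :
  partial i (fun y => omega y `^ a) x = 2 * a * x ord0 i * omega x `^ (a - 1).
Proof. by case: (is_derive_omega_pow a i x). Qed.

Lemma partial_comp h i f x : smooth1 h -> smooth f ->
  partial i (fun x => h (f x)) x = 'D_1 h (f x) * partial i f x.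
Proof.
by move=> sh sf; case: (is_derive_comp_line (@smooth_derivable _ i x sf) (sh 0%N (f x))).
Qed.

Lemma partial_sum (I : Type) (s : seq I) (F : I -> rV -> R) i x :
  (forall k, smooth (F k)) ->
  partial i (fun x => \sum_(k <- s) F k x) x = \sum_(k <- s) partial i (F k) x.
Proof.
move=> sF; elim: s => [|k s IH].
  by under eq_fun do rewrite big_nil; rewrite big_nil partial_cst.
have -> : (fun x => \sum_(j <- k :: s) F j x) = (fun x => F k x + \sum_(j <- s) F j x).
  by apply/funext => y; rewrite big_cons.
by rewrite big_cons (partialD _ _ (sF k) (smooth_sum s sF)) IH.
Qed.

Lemma continuous2_ball f g : continuous f -> continuous g ->
  forall x e, 0 < e -> exists2 d : R, 0 < d &
    forall y, ball x d y -> `|f x - f y| < e /\ `|g x - g y| < e.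
Proof.
move=> cf cg x e e0.
have /cvgrPdist_lt /(_ _ e0) h1 := cf x; have /cvgrPdist_lt /(_ _ e0) h2 := cg x.
have /nbhs_ballP[d /= d0 hd] :
    nbhs x [set y | `|f x - f y| < e /\ `|g x - g y| < e] by exact: filterI.
by exists d.
Qed.

Lemma near_both (a b c e : R) : `|a - b| < e / 2 -> `|c - b| < e / 2 -> `|a - c| <= e.
Proof.
rewrite (distrC c) => h1 h2; rewrite -(subrKA b) (le_trans (ler_normD _ _))//; lra.
Qed.

(** The second difference of f over a small square, expanded by the mean value theorem in each of
    the two orders, equals h^2 times either mixed derivative at a nearby point; continuity of both
    mixed derivatives concludes. *)
Lemma partial_comm i j f : smooth f -> partial i (partial j f) = partial j (partial i f).
Proof.
move=> sf; apply/funext => x.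
have sii := smooth_continuous (smooth_partial i (smooth_partial j sf)).
have sjj := smooth_continuous (smooth_partial j (smooth_partial i sf)).
apply/eqP; rewrite -subr_eq0 -normr_le0; apply/ler_addgt0Pl => e e0; rewrite addr0.
have e20 : 0 < e / 2 by rewrite divr_gt0.
have [d d0 hd] := continuous2_ball sii sjj x e20.
(* Two displacements smaller than h stay within distance d in the sup norm, even when i = j and they
   add up. *)
pose h := d / 2; have h0 : 0 < h by rewrite divr_gt0.
have step k l (F : rV -> R) : smooth F -> exists s t, [/\ 0 < s < h, 0 < t < h &
    F (h *: 'e_k + (h *: 'e_l + x)) - F (h *: 'e_l + x) - (F (h *: 'e_k + x) - F x) =
    partial k (partial l F) (t *: 'e_k + (s *: 'e_l + x)) * h * h].
  move=> sF; pose G y := F (h *: 'e_k + y) - F y.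
  have dG y : is_derive y 'e_l G (partial l F (h *: 'e_k + y) - partial l F y).
    have dF1 : is_derive y 'e_l (fun y => F (h *: 'e_k + y)) (partial l F (h *: 'e_k + y)).
      have e1 : (fun s => s^-1 *: (((fun y => F (h *: 'e_k + y)) \o shift y) (s *: 'e_l) - F (h *: 'e_k + y))) =
          (fun s => s^-1 *: ((F \o shift (h *: 'e_k + y)) (s *: 'e_l) - F (h *: 'e_k + y))).
        by apply/funext => s /=; rewrite addrCA.
      have := @smooth_derivable _ l (h *: 'e_k + y) sF.
      by move=> dF; apply: DeriveDef; rewrite /partial /derivable /derive e1.
    have dF2 : is_derive y 'e_l F (partial l F y).
      by apply: derivableP; exact: smooth_derivable.
    exact: is_deriveB dF1 dF2.
  have dG' y : derivable G y 'e_l by case: (dG y).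
  have [s sh es] := MVT_line x h0 dG'.
  have [t th et] := MVT_line (s *: 'e_l + x) h0
    (fun y => @smooth_derivable _ k y (smooth_partial l sF)).
  exists s, t; split=> //; rewrite -[LHS]/(G (h *: 'e_l + x) - G x) es.
  by case: (dG (s *: 'e_l + x)) => _ ->; rewrite et.
have inb k l s t : 0 < s < h -> 0 < t < h -> ball x d (t *: 'e_k + (s *: 'e_l + x)).
  move=> sh th; split=> // a b; rewrite /ball/= !mxE.
  rewrite addrA opprD addrCA subrr addr0 normrN.
  case: (_ && _) => /=; case: (_ && _) => /=; rewrite ?mulr1 ?mulr0 ?addr0 ?add0r ?normr0//;
    by rewrite gtr0_norm; move: sh th; rewrite /h => *; lra.
have [s [t [sh th est]]] := step i j f sf.
have [s' [t' [sh' th' est']]] := step j i f sf.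
(* The second difference does not depend on the order of the two steps, so its two expressions agree
   and h can be cancelled twice. *)
have e2 : partial i (partial j f) (t *: 'e_i + (s *: 'e_j + x)) =
    partial j (partial i f) (t' *: 'e_j + (s' *: 'e_i + x)).
  apply: (mulIf (lt0r_neq0 h0)); apply: (mulIf (lt0r_neq0 h0)).
  have key (A B C D P Q : R) : A - B - (C - D) = P -> A - C - (B - D) = Q -> P = Q.
    by move=> <- <-; rewrite !opprB addrACA [RHS]addrACA (addrC (- B)).
  apply: (key _ _ _ _ _ _ est); rewrite (addrCA (h *: 'e_i)); exact: est'.
have [a _] := hd _ (inb i j s t sh th).
have [_ b] := hd _ (inb j i s' t' sh' th').
by rewrite e2 in a; exact: near_both a b.
Qed.

Lemma bsupp_compact f : bsupp f <-> compact (closure [set x | f x != 0]).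
Proof.
split=> [[M hM]|cf].
  apply: (@subclosed_compact _ _ (box R n M)); first exact: closed_closure.
    exact: compact_box.
  have cb : closed (box R n M).
    by apply: compact_closed; [exact: norm_hausdorff|exact: compact_box].
  by rewrite [X in _ `<=` X]((closure_id _).1 cb); apply: closure_subset => x /hM.
have /compact_bounded[M [_ hM]] := cf.
exists (`|M| + 1) => x fx i.
have : `|x| <= `|M| + 1.
  by apply: hM; [rewrite (le_lt_trans (ler_norm _))// ltrDl|exact: subset_closure].
apply: le_trans.
by rewrite [leRHS]/Num.Def.normr/= mx_normrE; apply: le_trans (le_bigmax _ _ (ord0, i)).
Qed.

Lemma Cc_inftyP f : Cc_infty f <-> smooth f /\ bsupp f.
Proof. by split=> -[sf bf]; split=> //; apply/bsupp_compact. Qed.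

Lemma bsuppD f g : bsupp f -> bsupp g -> bsupp (fun x => f x + g x).
Proof.
move=> /bsupp_gt0[M M0 hM] /bsupp_gt0[N N0 hN]; exists (M + N) => x fgx i.
have [fx|/hM/(_ i) h] := eqVneq (f x) 0; last by rewrite (le_trans h)// lerDl ltW.
have : g x != 0 by move: fgx; rewrite fx add0r.
by move=> /hN/(_ i) h; rewrite (le_trans h)// lerDr ltW.
Qed.

Lemma bsuppMl f g : bsupp f -> bsupp (fun x => f x * g x).
Proof. by move=> [M hM]; exists M => x; rewrite mulf_eq0 negb_or => /andP[/hM]. Qed.

Lemma bsuppMr f g : bsupp f -> bsupp (fun x => g x * f x).
Proof. by move=> [M hM]; exists M => x; rewrite mulf_eq0 negb_or => /andP[_ /hM]. Qed.

Lemma CcD f g : Cc_infty f -> Cc_infty g -> Cc_infty (fun x => f x + g x).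
Proof.
move=> /Cc_inftyP[sf bf] /Cc_inftyP[sg bg]; apply/Cc_inftyP.
by split; [exact: smoothD|exact: bsuppD].
Qed.

Lemma CcMl f g : Cc_infty f -> smooth g -> Cc_infty (fun x => f x * g x).
Proof.
move=> /Cc_inftyP[sf bf] sg; apply/Cc_inftyP.
by split; [exact: smoothM|exact: bsuppMl].
Qed.

Lemma CcMr f g : Cc_infty f -> smooth g -> Cc_infty (fun x => g x * f x).
Proof.
move=> /Cc_inftyP[sf bf] sg; apply/Cc_inftyP.
by split; [exact: smoothM|exact: bsuppMr].
Qed.

Lemma CcZ c f : Cc_infty f -> Cc_infty (fun x => c * f x).
Proof. by move=> cf; apply: CcMr => //; exact: smooth_cst. Qed.

Lemma CcB f g : Cc_infty f -> Cc_infty g -> Cc_infty (fun x => f x - g x).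
Proof.
move=> cf cg; have -> : (fun x => f x - g x) = (fun x => f x + -1 * g x).
  by apply/funext => x; rewrite mulN1r.
exact: CcD cf (CcZ (-1) cg).
Qed.

Lemma Cc0 : Cc_infty (fun _ : rV => 0).
Proof.
by apply/Cc_inftyP; split; [exact: smooth_cst|exists 0 => x; rewrite eqxx].
Qed.

Lemma Cc_sum (I : Type) (s : seq I) (F : I -> rV -> R) :
  (forall i, Cc_infty (F i)) -> Cc_infty (fun x => \sum_(i <- s) F i x).
Proof.
move=> sF; elim: s => [|i s IH].
  by under eq_fun do rewrite big_nil; exact: Cc0.
have -> : (fun x => \sum_(k <- i :: s) F k x) = (fun x => F i x + \sum_(k <- s) F k x).
  by apply/funext => x; rewrite big_cons.
exact: CcD (sF i) IH.
Qed.

Lemma Cc_partial i f : Cc_infty f -> Cc_infty (partial i f).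
Proof.
move=> /Cc_inftyP[sf bf]; apply/Cc_inftyP.
by split; [exact: smooth_partial|exact: bsupp_partial].
Qed.

Lemma Cc_smooth f : Cc_infty f -> smooth f.
Proof. by case. Qed.

Lemma Cc_bsupp f : Cc_infty f -> bsupp f.
Proof. by case/Cc_inftyP. Qed.

Lemma Cc_integral_partial0 i f : Cc_infty f ->
  \int[@lebesgue_rV R n]_x partial i f x = 0.
Proof.
move=> cf; have [sf bf] := (Cc_inftyP f).1 cf; rewrite /Rintegral integral_partial0//.
- exact: smooth_continuous.
- by move=> x; exact: smooth_derivable.
- by apply: smooth_continuous; exact: smooth_partial.
Qed.

End smooth_functions.

(** * The Cauchy measure and the integrated curvature identity *)

Section density.
Context d (T : measurableType d) (R : realType).
Variables (m nu : {measure set T -> \bar R}) (p : T -> R).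
Hypotheses (mp : measurable_fun setT p) (p0 : forall x, 0 <= p x).
Hypothesis nuE : forall A, measurable A -> nu A = (\int[m]_(x in A) (p x)%:E)%E.

Import HBNNSimple.

(** By simple functions and monotone convergence on both sides. It moves integrals against the
    Cauchy measure to Lebesgue measure, where integration by parts takes place. *)
Lemma ge0_integral_density (f : T -> \bar R) : measurable_fun setT f ->
  (forall x, 0 <= f x)%E -> (\int[nu]_x f x = \int[m]_x (f x * (p x)%:E))%E.
Proof.
move=> mf f0; pose h := nnsfun_approx measurableT mf.
have mpE : measurable_fun setT (EFin \o p) by exact/measurable_EFinP.
transitivity (limn (fun n => \int[nu]_x (h n x)%:E)%E).
  rewrite -monotone_convergence//.
  - by apply: eq_integral => x _; apply/esym/cvg_lim => //; exact: cvg_nnsfun_approx.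
  - by move=> n; exact/measurable_EFinP.
  - by move=> n x _; rewrite lee_fin.
  - by move=> x _ a b ab; rewrite lee_fin; exact/lefP/nd_nnsfun_approx.
transitivity (limn (fun n => \int[m]_x ((h n x)%:E * (p x)%:E))%E); last first.
  rewrite -monotone_convergence//.
  - apply: eq_integral => x _; apply/cvg_lim => //; apply: cvgeZr => //.
    exact: cvg_nnsfun_approx.
  - by move=> n; apply: emeasurable_funM => //; exact/measurable_EFinP.
  - by move=> n x _; rewrite mule_ge0// lee_fin.
  - move=> x _ a b ab; rewrite lee_wpmul2r ?lee_fin//.
    exact/lefP/nd_nnsfun_approx.
suff H n : (\int[nu]_x (h n x)%:E = \int[m]_x ((h n x)%:E * (p x)%:E))%E.
  by under eq_fun do rewrite H.
have mi r : measurable_fun setT (fun x => (r * \1_(h n @^-1` [set r]) x)%:E).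
  by apply/measurable_EFinP; exact: measurable_funM.
transitivity (\int[nu]_x (\sum_(y \in range (h n)) (y * \1_(h n @^-1` [set y]) x)%:E))%E.
  by apply: eq_integral => x _; rewrite fimfunE -fsumEFin.
rewrite ge0_integral_fsum//; last by move=> y x _; exact: nnfun_muleindic_ge0.
transitivity (\int[m]_x (\sum_(y \in range (h n))
    (y * \1_(h n @^-1` [set y]) x)%:E * (p x)%:E))%E; last first.
  apply: eq_integral => x _.
  rewrite -ge0_mule_fsuml => [|y]; last exact: nnfun_muleindic_ge0.
  by rewrite fsumEFin// -(fimfunE _ x).
rewrite ge0_integral_fsum//; last 2 first.
- by move=> y; exact: emeasurable_funM.
- by move=> y x _; rewrite mule_ge0 ?lee_fin// -lee_fin nnfun_muleindic_ge0.
apply: eq_fsbigr => r rh.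
rewrite integralZl_indic_nnsfun//.
under [RHS]eq_integral do rewrite EFinM -muleA.
have [->|r0] := eqVneq r 0.
  rewrite mul0e; symmetry; under eq_integral do rewrite mul0e.
  by rewrite integral0.
have rp : 0 <= r by case: (set_mem rh) => x _ <-.
rewrite ge0_integralZl//; last 2 first.
- by apply: emeasurable_funM => //; exact/measurable_EFinP.
- by move=> x _; rewrite mule_ge0// lee_fin.
congr (_ * _)%E; rewrite integral_indic// setIT nuE// [LHS]integral_mkcond.
apply: eq_integral => x _; rewrite patchE indicE.
by case: ifPn => xr; rewrite ?mul1e ?mul0e.
Qed.

Lemma integrable_density (f : T -> R) : measurable_fun setT f ->
  nu.-integrable setT (EFin \o f) <-> m.-integrable setT (fun x => (f x * p x)%:E).
Proof.
move=> mf; have e : (\int[nu]_x `|(EFin \o f) x| = \int[m]_x `|(f x * p x)%:E|)%E.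
  rewrite ge0_integral_density//; last by apply: measurableT_comp => //; exact/measurable_EFinP.
  by apply: eq_integral => x _; rewrite EFinM abseM (gee0_abs (_ : 0 <= (p x)%:E)%E) ?lee_fin.
split=> /integrableP[_ h]; apply/integrableP; split.
- by apply/measurable_EFinP; exact: measurable_funM.
- by rewrite -e.
- exact/measurable_EFinP.
- by rewrite e.
Qed.

Lemma Rintegral_density (f : T -> R) : measurable_fun setT f ->
  \int[nu]_x f x = \int[m]_x (f x * p x).
Proof.
move=> mf; rewrite /Rintegral; congr fine; rewrite [LHS]integralE [RHS]integralE.
have mfE : measurable_fun setT (EFin \o f) by exact/measurable_EFinP.
congr (_ - _)%E; rewrite ge0_integral_density//.
- apply: eq_integral => x _; rewrite !funeposE -EFin_max -EFinM -EFin_max.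
  by rewrite maxr_pMl// mul0r.
- exact: measurable_funepos.
- apply: eq_integral => x _; rewrite !funenegE -!EFinN -EFin_max -EFinM -EFin_max.
  by rewrite maxr_pMl// mul0r mulNr.
- exact: measurable_funeneg.
Qed.

Lemma ae_density (P : T -> Prop) : {ae m, forall x, P x} -> {ae nu, forall x, P x}.
Proof.
move=> [N [mN N0 PN]]; exists N; split=> //.
rewrite nuE//; apply: null_set_integral => //.
by apply/measurable_EFinP; exact: measurable_funTS.
Qed.

End density.

(** * Integrability of powers of omega *)

Section integrability.
Context (R : realType).

Lemma derivable_continuous (f : R -> R) (x : R) : derivable f x 1 ->
  {for x, continuous f}.
Proof. by move=> /derivable1_diffP; exact: differentiable_continuous. Qed.

Lemma continuous_powR_comp (f : R -> R) a (x : R) : derivable f x 1 -> 0 < f x ->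
  {for x, continuous (fun t => f t `^ a)}.
Proof.
move=> df fx; apply: derivable_continuous.
have [d1 d2] := @is_derive1_comp R (fun s => s `^ a) f x _ _
  (is_derive1_powR a fx) (derivableP df).
exact: d1.
Qed.

(** The antiderivative - (1 + t)^(-c) / c tends to 0 at infinity. *)
Lemma powR_tail_lty (c : R) : 0 < c ->
  (\int[@lebesgue_measure R]_(t in `[0%R, +oo[) ((1 + t) `^ (- (c + 1)))%:E < +oo)%E.
Proof.
move=> c0.
have D (t : R) : 0 <= t -> is_derive t (1 : R) (fun t : R => - c^-1 * (1 + t) `^ (- c)) ((1 + t) `^ (- (c + 1))).
  move=> t0; have t1 : 0 < 1 + t by rewrite ltr_pwDl.
  have d1 : is_derive t 1 (fun t : R => 1 + t) 1.
    by rewrite -[X in is_derive _ _ _ X]add0r; apply: is_deriveD.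
  have [a b] := @is_derive1_comp R (fun s => s `^ (- c)) (fun t => 1 + t) t _ _
    (is_derive1_powR (- c) t1) d1.
  have [h1 h2] := @is_deriveZ _ _ _ _ (- c^-1) t 1 _ (DeriveDef a b).
  apply: DeriveDef; first exact: h1.
  apply: (etrans h2); rewrite mulr1 /GRing.scale/= mulrA mulrNN mulVf ?gt_eqF// mul1r.
  by rewrite opprD.
rewrite (@ge0_continuous_FTC2y R _ (fun t : R => - c^-1 * (1 + t) `^ (- c)) 0 0).
- by rewrite -EFinB ltry.
- by move=> x x0; rewrite powR_ge0.
- apply: continuous_in_subspaceT => x; rewrite inE/= in_itv/= andbT => x0.
  have x1 : 0 < 1 + x by rewrite ltr_pwDl.
  apply: (@continuous_powR_comp (fun t => 1 + t)) => //.
- rewrite -[X in _ --> X](mulr0 (- c^-1)); apply: cvgM; first exact: cvg_cst.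
  apply/cvgrPdist_le => e e0; near=> t.
  rewrite sub0r normrN ger0_norm ?powR_ge0// powRN.
  rewrite -[leRHS]invrK lef_pV2 ?posrE ?invr_gt0 ?powR_gt0//; last first.
    rewrite ltr_pwDl//; near: t; exact: nbhs_pinfty_ge.
  have -> : e^-1 = ((e^-1) `^ (c^-1)) `^ c.
    by rewrite -powRrM mulVf ?gt_eqF// powRr1// invr_ge0 ltW.
  rewrite ge0_ler_powR ?nnegrE ?powR_ge0 ?(ltW c0)//.
    rewrite addr_ge0//; near: t; exact: nbhs_pinfty_ge.
  rewrite ler_wpDl//; near: t; exact: nbhs_pinfty_ge.
- by move=> x x0; case: (D x (ltW x0)).
- apply: cvg_at_right_filter.
  by case: (D 0 (lexx 0)) => /(@derivable_continuous _ 0).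
- move=> x; rewrite in_itv/= andbT => x0; rewrite derive1E.
  by case: (D x (ltW x0)).
Unshelve. all: by end_near. Qed.

(** By symmetry only t >= 0 matters, and there (1 + t)^2 <= 2 (1 + t^2) compares the integrand with
    (1 + t)^(-2a), where 2a > 1. *)
Lemma integral_1Dsqr_lty (a : R) : 2^-1 < a ->
  (\int[@lebesgue_measure R]_t ((1 + t ^+ 2) `^ (- a))%:E < +oo)%E.
Proof.
move=> a2; have p (t : R) : 0 < 1 + t ^+ 2 by rewrite ltr_pwDl// sqr_ge0.
have cf : continuous (fun t : R => (1 + t ^+ 2) `^ (- a)).
  move=> x; apply: (@continuous_powR_comp (fun t => 1 + t ^+ 2)) => //.
rewrite (ge0_symfun_integralT _ cf); last 2 first.
- by move=> x; exact: powR_ge0.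
- by move=> x /=; rewrite sqrrN.
apply: lte_mul_pinfty => //.
have -> : [set x : R | 0 <= x] = `[0%R, +oo[%classic by rewrite set_itvcy.
have ma (f : R -> R) : measurable_fun setT f -> measurable_fun (`[0%R, +oo[%classic : set R) (EFin \o f).
  by move=> mf; apply: measurable_funTS; exact/measurable_EFinP.
have m1 : measurable_fun setT (fun t : R => (1 + t ^+ 2) `^ (- a)).
  by apply: (measurableT_comp (measurable_powR _)); exact: measurable_funD.
have m2 : measurable_fun setT (fun t : R => (1 + t) `^ (- (2 * a - 1 + 1))).
  by apply: (measurableT_comp (measurable_powR _)); exact: measurable_funD.
apply: (@le_lt_trans _ _ (\int[@lebesgue_measure R]_(t in `[0%R, +oo[)
   ((2 `^ a)%:E * ((1 + t) `^ (- (2 * a - 1 + 1)))%:E))%E).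
  apply: ge0_le_integral => //.
  - by move=> x _; rewrite lee_fin powR_ge0.
  - exact: (ma _ m1).
  - by apply: measurable_funeM; exact: (ma _ m2).
  - move=> t; rewrite /= in_itv/= andbT => t0; rewrite -EFinM lee_fin subrK.
    have t1 : 0 < 1 + t by rewrite ltr_pwDl.
    have hV : (1 + t) `^ (2 * a) <= 2 `^ a * (1 + t ^+ 2) `^ a.
      rewrite powRrM powR_mulrn ?(ltW t1)// -powRM ?(ltW (p t))//.
      rewrite ge0_ler_powR ?nnegrE ?sqr_ge0 ?mulr_ge0 ?(ltW (p t))//; first by lra.
      by have := sqr_ge0 (1 - t); nra.
    rewrite !powRN ler_pdivlMr ?powR_gt0// ler_pdivrMl ?powR_gt0//.
    by rewrite [leRHS]mulrC.
rewrite ge0_integralZl//.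
- apply: lte_mul_pinfty; rewrite ?lee_fin ?powR_ge0//.
  by apply: powR_tail_lty; lra.
- exact: (ma _ m2).
- by move=> x _; rewrite lee_fin powR_ge0.
Qed.

Lemma lebesgue_rV_setT_neq0 n : (@lebesgue_rV R n [set: 'rV[R]_n] != 0)%E.
Proof.
elim: n => [|n IH]; first by rewrite /= diracT onee_neq0.
rewrite -[X in (X != _)%E]/((@lebesgue_measure R \x @lebesgue_rV R n)%E (@rV_cons R n @^-1` setT)).
rewrite preimage_setT -setXTT product_measure1E// mule_eq0 negb_or IH andbT.
have h : @lebesgue_measure R [set: R] = +oo%E.
  by rewrite -set_itvNyy lebesgue_measure_itv.
by rewrite [X in (X != _)%E]h.
Qed.

(** Since omega >= 1 + x_i^2 for every i, omega^(-g) is at most the product of the (1 +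
    x_i^2)^(-g/n). Each factor is integrable because g/n > 1/2, so polar coordinates are avoided. *)
Lemma integral_omega_lty n (g : R) : (0 < n)%N -> n%:R / 2 < g ->
  (\int[@lebesgue_rV R n]_x (omega x `^ (- g))%:E < +oo)%E.
Proof.
move=> n0 ng; have n0' : 0 < n%:R :> R by rewrite ltr0n.
have g0 : 0 < g by rewrite (le_lt_trans _ ng)// divr_ge0// ltW.
pose h (i : 'I_n) (t : R) := (1 + t ^+ 2) `^ (- (g / n%:R)).
have mh (i : 'I_n) : measurable_fun setT (h i).
  by apply: (measurableT_comp (measurable_powR _)); exact: measurable_funD.
have lt : (\int[@lebesgue_rV R n]_x (\prod_(i < n) h i (x ord0 i))%:E < +oo)%E.
  apply: ge0_lebesgue_rV_prod => // i; first by move=> t; exact: powR_ge0.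
  by apply: integral_1Dsqr_lty; rewrite ltr_pdivlMr// mulrC.
apply: le_lt_trans lt; apply: ge0_le_integral => //.
- by move=> x _; rewrite lee_fin powR_ge0.
- apply/measurable_EFinP.
  exact: (measurableT_comp (measurable_powR _) (@measurable_omega R n)).
- apply/measurable_EFinP; apply: measurable_prod => i _.
  exact: measurableT_comp (mh i) (measurable_coord i).
- move=> x _; rewrite lee_fin.
  have -> : omega x `^ (- g) = \prod_(i < n) omega x `^ (- (g / n%:R)).
    rewrite prodr_const card_ord -powR_mulrn ?powR_ge0// -powRrM mulNr divfK//.
    by rewrite gt_eqF.
  apply: ler_prod => i _; rewrite /h powR_ge0/= !powRN lef_pV2 ?posrE ?powR_gt0 ?omega_gt0//.
    apply: ge0_ler_powR; [by rewrite divr_ge0// ltW|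
      by rewrite nnegrE addr_ge0// sqr_ge0|by rewrite nnegrE ltW// omega_gt0|].
    by rewrite omegaE lerD2l (bigD1 i)//= lerDl sumr_ge0// => j _; rewrite sqr_ge0.
  by rewrite ltr_pwDl// sqr_ge0.
Qed.

End integrability.

(** * The Cauchy measure is a probability measure *)

Section cauchy_probability.
Context (R : realType) (n : nat) (beta : R).
Hypotheses (n0 : (0 < n)%N) (beta_gt : n%:R / 2 < beta).
Local Notation rV := 'rV[R]_n.
Local Notation mu := (@cauchy_measure R n beta).
Local Notation lam := (@lebesgue_rV R n).
Local Notation pdf := (@cauchy_pdf R n beta).

(** [fine] would turn an infinite integral into 0, so finiteness is part of the argument; an
    integral equal to 0 would make the whole space Lebesgue-null, the integrand being positive
    everywhere. *)
Lemma cauchy_Z_gt0 : 0 < cauchy_Z n beta :> R.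
Proof.
have m : measurable_fun setT (fun x : rV => (omega x `^ (- beta))%:E).
  apply/measurable_EFinP.
  exact: (measurableT_comp (measurable_powR _) (@measurable_omega R n)).
have i0 : (0 <= \int[lam]_x (omega x `^ (- beta))%:E)%E.
  by apply: integral_ge0 => x _; rewrite lee_fin powR_ge0.
rewrite /cauchy_Z fine_gt0// (integral_omega_lty n0 beta_gt) andbT lt_def i0 andbT.
apply/eqP => z.
have : (\int[lam]_x `|(omega x `^ (- beta))%:E| = 0)%E.
  by rewrite -[RHS]z; apply: eq_integral => x _; rewrite gee0_abs// lee_fin powR_ge0.
move=> /(ae_eq_integral_abs _ measurableT m) [N [mN N0 sN]].
have /eqP := lebesgue_rV_setT_neq0 R n; apply.
apply/eqP; rewrite -measure_le0 -[leRHS]N0; apply: le_measure; rewrite ?inE//.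
move=> x _; apply: sN => /= /(_ I) [] /eqP; rewrite powR_eq0.
by rewrite gt_eqF// omega_gt0.
Qed.

Lemma cauchy_integrable_density (f : rV -> R) : measurable_fun setT f ->
  mu.-integrable setT (EFin \o f) <-> lam.-integrable setT (fun x => (f x * pdf x)%:E).
Proof.
move=> mf; apply: integrable_density => //.
- exact: measurable_cauchy_pdf.
- exact: cauchy_pdf_ge0.
Qed.

Lemma cauchy_Rintegral_density (f : rV -> R) : measurable_fun setT f ->
  \int[mu]_x f x = \int[lam]_x (f x * pdf x).
Proof.
move=> mf; apply: Rintegral_density => //.
- exact: measurable_cauchy_pdf.
- exact: cauchy_pdf_ge0.
Qed.

Lemma ae_lebesgue_cauchy (P : rV -> Prop) :
  {ae lam, forall x, P x} -> {ae mu, forall x, P x}.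
Proof.
apply: ae_density => //.
exact: measurable_cauchy_pdf.
Qed.

Lemma cauchy_measure_setT : mu setT = 1%E.
Proof.
rewrite /= /cauchy_measure; under eq_integral do rewrite EFinM.
rewrite ge0_integralZl//.
- rewrite -[X in (_ * X)%E]fineK; last first.
    rewrite ge0_fin_numE ?(integral_omega_lty n0 beta_gt)//.
    by apply: integral_ge0 => x _; rewrite lee_fin powR_ge0.
  by rewrite -/(cauchy_Z n beta) -EFinM mulVf// gt_eqF// cauchy_Z_gt0.
- apply/measurable_EFinP.
  exact: (measurableT_comp (measurable_powR _) (@measurable_omega R n)).
- by move=> x _; rewrite lee_fin powR_ge0.
- by rewrite lee_fin invr_ge0 ltW// cauchy_Z_gt0.
Qed.

Lemma cauchy_integrable_omega a : 2 * a < 2 * beta - n%:R ->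
  mu.-integrable setT (fun x => (omega x `^ a)%:E).
Proof.
move=> ab; have mo c : measurable_fun setT (fun x : rV => omega x `^ c).
  exact: (measurableT_comp (measurable_powR _) (@measurable_omega R n)).
apply/(cauchy_integrable_density (mo a)).
apply/integrableP; split.
  by apply/measurable_EFinP; apply: measurable_funM; [exact: mo|exact: measurable_cauchy_pdf].
have -> : (fun x : rV => `|(omega x `^ a * pdf x)%:E|%E) =
    (fun x => (cauchy_Z n beta)^-1%:E * (omega x `^ (- (beta - a)))%:E)%E.
  apply/funext => x; rewrite gee0_abs ?lee_fin ?(mulr_ge0 (powR_ge0 _ _) (cauchy_pdf_ge0 beta x))//.
  rewrite -EFinM /cauchy_pdf mulrCA -powRD; first by congr (_ * _ `^ _)%:E; ring.
  by rewrite (gt_eqF (omega_gt0 x)) implybT.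
rewrite ge0_integralZl//.
- apply: lte_mul_pinfty; rewrite ?lee_fin ?invr_ge0 ?ltW ?cauchy_Z_gt0//.
  by apply: integral_omega_lty => //; lra.
- exact/measurable_EFinP.
- by move=> x _; rewrite lee_fin powR_ge0.
- by rewrite lee_fin invr_ge0 ltW// cauchy_Z_gt0.
Qed.

End cauchy_probability.

Ltac solve_smooth :=
  lazymatch goal with
  | H : smooth ?f |- smooth ?f => exact H
  | H : forall i, smooth (?f i) |- smooth (?f ?i) => exact (H i)
  | H : forall i, smooth (?f i) |- smooth (fun x => ?f ?i x) => exact (H i)
  | H : forall i j, smooth (?f i j) |- smooth (?f ?i ?j) => exact (H i j)
  | H : forall i j, smooth (?f i j) |- smooth (fun x => ?f ?i ?j x) => exact (H i j)
  | H : smooth ?f |- smooth (fun x => ?f x) => exact H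
  | |- smooth (fun x => @?a x - @?b x) =>
      refine (@smoothB _ _ a b _ _); cbv beta; solve_smooth
  | |- smooth (fun x => @?a x + @?b x) =>
      refine (@smoothD _ _ a b _ _); cbv beta; solve_smooth
  | |- smooth (fun x => @?a x * @?b x) =>
      refine (@smoothM _ _ a b _ _); cbv beta; solve_smooth
  | |- smooth (fun x => \sum_(i <- ?s) (@?F x i)) =>
      refine (@smooth_sum _ _ _ s (fun i x => F x i) _); intro; cbv beta; solve_smooth
  | |- smooth (fun x => partial ?i ?f x) =>
      refine (@smooth_partial _ _ i f _); solve_smooth
  | |- smooth (partial ?i ?f) =>
      refine (@smooth_partial _ _ i f _); solve_smooth
  | |- smooth (fun x => coord ?i x) => exact (@smooth_coord _ _ i)
  | |- smooth (coord ?i) => exact (@smooth_coord _ _ i)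
  | |- smooth (@omega _ _) => exact (@smooth_omega _ _)
  | |- smooth (fun x => omega x) => exact (@smooth_omega _ _)
  | |- smooth (fun x => omega x `^ ?a) => exact (@smooth_omega_pow _ _ a)
  | |- smooth (fun x => ?c) => exact (@smooth_cst _ _ c)
  | _ => idtac
  end.

(** * Divergence theorem for the weighted measure and Green formula *)

Section integration_by_parts.
Context (R : realType) (n : nat) (beta : R).
Local Notation rV := 'rV[R]_n.
Local Notation mu := (@cauchy_measure R n beta).
Local Notation lam := (@lebesgue_rV R n).
Implicit Types u v : rV -> R.

Lemma smooth_measurable u : smooth u -> measurable_fun setT u.
Proof. by move=> su; apply: continuous_measurable_rV; exact: smooth_continuous. Qed.

Lemma omega_powB1 x : omega x `^ (1 - beta) = omega (x : rV) * omega x `^ (- beta).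
Proof.
rewrite powRD; last by rewrite (gt_eqF (omega_gt0 x)) implybT.
by rewrite powRr1// ltW// omega_gt0.
Qed.

Lemma omega_powB2 x : omega x `^ (2 - beta) = omega (x : rV) ^+ 2 * omega x `^ (- beta).
Proof.
rewrite powRD; last by rewrite (gt_eqF (omega_gt0 x)) implybT.
by rewrite powR_mulrn// ltW// omega_gt0.
Qed.

(** The density removes the factor omega^(-beta) from the hypothesis, and each partial derivative
    has zero Lebesgue integral. Integrations by parts against the Cauchy measure thereby reduce to
    computing a divergence. *)
Lemma cauchy_integral_div (F : 'I_n -> rV -> R) (G : rV -> R) :
  (forall i, Cc_infty (F i)) -> measurable_fun setT G ->
  (forall x, G x * omega x `^ (- beta) = \sum_(i < n) partial i (F i) x) ->
  \int[mu]_x G x = 0.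
Proof.
move=> cF mG GF; rewrite cauchy_Rintegral_density//.
have iF i : lam.-integrable setT (EFin \o partial i (F i)).
  have cp := Cc_partial i (cF i).
  by apply: integrable_bsupp; [exact: smooth_continuous (Cc_smooth cp)|exact: Cc_bsupp].
have -> : (fun x => G x * cauchy_pdf beta x) =
    (fun x => (cauchy_Z n beta)^-1 * \sum_(i < n) partial i (F i) x).
  by apply/funext => x; rewrite -GF /cauchy_pdf; ring.
rewrite RintegralZl//; last first.
  rewrite (_ : EFin \o _ = fun x => (\sum_(i < n) (partial i (F i) x)%:E)%E).
    by apply: integrable_sum => // i _; exact: iF.
  by apply/funext => x /=; rewrite sumEFin.
suff -> : \int[lam]_x (\sum_(i < n) partial i (F i) x) = 0 by rewrite mulr0.
have H (s : seq 'I_n) : \int[lam]_x (\sum_(i <- s) partial i (F i) x) = 0.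
  elim: s => [|i s IH].
    by under eq_Rintegral do rewrite big_nil; rewrite Rintegral_cst// mul0r.
  under eq_Rintegral do rewrite big_cons.
  rewrite RintegralD//; last first.
    rewrite (_ : EFin \o _ = fun x => (\sum_(i <- s) (partial i (F i) x)%:E)%E).
      by apply: integrable_sum => // k _; exact: iF.
    by apply/funext => x /=; rewrite sumEFin.
  by rewrite IH Cc_integral_partial0 ?addr0.
exact: H.
Qed.

(** Multiplied by omega, this is the carre du champ of [L]. *)
Definition gdot u v (x : rV) : R := \sum_(i < n) partial i u x * partial i v x.

Lemma laplacianE u x : laplacian u x = \sum_(i < n) partial i (partial i u) x.
Proof. by rewrite /laplacian /mxtrace; apply: eq_bigr => i _; rewrite mxE. Qed.

Lemma cauchy_LE u x : cauchy_L beta u x =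
  omega x * (\sum_(i < n) partial i (partial i u) x) -
  2 * (beta - 1) * (\sum_(i < n) x ord0 i * partial i u x).
Proof.
rewrite /cauchy_L laplacianE; congr (_ - _ * _).
by apply: eq_bigr => i _; rewrite mxE.
Qed.

Lemma smooth_gdot u v : smooth u -> smooth v -> smooth (gdot u v).
Proof. by move=> su sv; rewrite /gdot; solve_smooth. Qed.

Lemma smooth_cauchy_L u : smooth u -> smooth (cauchy_L beta u).
Proof.
move=> su; rewrite (_ : cauchy_L beta u = fun x =>
    omega x * (\sum_(i < n) partial i (partial i u) x) -
    2 * (beta - 1) * (\sum_(i < n) coord i x * partial i u x)).
  by solve_smooth.
by apply/funext => x; rewrite cauchy_LE.
Qed.

Lemma Cc_cauchy_L u : Cc_infty u -> Cc_infty (cauchy_L beta u).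
Proof.
move=> cu; apply/Cc_inftyP; split; first by apply: smooth_cauchy_L; exact: Cc_smooth.
have h (F : 'I_n -> rV -> R) : (forall i, bsupp (F i)) -> bsupp (fun x => \sum_(i < n) F i x).
  move=> bF; suff H (s : seq 'I_n) : bsupp (fun x => \sum_(i <- s) F i x) by exact: H.
  elim: s => [|i s IH]; first by exists 0 => x; rewrite big_nil eqxx.
  rewrite (_ : (fun x => _) = fun x => F i x + \sum_(k <- s) F k x).
    exact: bsuppD.
  by apply/funext => x; rewrite big_cons.
rewrite (_ : cauchy_L beta u = fun x =>
    omega x * (\sum_(i < n) partial i (partial i u) x) +
    (- (2 * (beta - 1))) * (\sum_(i < n) x ord0 i * partial i u x)).
  apply: bsuppD; apply: bsuppMr; apply: h => i; do ?apply: bsuppMr;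
  by do ?apply: bsupp_partial; exact: Cc_bsupp.
by apply/funext => x; rewrite cauchy_LE mulNr.
Qed.

(** L u = omega^beta div(omega^(1-beta) grad u), so the relevant field is v omega^(1-beta) grad
    u. *)
Lemma cauchy_green u v : Cc_infty u -> smooth v ->
  \int[mu]_x (v x * cauchy_L beta u x + omega x * gdot u v x) = 0.
Proof.
move=> cu sv; have su := Cc_smooth cu.
apply: (@cauchy_integral_div (fun i x => partial i u x * (v x * omega x `^ (1 - beta)))).
- by move=> i; apply: CcMl; [exact: Cc_partial|solve_smooth].
- apply: smooth_measurable.
  exact: smoothD (smoothM sv (smooth_cauchy_L su)) (smoothM (@smooth_omega _ _) (smooth_gdot su sv)).
- move=> x; rewrite cauchy_LE /gdot.
  have -> : \sum_(i < n) partial i (fun x0 => partial i u x0 * (v x0 * omega x0 `^ (1 - beta))) x =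
    \sum_(i < n) (omega x * omega x `^ (- beta) * (partial i u x * partial i v x) +
      v x * omega x * omega x `^ (- beta) * partial i (partial i u) x +
      v x * (2 * (1 - beta)) * omega x `^ (- beta) * (x ord0 i * partial i u x)).
    apply: eq_bigr => i _.
    rewrite partialM; [|by solve_smooth..].
    rewrite partialM; [|by solve_smooth..].
    by rewrite partial_omega_pow omega_powB1 addrAC subrr add0r; ring.
  by rewrite !big_split/= -!mulr_sumr; ring.
Qed.

End integration_by_parts.

(** * Divergences of three weighted vector fields *)

Section divergences.
Context (R : realType) (n : nat) (beta : R).
Local Notation rV := 'rV[R]_n.
Context (g : 'I_n -> rV -> R) (h : 'I_n -> 'I_n -> rV -> R).
Hypotheses (sg : forall i, smooth (g i)) (sh : forall i j, smooth (h i j)).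
Hypotheses (gh : forall i j, partial i (g j) = h i j) (hC : forall i j, h i j = h j i).
Hypothesis h3 : forall i j k, partial i (h j k) = partial j (h i k).

Lemma partial_sumM (a b : 'I_n -> rV -> R) i x :
  (forall j, smooth (a j)) -> (forall j, smooth (b j)) ->
  partial i (fun x => \sum_(j < n) a j x * b j x) x =
  \sum_(j < n) (a j x * partial i (b j) x + b j x * partial i (a j) x).
Proof.
move=> sa sb; rewrite (@partial_sum _ _ _ _ (fun j x => a j x * b j x)).
  by apply: eq_bigr => j _; rewrite partialM.
by move=> j; exact: smoothM.
Qed.

(** With g and h standing for the first and second derivatives, the field h g - (tr h) g is chosen
    so that third derivatives cancel: the divergence of h g yields the same third-order term as the
    derivative of tr h, by [h3] and the symmetry of h. *)
Lemma div_hess_grad x : \sum_(i < n) partial i (fun x => omega x `^ (2 - beta) *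
      (\sum_(j < n) h i j x * g j x - (\sum_(j < n) h j j x) * g i x)) x =
  omega x `^ (- beta) * (2 * (2 - beta) * omega x *
    (\sum_(i < n) \sum_(j < n) x ord0 i * (h i j x * g j x) -
     (\sum_(i < n) h i i x) * (\sum_(i < n) x ord0 i * g i x)) +
    omega x ^+ 2 * (\sum_(i < n) \sum_(j < n) h i j x ^+ 2 - (\sum_(i < n) h i i x) ^+ 2)).
Proof.
set D := \sum_(i < n) h i i x.
pose T i j := partial i (h i j) x * g j x.
have -> : \sum_(i < n) partial i (fun x => omega x `^ (2 - beta) *
      (\sum_(j < n) h i j x * g j x - (\sum_(j < n) h j j x) * g i x)) x =
  \sum_(i < n) (omega x `^ (- beta) * (2 * (2 - beta)) * omega x *
      (\sum_(j < n) x ord0 i * (h i j x * g j x) - D * (x ord0 i * g i x)) +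
      omega x `^ (- beta) * omega x ^+ 2 * (\sum_(j < n) h i j x ^+ 2 +
      \sum_(j < n) T i j - \sum_(j < n) T j i - D * h i i x)).
  apply: eq_bigr => i _.
  rewrite (@partialM _ _ _ (fun x => omega x `^ (2 - beta))); [|by solve_smooth..].
  rewrite (@partialB _ _ _ (fun x => \sum_(j < n) h i j x * g j x)); [|by solve_smooth..].
  rewrite partial_sumM//.
  rewrite (@partialM _ _ _ (fun x => \sum_(j < n) h j j x)); [|by solve_smooth..].
  rewrite (partial_sum _ _ _ (fun j => sh j j)) partial_omega_pow -/D gh big_split/=.
  have -> : \sum_(j < n) h i j x * partial i (g j) x = \sum_(j < n) h i j x ^+ 2.
    by apply: eq_bigr => j _; rewrite gh expr2.
  have -> : \sum_(j < n) g j x * partial i (h i j) x = \sum_(j < n) T i j.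
    by apply: eq_bigr => j _; rewrite /T mulrC.
  have -> : \sum_(j < n) partial i (h j j) x = \sum_(j < n) partial j (h j i) x.
    by apply: eq_bigr => j _; rewrite h3 (hC i j).
  rewrite -!mulr_sumr -mulr_suml omega_powB2.
  rewrite (_ : 2 - beta - 1 = 1 - beta) ?omega_powB1; last by ring.
  by ring.
rewrite big_split/= -!mulr_sumr !sumrB !big_split/= -!mulr_sumr.
by rewrite [\sum_i \sum_j T j i]exchange_big/= -/D; ring.
Qed.

(** This field trades the product (x.g) tr h, left over by [div_hess_grad], for terms without the
    trace. *)
Lemma div_radial_grad x : \sum_(i < n) partial i (fun x => omega x `^ (1 - beta) *
      ((\sum_(j < n) coord j x * g j x) * g i x)) x =
  omega x `^ (- beta) * (omega x * ((\sum_(i < n) x ord0 i * g i x) * (\sum_(i < n) h i i x) +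
     \sum_(i < n) g i x ^+ 2 + \sum_(i < n) \sum_(j < n) x ord0 i * (h i j x * g j x)) +
     2 * (1 - beta) * (\sum_(i < n) x ord0 i * g i x) ^+ 2).
Proof.
set B := \sum_(i < n) x ord0 i * g i x.
have -> : \sum_(i < n) partial i (fun x => omega x `^ (1 - beta) *
      ((\sum_(j < n) coord j x * g j x) * g i x)) x =
  \sum_(i < n) (omega x `^ (- beta) * omega x * (B * h i i x + g i x ^+ 2 +
      \sum_(j < n) x ord0 j * (h j i x * g i x)) +
    omega x `^ (- beta) * (2 * (1 - beta) * B) * (x ord0 i * g i x)).
  apply: eq_bigr => i _.
  rewrite (@partialM _ _ _ (fun x => omega x `^ (1 - beta))); [|by solve_smooth..].
  rewrite (@partialM _ _ _ (fun x => \sum_(j < n) coord j x * g j x)); [|by solve_smooth..].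
  rewrite (@partial_sumM (fun j => coord j))//; last by move=> j; exact: smooth_coord.
  rewrite partial_omega_pow gh big_split/= -/B.
  have -> : \sum_(j < n) g j x * partial i (coord j) x = g i x.
    rewrite (bigD1 i)//= partial_coord eqxx mulr1 big1 ?addr0// => j ij.
    by rewrite partial_coord eq_sym (negbTE ij) mulr0.
  have -> : \sum_(j < n) x ord0 j * (h j i x * g i x) = (\sum_(j < n) x ord0 j * h j i x) * g i x.
    by rewrite mulr_suml; apply: eq_bigr => j _; ring.
  have -> : \sum_(j < n) coord j x * partial i (g j) x = \sum_(j < n) x ord0 j * h j i x.
    by apply: eq_bigr => j _; rewrite gh hC.
  rewrite omega_powB1 (_ : 1 - beta - 1 = - beta); last by ring.
  by rewrite -/(coord _ _); ring.
rewrite big_split/= -!mulr_sumr !big_split/= -!mulr_sumr.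
by rewrite [\sum_i \sum_j x ord0 j * _]exchange_big/= -/B; ring.
Qed.

(** This field trades the remaining mixed term x.(h g) for terms in |g|^2 alone; the factor n is the
    divergence of x. *)
Lemma div_grad_radial x : \sum_(i < n) partial i (fun x => omega x `^ (1 - beta) *
      ((\sum_(j < n) g j x * g j x) * coord i x)) x =
  omega x `^ (- beta) * (omega x * (n%:R * (\sum_(i < n) g i x ^+ 2) +
     2 * (\sum_(i < n) \sum_(j < n) x ord0 i * (h i j x * g j x))) +
     2 * (1 - beta) * (\sum_(i < n) x ord0 i ^+ 2) * (\sum_(i < n) g i x ^+ 2)).
Proof.
set A := \sum_(i < n) g i x ^+ 2.
have -> : \sum_(i < n) partial i (fun x => omega x `^ (1 - beta) *
      ((\sum_(j < n) g j x * g j x) * coord i x)) x =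
  \sum_(i < n) (omega x `^ (- beta) * omega x * (A +
      2 * \sum_(j < n) x ord0 i * (h i j x * g j x)) +
    omega x `^ (- beta) * (2 * (1 - beta) * A) * (x ord0 i ^+ 2)).
  apply: eq_bigr => i _.
  rewrite (@partialM _ _ _ (fun x => omega x `^ (1 - beta))); [|by solve_smooth..].
  rewrite (@partialM _ _ _ (fun x => \sum_(j < n) g j x * g j x)); [|by solve_smooth..].
  rewrite (@partial_sumM g)//.
  rewrite partial_omega_pow partial_coord eqxx.
  have -> : \sum_(j < n) (g j x * partial i (g j) x + g j x * partial i (g j) x) =
      2 * \sum_(j < n) h i j x * g j x.
    by rewrite mulr_sumr; apply: eq_bigr => j _; rewrite gh; ring.
  have -> : \sum_(j < n) g j x * g j x = A by apply: eq_bigr => j _; rewrite expr2.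
  rewrite -mulr_sumr omega_powB1 (_ : 1 - beta - 1 = - beta); last by ring.
  by rewrite /coord/=; ring.
rewrite big_split/= -!mulr_sumr !big_split/= -!mulr_sumr sumr_const card_ord -[A *+ n]mulr_natl.
by ring.
Qed.

End divergences.

(** * The quadratic form Q: expansion, sign and integral *)

Section gamma2.
Context (R : realType) (n : nat) (beta : R).
Local Notation rV := 'rV[R]_n.
Local Notation mu := (@cauchy_measure R n beta).
Let eps : R := n%:R / 2 + 2 - beta.
Let lambda : R := (beta - n%:R / 2) ^+ 2.
Let K : R := (n%:R - 2) * (4 * (beta - 1) ^+ 2 - 4 * (n%:R - 2) * (beta - 1)
                         + (n%:R + 2) ^+ 2) / (8 * (n%:R - 1)).

(** The integrand of the theorem as an algebraic function of the point, a vector and a matrix, so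
    that the same form serves classical derivatives, their L^2 limits and the weak derivatives of
    the statement. *)
Definition gamma2_form (x g : rV) (H : 'M[R]_n) : R :=
  n%:R / (n%:R - 1)
    * hs_norm (omega x *: H + (eps / 2) *: (tensor g x + tensor x g)) ^+ 2
  - 1 / (n%:R - 1) * (omega x * \tr H + eps * dot g x) ^+ 2
  + K * (enorm g ^+ 2 * enorm x ^+ 2 - dot g x ^+ 2)
  + eps * (beta + n%:R / 2) * enorm g ^+ 2.

Lemma sqr_enorm (x : rV) : enorm x ^+ 2 = \sum_(i < n) x ord0 i ^+ 2.
Proof.
by rewrite /enorm sqr_sqrtr ?sumr_ge0// => i _; rewrite -expr2 sqr_ge0.
Qed.

Lemma sqr_hs_norm (A : 'M[R]_n) : hs_norm A ^+ 2 = \sum_(i < n) \sum_(j < n) A i j ^+ 2.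
Proof.
by rewrite /hs_norm sqr_sqrtr// sumr_ge0// => i _; rewrite sumr_ge0// => j _; rewrite sqr_ge0.
Qed.

Lemma sum_mul_sqr (I : Type) (s : seq I) (a b : I -> R) :
  \sum_(i <- s) \sum_(j <- s) (a i * b j) ^+ 2 =
  (\sum_(i <- s) a i ^+ 2) * (\sum_(j <- s) b j ^+ 2).
Proof.
rewrite mulr_suml; apply: eq_bigr => i _; rewrite mulr_sumr; apply: eq_bigr => j _.
by rewrite exprMn.
Qed.

Lemma gamma2_formE x g H : gamma2_form x g H =
  n%:R / (n%:R - 1) * (\sum_(i < n) \sum_(j < n)
    (omega x * H i j + eps / 2 * (g ord0 i * x ord0 j + x ord0 i * g ord0 j)) ^+ 2)
  - 1 / (n%:R - 1) * (\sum_(i < n) (omega x * H i i + eps * (g ord0 i * x ord0 i))) ^+ 2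
  + K * (\sum_(i < n) \sum_(j < n) (g ord0 i * x ord0 j) ^+ 2 -
         (\sum_(i < n) g ord0 i * x ord0 i) ^+ 2)
  + eps * (beta + n%:R / 2) * \sum_(i < n) g ord0 i ^+ 2.
Proof.
rewrite /gamma2_form sqr_hs_norm !sqr_enorm sum_mul_sqr; congr (_ + _ * _ + _).
congr (_ * _ - _ * _ ^+ 2).
  apply: eq_bigr => i _; apply: eq_bigr => j _; congr (_ ^+ 2).
  by rewrite !mxE !big_ord1 !mxE.
by rewrite big_split/= -!mulr_sumr.
Qed.

Lemma smooth_gamma2 u : smooth u -> smooth (fun x => gamma2_form x (grad u x) (hess u x)).
Proof.
move=> su.
rewrite (_ : (fun x => _) = fun x => n%:R / (n%:R - 1) * (\sum_(i < n) \sum_(j < n)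
    ((omega x * partial i (partial j u) x +
      eps / 2 * (partial i u x * coord j x + coord i x * partial j u x)) *
    (omega x * partial i (partial j u) x +
      eps / 2 * (partial i u x * coord j x + coord i x * partial j u x))))
  - 1 / (n%:R - 1) *
    ((\sum_(i < n) (omega x * partial i (partial i u) x + eps * (partial i u x * coord i x))) *
     (\sum_(i < n) (omega x * partial i (partial i u) x + eps * (partial i u x * coord i x))))
  + K * (\sum_(i < n) \sum_(j < n) ((partial i u x * coord j x) * (partial i u x * coord j x)) -
         (\sum_(i < n) partial i u x * coord i x) * (\sum_(i < n) partial i u x * coord i x))
  + eps * (beta + n%:R / 2) * \sum_(i < n) partial i u x * partial i u x).
  by solve_smooth.
apply/funext => x; rewrite gamma2_formE !expr2.
congr (_ * _ - _ * (_ * _) + _ * (_ - _ * _) + _ * _).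
all: try (apply: eq_bigr => i _).
all: try (apply: eq_bigr => j _).
all: by rewrite -?expr2 !mxE.
Qed.

Lemma bsupp_gamma2 u : Cc_infty u -> bsupp (fun x => gamma2_form x (grad u x) (hess u x)).
Proof.
move=> cu.
(* Where this sum of squares vanishes, all first and second derivatives vanish and so does the form;
   its support therefore bounds that of the form. *)
have cF : Cc_infty (fun x => \sum_(i < n) (partial i u x * partial i u x +
    \sum_(j < n) partial i (partial j u) x * partial i (partial j u) x)).
  apply: Cc_sum => i; have ci := Cc_partial i cu.
  refine (CcD (CcMr ci (Cc_smooth ci)) (Cc_sum _ (fun j => _))).
  have cj := Cc_partial i (Cc_partial j cu).
  exact: CcMr cj (Cc_smooth cj).
have [M hM] := Cc_bsupp cF; exists M => x qx; apply: hM; apply: contra qx => /eqP.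
have h0 i : 0 <= \sum_(j < n) partial i (partial j u) x * partial i (partial j u) x.
  by apply: sumr_ge0 => j _; rewrite -expr2 sqr_ge0.
move=> /psumr_eq0P F0.
have {}F0 i : partial i u x = 0 /\ forall j, partial i (partial j u) x = 0.
  have := F0 (fun i _ => addr_ge0 (sqr_ge0 _) (h0 i)) i isT => /eqP.
  rewrite paddr_eq0 ?h0 -?expr2 ?sqr_ge0// sqrf_eq0 => /andP[/eqP -> /eqP].
  move=> /psumr_eq0P H; split=> // j.
  have := H (fun j _ => sqr_ge0 _) j isT => /eqP.
  by rewrite -expr2 sqrf_eq0 => /eqP.
have -> : grad u x = 0 by apply/rowP => i; rewrite !mxE (F0 i).1.
have -> : hess u x = 0 by apply/matrixP => i j; rewrite !mxE (F0 i).2.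
rewrite gamma2_formE; apply/eqP.
rewrite big1; last by move=> i _; apply: big1 => j _; rewrite !mxE; ring.
rewrite big1; last by move=> i _; rewrite !mxE; ring.
rewrite big1; last by move=> i _; apply: big1 => j _; rewrite !mxE; ring.
rewrite big1; last by move=> i _; rewrite !mxE; ring.
rewrite big1; last by move=> i _; rewrite !mxE; ring.
by ring.
Qed.

(** Lagrange's identity: the difference of the two sides is half the double sum of (a_i b_j - a_j
    b_i)^2. *)
Lemma sum_CauchySchwarz (a b : 'I_n -> R) :
  (\sum_i a i * b i) ^+ 2 <= (\sum_i a i ^+ 2) * (\sum_i b i ^+ 2).
Proof.
have : 0 <= \sum_(i < n) \sum_(j < n) (a i * b j - a j * b i) ^+ 2.
  by apply: sumr_ge0 => i _; apply: sumr_ge0 => j _; exact: sqr_ge0.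
have -> : \sum_(i < n) \sum_(j < n) (a i * b j - a j * b i) ^+ 2 =
    \sum_(i < n) \sum_(j < n) ((a i * b j) ^+ 2 + (a j * b i) ^+ 2 -
      2 * ((a i * b i) * (a j * b j))).
  by apply: eq_bigr => i _; apply: eq_bigr => j _; ring.
under eq_bigr do rewrite sumrB big_split/= -!mulr_sumr.
rewrite sumrB big_split/= -mulr_sumr -mulr_suml.
rewrite [\sum_(i < n) \sum_(j < n) (a j * b i) ^+ 2]exchange_big/= sum_mul_sqr.
by lra.
Qed.

(** The scalar squared in the second term is the trace of the matrix in the first, so the two
    combine to a nonnegative quantity by (tr M)^2 <= n |M|^2. The bracket in [K] equals (2 (beta -
    1) - (n - 2))^2 + 8 n, and the last term has its sign because beta <= n/2 + 2. *)
Lemma gamma2_form_ge0 (x g : rV) (H : 'M[R]_n) : (1 < n)%N -> n%:R / 2 < beta ->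
  beta <= n%:R / 2 + 2 -> 0 <= gamma2_form x g H.
Proof.
move=> n1 bn bn2; have n0 : 0 < n%:R - 1 :> R by rewrite subr_gt0 ltr1n.
have n2' : 2 <= n%:R :> R by rewrite (ler_nat _ 2).
have CS := sum_CauchySchwarz.
have trH (M : 'I_n -> 'I_n -> R) : (\sum_i M i i) ^+ 2 <= n%:R * \sum_i \sum_j M i j ^+ 2.
  have := CS (fun=> 1) (fun i => M i i).
  under eq_bigr do rewrite mul1r.
  rewrite [X in _ <= X * _ -> _](_ : _ = n%:R); last first.
    by under eq_bigr do rewrite expr1n; rewrite sumr_const card_ord.
  move=> /le_trans; apply; rewrite ler_wpM2l//; apply: ler_sum => i _.
  by rewrite (bigD1 i)//= lerDl sumr_ge0// => j _; exact: sqr_ge0.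
have eps0 : 0 <= eps by rewrite /eps; lra.
rewrite gamma2_formE; apply: addr_ge0; last first.
  rewrite mulr_ge0// ?mulr_ge0//; first by lra.
  by apply: sumr_ge0 => i _; exact: sqr_ge0.
apply: addr_ge0; last first.
  apply: mulr_ge0.
    rewrite /K divr_ge0 ?mulr_ge0 ?subr_ge0// ?(ltW n0)//; last by move: n0; lra.
    by nra.
  by rewrite sum_mul_sqr subr_ge0.
have := trH (fun i j => omega x * H i j + eps / 2 * (g ord0 i * x ord0 j + x ord0 i * g ord0 j)).
rewrite (_ : \sum_(i < n) (omega x * H i i + eps / 2 * (g ord0 i * x ord0 i + x ord0 i * g ord0 i)) =
  \sum_(i < n) (omega x * H i i + eps * (g ord0 i * x ord0 i))); last first.
  by apply: eq_bigr => i _; field.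
move: (\sum_(i < n) _) (\sum_(i < n) _) => T S TS.
have -> : n%:R / (n%:R - 1) * S - 1 / (n%:R - 1) * T ^+ 2 = (n%:R * S - T ^+ 2) / (n%:R - 1) by field; rewrite gt_eqF.
by rewrite divr_ge0 ?(ltW n0)// subr_ge0.
Qed.

Hypothesis n2 : (2 <= n)%N.

Lemma natr_subr1_neq0 : n%:R - 1 != 0 :> R.
Proof. by rewrite subr_eq0 pnatr_eq1 neq_ltn n2 orbT. Qed.

Lemma gamma2_formE2 (x g : rV) (H : 'M[R]_n) : (forall i j, H i j = H j i) ->
  gamma2_form x g H =
    n%:R / (n%:R - 1) * (omega x ^+ 2 * (\sum_(i < n) \sum_(j < n) H i j ^+ 2) +
       2 * omega x * eps * (\sum_(i < n) \sum_(j < n) x ord0 i * (H i j * g ord0 j)) +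
       eps ^+ 2 / 2 * ((\sum_(i < n) g ord0 i ^+ 2) * (\sum_(i < n) x ord0 i ^+ 2) +
         (\sum_(i < n) x ord0 i * g ord0 i) ^+ 2))
    - 1 / (n%:R - 1) * (omega x * (\sum_(i < n) H i i) + eps * (\sum_(i < n) x ord0 i * g ord0 i)) ^+ 2
    + K * ((\sum_(i < n) g ord0 i ^+ 2) * (\sum_(i < n) x ord0 i ^+ 2) -
         (\sum_(i < n) x ord0 i * g ord0 i) ^+ 2)
    + eps * (beta + n%:R / 2) * (\sum_(i < n) g ord0 i ^+ 2).
Proof.
move=> HC; rewrite gamma2_formE sum_mul_sqr.
have -> : \sum_(i < n) g ord0 i * x ord0 i = \sum_(i < n) x ord0 i * g ord0 i.
  by apply: eq_bigr => i _; rewrite mulrC.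
have -> : \sum_(i < n) (omega x * H i i + eps * (g ord0 i * x ord0 i)) =
    omega x * (\sum_(i < n) H i i) + eps * (\sum_(i < n) x ord0 i * g ord0 i).
  by rewrite big_split/= -!mulr_sumr; congr (_ + _ * _); apply: eq_bigr => i _; rewrite mulrC.
congr (_ * _ - _ + _ + _).
have -> : \sum_(i < n) \sum_(j < n) (omega x * H i j +
      eps / 2 * (g ord0 i * x ord0 j + x ord0 i * g ord0 j)) ^+ 2 =
    \sum_(i < n) \sum_(j < n) (omega x ^+ 2 * H i j ^+ 2 +
      omega x * eps * (x ord0 i * (H i j * g ord0 j)) +
      omega x * eps * (x ord0 j * (H j i * g ord0 i)) +
      eps ^+ 2 / 4 * (g ord0 i * x ord0 j) ^+ 2 + eps ^+ 2 / 4 * (x ord0 i * g ord0 j) ^+ 2 +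
      eps ^+ 2 / 2 * ((x ord0 i * g ord0 i) * (x ord0 j * g ord0 j))).
  by apply: eq_bigr => i _; apply: eq_bigr => j _; rewrite (HC j i); field.
under eq_bigr do rewrite !big_split/= -!mulr_sumr.
rewrite !big_split/= -!mulr_sumr -!mulr_suml.
rewrite [X in _ + omega x * eps * X + _]exchange_big/=.
have -> : \sum_(i < n) x ord0 i * \sum_(j < n) H i j * g ord0 j =
    \sum_(i < n) \sum_(j < n) x ord0 i * (H i j * g ord0 j).
  by apply: eq_bigr => i _; rewrite mulr_sumr.
by rewrite !sum_mul_sqr; field.
Qed.

Lemma gamma2_integral u : Cc_infty u ->
  \int[mu]_x (cauchy_L beta u x ^+ 2 - lambda * (omega x * gdot u u x) -
    gamma2_form x (grad u x) (hess u x)) = 0.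
Proof.
move=> cu; have su := Cc_smooth cu.
(* The integrand is sought as omega^beta times the divergence of al F1 + b F2 + c F3. Comparing the
   coefficients of |Hess u|^2, of (x.grad u) Lap u and of x.(Hess u grad u) fixes al, b and c in
   this order. The terms in |grad u|^2 and (x.grad u)^2 then agree for the given [eps], [K] and
   [lambda]. *)
pose al : R := - n%:R / (n%:R - 1).
pose b : R := - 4 * (beta - 1) + 2 * eps / (n%:R - 1) - 2 * n%:R * (2 - beta) / (n%:R - 1).
pose c : R := (- 2 * eps * n%:R / (n%:R - 1) + 2 * n%:R * (2 - beta) / (n%:R - 1) - b) / 2.
have [g gE] : exists g : 'I_n -> rV -> R, forall i, g i = partial i u by exists (fun i => partial i u).
have [h hE] : exists h : 'I_n -> 'I_n -> rV -> R, forall i j, h i j = partial i (partial j u).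
  by exists (fun i j => partial i (partial j u)).
have sg i : smooth (g i) by rewrite gE; solve_smooth.
have sh i j : smooth (h i j) by rewrite hE; solve_smooth.
have cg i : Cc_infty (g i) by rewrite gE; exact: Cc_partial.
have hC i j : h i j = h j i by rewrite !hE; exact: partial_comm.
have gh i j : partial i (g j) = h i j by rewrite gE hE.
have h3 i j k : partial i (h j k) = partial j (h i k).
  by rewrite -!gh; exact: partial_comm (sg k).
pose F1 i x := omega x `^ (2 - beta) * (\sum_(j < n) h i j x * g j x - (\sum_(j < n) h j j x) * g i x).
pose F2 i x := omega x `^ (1 - beta) * ((\sum_(j < n) coord j x * g j x) * g i x).
pose F3 i x := omega x `^ (1 - beta) * ((\sum_(j < n) g j x * g j x) * coord i x).
have cF1 i : Cc_infty (F1 i).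
  refine (CcMr (CcB (Cc_sum _ (fun j => CcMr (cg j) (sh i j))) (CcMr (cg i) _)) _).
    exact: smooth_sum _ (fun j => sh j j).
  exact: smooth_omega_pow.
have cF2 i : Cc_infty (F2 i).
  refine (CcMr (CcMr (cg i) _) (@smooth_omega_pow _ _ _)).
  exact: smooth_sum _ (fun j => smoothM (@smooth_coord _ _ j) (sg j)).
have cF3 i : Cc_infty (F3 i).
  refine (CcMr (CcMl (Cc_sum _ (fun j => CcMr (cg j) (sg j))) _) (@smooth_omega_pow _ _ _)).
  exact: smooth_coord.
have sQ : smooth (fun x => cauchy_L beta u x ^+ 2 - lambda * (omega x * gdot u u x) -
    gamma2_form x (grad u x) (hess u x)).
  have sq := smooth_gamma2 su; have sL := smooth_cauchy_L beta su; have sd := smooth_gdot su su.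
  under eq_fun do rewrite expr2.
  exact: smoothB (smoothB (smoothM sL sL) (smoothZ _ (smoothM (@smooth_omega _ _) sd))) sq.
apply: (@cauchy_integral_div _ _ _ (fun i x => al * F1 i x + (b * F2 i x + c * F3 i x))).
- by move=> i; exact: CcD (CcZ _ (cF1 i)) (CcD (CcZ _ (cF2 i)) (CcZ _ (cF3 i))).
- exact: smooth_measurable.
move=> x.
have -> : \sum_(i < n) partial i (fun x => al * F1 i x + (b * F2 i x + c * F3 i x)) x =
    al * (\sum_(i < n) partial i (F1 i) x) +
    (b * (\sum_(i < n) partial i (F2 i) x) + c * (\sum_(i < n) partial i (F3 i) x)).
  rewrite !mulr_sumr -!big_split/=; apply: eq_bigr => i _.
  have s1 := Cc_smooth (cF1 i); have s2 := Cc_smooth (cF2 i); have s3 := Cc_smooth (cF3 i).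
  rewrite (partialD _ _ (smoothZ al s1) (smoothD (smoothZ b s2) (smoothZ c s3))).
  by rewrite (partialD _ _ (smoothZ b s2) (smoothZ c s3)) !partialZ.
rewrite (div_hess_grad beta sg sh gh hC h3) (div_radial_grad beta sg gh hC) (div_grad_radial beta sg gh).
have HC i j : hess u x i j = hess u x j i by rewrite !mxE -!hE hC.
rewrite (gamma2_formE2 _ _ HC) cauchy_LE.
have -> : \sum_(i < n) \sum_(j < n) hess u x i j ^+ 2 = \sum_(i < n) \sum_(j < n) h i j x ^+ 2.
  by apply: eq_bigr => i _; apply: eq_bigr => j _; rewrite mxE hE.
have -> : \sum_(i < n) \sum_(j < n) x ord0 i * (hess u x i j * grad u x ord0 j) =
    \sum_(i < n) \sum_(j < n) x ord0 i * (h i j x * g j x).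
  by apply: eq_bigr => i _; apply: eq_bigr => j _; rewrite !mxE hE gE.
have -> : \sum_(i < n) grad u x ord0 i ^+ 2 = \sum_(i < n) g i x ^+ 2.
  by apply: eq_bigr => i _; rewrite mxE gE.
have -> : \sum_(i < n) x ord0 i * grad u x ord0 i = \sum_(i < n) x ord0 i * g i x.
  by apply: eq_bigr => i _; rewrite mxE gE.
have -> : \sum_(i < n) hess u x i i = \sum_(i < n) h i i x.
  by apply: eq_bigr => i _; rewrite mxE hE.
have -> : \sum_(i < n) partial i (partial i u) x = \sum_(i < n) h i i x.
  by apply: eq_bigr => i _; rewrite hE.
have -> : \sum_(i < n) x ord0 i * partial i u x = \sum_(i < n) x ord0 i * g i x.
  by apply: eq_bigr => i _; rewrite gE.
have -> : gdot u u x = \sum_(i < n) g i x ^+ 2.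
  by apply: eq_bigr => i _; rewrite gE expr2.
rewrite omegaE /al /c /b /K /lambda /eps.
set P := _ `^ _; set N := \sum_(i < n) \sum_(j < n) h i j x ^+ 2.
set X := \sum_(i < n) \sum_(j < n) x ord0 i * _; set A := \sum_(i < n) g i x ^+ 2.
set B := \sum_(i < n) x ord0 i * _; set D := \sum_(i < n) h i i x.
set r := \sum_(i < n) x ord0 i ^+ 2; move: P N X A B D r => P N X A B D r.
have := natr_subr1_neq0; move: (n%:R) => m m1.
by clear -m1; field.
Qed.

End gamma2.

(** * Density of the range of the operator *)

Section step_polynomials.
Context (R : realType).

Lemma bernoulli_ge (h : R) k : -1 <= h -> 1 + k%:R * h <= (1 + h) ^+ k.
Proof.
move=> h1; elim: k => [|k IH]; first by rewrite mul0r addr0 expr0.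
rewrite exprS; have h0 : 0 <= 1 + h by lra.
apply: le_trans (ler_wpM2l h0 IH).
have : 0 <= k%:R * h ^+ 2 by rewrite mulr_ge0// sqr_ge0.
by rewrite -natr1 expr2; lra.
Qed.

(** With q = r^2, the factor k r^k is bounded by Bernoulli's inequality for 1/r and the other r^k
    tends to 0. *)
Lemma cvg_mulrn_expr (q : R) : 0 <= q -> q < 1 -> (k%:R * q ^+ k : R) @[k --> \oo] --> (0 : R).
Proof.
rewrite le_eqVlt => /orP[/eqP <- _|q0 q1].
  by apply: cvg_near_cst; exists 1%N => // k /= k1; rewrite expr0n gtn_eqF// mulr0.
pose r := Num.sqrt q; have r0 : 0 < r by rewrite sqrtr_gt0.
have r1 : r < 1 by rewrite -[ltRHS]sqrtr1 ltr_sqrt.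
have rq : r ^+ 2 = q by rewrite sqr_sqrtr// ltW.
pose h := r^-1 - 1; have h0 : 0 < h by rewrite subr_gt0 invf_gt1.
have H k : `|k%:R * q ^+ k| <= r ^+ k * h^-1.
  rewrite ger0_norm ?mulr_ge0// ?exprn_ge0// ?(ltW q0)//.
  rewrite -rq -exprM mul2n -addnn exprD mulrCA ler_wpM2l ?exprn_ge0 ?(ltW r0)//.
  rewrite -ler_pdivlMr ?exprn_gt0// -exprVn ler_pdivlMl// mulrC.
  apply: le_trans (_ : 1 + k%:R * h <= _); first by rewrite lerDr.
  rewrite (_ : r^-1 = 1 + h); last by rewrite /h; ring.
  by apply: bernoulli_ge; lra.
apply/norm_cvg0P; apply: (@squeeze_cvgr _ _ _ _ (fun=> 0) (fun k => r ^+ k * h^-1)).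
- by apply: nearW => k; rewrite normr_ge0 H.
- exact: cvg_cst.
- rewrite -[X in _ --> X](mul0r h^-1); apply: cvgM; last exact: cvg_cst.
  by apply: cvg_expr; rewrite ger0_norm ?ltW.
Qed.

Let N a k := (Num.trunc (k%:R / a ^+ k : R)).+1.

(* With N_k of order k a^(-k), N_k t^k tends to 0 for t < a and to infinity for
   t >= a, so that (1 - t^k)^(N_k) tends to the indicator function of t < a. *)
Lemma cvg_step (a t : R) : 0 < a -> 0 <= t < 1 ->
  ((1 - t ^+ k) ^+ N a k : R) @[k --> \oo] --> ((t < a)%R%:R : R).
Proof.
move=> a0 /andP[t0 t1].
have tk k : 0 <= t ^+ k <= 1 by rewrite exprn_ge0//= exprn_ile1// ltW.
have ak k : 0 < a ^+ k by rewrite exprn_gt0.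
have [ta|at_] := ltP t a.
  have : (1 - (k%:R * (t / a) ^+ k + t ^+ k)) @[k --> \oo] --> (1 - (0 + 0) : R).
    apply: cvgB; first exact: cvg_cst.
    apply: cvgD.
      by apply: cvg_mulrn_expr; [rewrite divr_ge0// ltW|rewrite ltr_pdivrMr// mul1r].
    by apply: cvg_expr; rewrite ger0_norm.
  rewrite addr0 subr0 => H; apply: (squeeze_cvgr _ H (@cvg_cst _ _ _ _ _)).
  apply: nearW => k; apply/andP; split; last by apply: exprn_ile1; have := tk k; lra.
  apply: le_trans (_ : 1 + (N a k)%:R * - t ^+ k <= _); last first.
    by apply: bernoulli_ge; have := tk k; lra.
  rewrite mulrN lerD2l lerN2 /N -natr1 mulrDl mul1r lerD2r exprMn exprVn mulrCA.
  have /andP[tk0 _] := tk k.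
  by rewrite [leLHS]mulrC ler_wpM2l// truncn_le divr_ge0// ltW.
apply: (@squeeze_cvgr _ _ _ _ (fun=> 0) (fun k => k.+1%:R^-1)); last 2 first.
- exact: cvg_cst.
- exact: cvg_harmonic.
apply: nearW => k; have /andP[tk0 tk1] := tk k.
have t1k : 0 <= 1 - t ^+ k by lra.
rewrite exprn_ge0//=.
have akt : a ^+ k <= t ^+ k by rewrite lerXn2r// nnegrE ltW.
have ak1 : a ^+ k <= 1 by exact: le_trans tk1.
apply: le_trans (_ : (1 - a ^+ k) ^+ N a k <= _).
  by rewrite lerXn2r ?nnegrE ?lerD2l ?lerN2// subr_ge0.
rewrite -[leRHS]div1r ler_pdivlMr//.
apply: le_trans (_ : (1 - a ^+ k) ^+ N a k * (1 + a ^+ k) ^+ N a k <= _).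
  rewrite ler_wpM2l ?exprn_ge0 ?subr_ge0//.
  apply: le_trans (_ : 1 + (N a k)%:R * a ^+ k <= _).
    rewrite -natr1 addrC lerD2l -ler_pdivrMr//.
    by rewrite ltW// truncnS_gt.
  by apply: bernoulli_ge; have := ak k; lra.
rewrite -exprMn exprn_ile1//.
  by rewrite mulr_ge0 ?subr_ge0 ?addr_ge0// ltW.
rewrite mulrBl mulrDr !mulr1 !mul1r; have := ak k; nra.
Qed.

(** A bounded pointwise approximation of a step function on [-1, 1]. The map t -> (t + 2)/4 brings
    this interval inside [0, 1[ as [cvg_step] requires, and the threshold becomes positive once b >
    -1; for b <= -1 the step vanishes on the interval. *)
Lemma step_polynomials (b : R) : exists q : nat -> {poly R},
  forall t, -1 <= t <= 1 -> (forall k, `|(q k).[t]| <= 1) /\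
    ((q k).[t] @[k --> \oo] --> ((t < b)%R%:R : R)).
Proof.
have [b1|b1] := leP b (-1).
  exists (fun=> 0) => t /andP[t1 _]; rewrite ltNge (le_trans b1 t1) horner0 normr0.
  by split=> //; exact: cvg_cst.
exists (fun k => (1 - (4^-1 *: ('X + 2%:P)) ^+ k) ^+ N ((b + 2) / 4) k) => t t1.
have tE k : ((1 - (4^-1 *: ('X + 2%:P)) ^+ k) ^+ N ((b + 2) / 4) k).[t] =
    (1 - ((t + 2) / 4) ^+ k) ^+ N ((b + 2) / 4) k.
  by rewrite !hornerE mulrC.
have t01 : 0 <= (t + 2) / 4 <= 1 by apply/andP; split; lra.
split=> [k|].
  have /andP[t0 t2] := t01.
  have : 0 <= ((t + 2) / 4) ^+ k <= 1 by rewrite exprn_ge0//= exprn_ile1.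
  by rewrite tE => tk; rewrite normrX exprn_ile1// ger0_norm; lra.
under eq_cvg do rewrite tE.
rewrite (_ : (t < b) = ((t + 2) / 4 < (b + 2) / 4)); last by apply/idP/idP; lra.
by apply: cvg_step => //; lra.
Qed.

End step_polynomials.

(** * A monotone class theorem for closed subspaces of L^2 *)

Section closed_subspaces.
Context d (T : measurableType d) (R : realType).
Variable mu : {measure set T -> \bar R}.
Local Notation sqi := (sqi mu).
Local Notation nrm := (nrm mu).

(** The last clause is topological closedness; as it is phrased with norms of differences, it also
    contains invariance under equality almost everywhere. *)
Definition closed_subspace (W : (T -> R) -> Prop) :=
  [/\ forall f, W f -> sqi f,
      forall f g, W f -> W g -> W (fun x => f x + g x),
      forall c f, W f -> W (fun x => c * f x) &
      forall f, sqi f -> (forall e, 0 < e -> exists2 g, W g & nrm (fun x => g x - f x) < e) -> W f].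

Context (W : (T -> R) -> Prop) (clW : closed_subspace W).

Lemma closed_subspace_cvg (u : nat -> T -> R) f : (forall k, W (u k)) -> sqi f ->
  nrm (fun x => u k x - f x) @[k --> \oo] --> 0 -> W f.
Proof.
move=> Wu sf uf; have [_ _ _] := clW; apply => // e e0.
have [k _ uk] : \forall k \near \oo, nrm (fun x => u k x - f x) < e.
  exact: cvgr_lt uf _ e0.
by exists (u k) => //; apply: uk => /=.
Qed.

Lemma closed_subspace_dominated (u : nat -> T -> R) f g : (forall k, W (u k)) ->
  measurable_fun setT f -> sqi g -> (forall k x, `|u k x| <= g x) ->
  (forall x, u k x @[k --> \oo] --> (f x : R)) -> W f.
Proof.
move=> Wu mf sg ug uf.
have mu_ k : measurable_fun setT (u k) by have [/(_ _ (Wu k))[]] := clW.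
have [sf] := dominated_cvg_nrm mu_ mf sg ug uf.
exact: closed_subspace_cvg.
Qed.

Lemma closed_subspaceB f g : W f -> W g -> W (fun x => f x - g x).
Proof.
have [_ WD WZ _] := clW => Wf Wg; have := WD _ _ Wf (WZ (-1) _ Wg).
by under eq_fun do rewrite mulN1r.
Qed.

Lemma closed_subspace0 f : W f -> W (fun=> 0).
Proof.
have [_ _ WZ _] := clW => /(WZ 0).
by under eq_fun do rewrite mul0r.
Qed.

Lemma closed_subspace_sum (I : Type) (s : seq I) (F : I -> T -> R) f : W f ->
  (forall i, W (F i)) -> W (fun x => \sum_(i <- s) F i x).
Proof.
have [_ WD _ _] := clW => Wf WF; elim: s => [|i s IH].
  by under eq_fun do rewrite big_nil; exact: closed_subspace0 Wf.
by under eq_fun do rewrite big_cons; exact: WD.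
Qed.

Context (m : nat) (Y : T -> 'rV[R]_m) (h : T -> R).
Hypothesis mY : measurable_fun setT Y.
Hypothesis Y1 : forall i x, -1 <= Y x ord0 i <= 1.
Context (S : (T -> R) -> Prop).
Hypothesis Sh : S h.
Hypothesis SD : forall f g, S f -> S g -> S (fun x => f x + g x).
Hypothesis SZ : forall c f, S f -> S (fun x => c * f x).
Hypothesis SM : forall i f, S f -> S (fun x => Y x ord0 i * f x).
Hypothesis SW : forall f, S f -> W f.

Let Wsqi f : W f -> sqi f. Proof. by case: clW => + _ _ _; apply. Qed.
Let WD f g : W f -> W g -> W (fun x => f x + g x).
Proof. by case: clW => _ + _ _; apply. Qed.
Let WZ c f : W f -> W (fun x => c * f x).
Proof. by case: clW => _ _ + _; apply. Qed.
Let Wh := SW Sh.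
Let sh := Wsqi Wh.
Let mh : measurable_fun setT h := sh.1.

Lemma horner_class (q : {poly R}) i f : S f -> S (fun x => q.[Y x ord0 i] * f x).
Proof.
move=> Sf; elim/poly_ind: q => [|q c IH].
  by under eq_fun do rewrite horner0; exact: SZ.
under eq_fun do rewrite hornerMXaddC mulrDl mulrAC [X in X + _]mulrC.
by apply: SD; [exact: SM|exact: SZ].
Qed.

Lemma sqi_norm f : sqi f -> sqi (fun x => `|f x|).
Proof.
move=> sf; apply: le_sqi (sf) => [|x]; last by rewrite normr_id.
by apply: measurableT_comp => //; exact: sf.1.
Qed.

Lemma measurable_orthant (b : 'rV[R]_m) : measurable [set y : 'rV[R]_m | forall i, y ord0 i < b ord0 i].
Proof.
rewrite (_ : mkset _ = [set y : 'rV[R]_m | forall i, `]-oo, (b ord0 i)[%classic (y ord0 i)]).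
  by apply: (measurable_coords (A := fun i => `]-oo, (b ord0 i)[%classic)) => i.
by apply/seteqP; split => y /= yb i; have := yb i; rewrite in_itv.
Qed.

(** Products of step polynomials in the coordinates of [Y] keep [h] in the class [S]. They are
    bounded by 1 and converge pointwise to the indicator of the orthant, so [h] dominates. *)
Lemma orthant_closed_subspace (b : 'rV[R]_m) :
  W (fun x => h x * \1_[set y : 'rV[R]_m | forall i, y ord0 i < b ord0 i] (Y x)).
Proof.
have [q qP] := choice (fun i => step_polynomials (b ord0 i)).
have qY i x : (forall k, `|(q i k).[Y x ord0 i]| <= 1) /\
    ((q i k).[Y x ord0 i] @[k --> \oo] --> ((Y x ord0 i < b ord0 i)%R%:R : R)).
  exact: qP.
apply: (@closed_subspace_dominated
    (fun k x => (\prod_(i < m) (q i k).[Y x ord0 i]) * h x) _ (fun x => `|h x|)).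
- move=> k; apply: SW; elim: (index_enum _) => [|i s IH].
    by under eq_fun do rewrite big_nil mul1r.
  by under eq_fun do rewrite big_cons -mulrA; exact: horner_class.
- apply: measurable_funM => //; apply: (measurableT_comp _ mY).
  by apply: measurable_indic; exact: measurable_orthant.
- exact: sqi_norm.
- move=> k x; rewrite normrM ler_piMl// normr_prod.
  by apply: prodr_ile1 => i _; rewrite normr_ge0 (qY i x).1.
- move=> x; rewrite mulrC; apply: cvgM; last exact: cvg_cst.
  rewrite (_ : \1_ _ (Y x) = \prod_(i < m) ((Y x ord0 i < b ord0 i)%R%:R : R)).
    apply: cvg_big => [|i _]; last exact: (qY i x).2.
    exact: mul_continuous.
  rewrite indicE; case: (boolP (Y x \in _)) => [|/negP H].
    by rewrite inE/= => H; rewrite big1// => i _; rewrite H.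
  have /existsNP[i /negP/negbTE Hi] : ~ forall i, Y x ord0 i < b ord0 i by move: H; rewrite inE.
  by rewrite (bigD1 i)//= Hi mul0r.
Qed.

(** The sets whose indicator keeps [h] in [W] form a lambda-system: [W] is stable under differences,
    and increasing limits are dominated by |h|. *)
Lemma indic_closed_subspace (A : set 'rV[R]_m) : measurable A ->
  W (fun x => h x * \1_A (Y x)).
Proof.
move=> mA; suff [] : measurable A /\ W (fun x => h x * \1_A (Y x)) by [].
have mi B : measurable B -> measurable_fun setT (fun x => h x * \1_B (Y x)).
  move=> mB; apply: measurable_funM => //.
  by apply: (measurableT_comp _ mY); exact: measurable_indic.
apply: (@orthant_dynkin _ _ (fun A => measurable A /\ W (fun x => h x * \1_A (Y x)))) => //.
  split.
  - by move=> B _.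
  - split=> //; under eq_fun do rewrite indicT mulr1.
    exact: Wh.
  - move=> B C CB [mB WB] [mC WC]; split; first exact: measurableD.
    rewrite (_ : (fun x => _) = fun x => h x * \1_B (Y x) - h x * \1_C (Y x)).
      exact: closed_subspaceB.
    apply/funext => x; rewrite -mulrBr; congr (_ * _); rewrite !indicE.
    have [YC|/negP YC] := boolP (Y x \in C); have [YB|/negP YB] := boolP (Y x \in B).
    + by rewrite memNset ?subrr// => -[_]; rewrite inE in YC.
    + by move: YC YB; rewrite !inE => /CB.
    + by rewrite mem_set ?subr0//; split; [move: YB|move: YC]; rewrite inE.
    + by rewrite memNset ?subr0// => -[YB' _]; apply: YB; rewrite inE.
  - move=> F ndF WF; split; first by apply: bigcup_measurable => k _; exact: (WF k).1.
    apply: (@closed_subspace_dominated (fun k x => h x * \1_(F k) (Y x)) _ (fun x => `|h x|)).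
    + by move=> k; exact: (WF k).2.
    + by apply: mi; apply: bigcup_measurable => k _; exact: (WF k).1.
    + exact: sqi_norm.
    + move=> k x; rewrite normrM ler_piMr// indicE.
      by case: (_ \in _); rewrite ?normr1 ?normr0.
    + move=> x; apply: cvgM; first exact: cvg_cst.
      have [[k _ FkY]|nF] := pselect ((\bigcup_k F k) (Y x)).
        apply: cvg_near_cst; exists k => // j /= kj.
        rewrite !indicE !mem_set//; first by exists k.
        by move: FkY; exact/subsetPset/ndF.
      apply: cvg_near_cst; exists 0%N => // j _.
      by rewrite !indicE !memNset// => Fj; apply: nF; exists j.
move=> b; split; last exact: orthant_closed_subspace.
exact: measurable_orthant.
Qed.

Import HBNNSimple.

Lemma ge0_comp_closed_subspace (phi : 'rV[R]_m -> R) : measurable_fun setT phi ->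
  (forall y, 0 <= phi y) -> sqi (fun x => h x * phi (Y x)) -> W (fun x => h x * phi (Y x)).
Proof.
move=> mphi phi0 sphi.
have mphi' : measurable_fun setT (EFin \o phi) by exact/measurable_EFinP.
have phi0' y : [set: 'rV[R]_m] y -> (0 <= (EFin \o phi) y)%E by rewrite lee_fin.
pose s k := nnsfun_approx measurableT mphi' k.
have sE y : s k y @[k --> \oo] --> phi y.
  have := cvg_nnsfun_approx measurableT mphi' phi0' (I : setT y).
  by move/fine_cvgP => -[_].
have s_le k y : s k y <= phi y.
  have ch : cvgn (fun k => s k y) by apply/cvg_ex; exists (phi y).
  rewrite -(cvg_lim (@Rhausdorff R) (sE y)); apply: nondecreasing_cvgn_le => // i j ij.
  exact/lefP/nd_nnsfun_approx.
apply: (@closed_subspace_dominated (fun k x => h x * s k (Y x)) _ (fun x => `|h x * phi (Y x)|)).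
- move=> k; under eq_fun do rewrite fimfunEord mulr_sumr.
  apply: closed_subspace_sum Wh _ => i.
  under eq_fun do rewrite mulrCA.
  by apply: WZ; exact: indic_closed_subspace.
- exact: sphi.1.
- exact: sqi_norm.
- move=> k x; rewrite !normrM ler_wpM2l// !ger0_norm//.
- by move=> x; apply: cvgM; [exact: cvg_cst|exact: sE].
Qed.

(** The outcome of the section: if [W] contains h times all polynomials in the bounded functions
    Y_i, it contains every square-integrable h phi(Y). Positive and negative parts of phi reduce
    this to the nonnegative case. *)
Lemma comp_closed_subspace (phi : 'rV[R]_m -> R) : measurable_fun setT phi ->
  sqi (fun x => h x * phi (Y x)) -> W (fun x => h x * phi (Y x)).
Proof.
move=> mphi sphi.
have mp (c : R) : measurable_fun setT (fun y => Num.max (c * phi y) 0).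
  by apply: measurable_maxr => //; exact: measurable_funM.
have H (c : R) : `|c| = 1 -> W (fun x => h x * Num.max (c * phi (Y x)) 0).
  move=> c1; apply: (@ge0_comp_closed_subspace (fun y => Num.max (c * phi y) 0)) => //.
    by move=> y; rewrite le_max lexx orbT.
  apply: le_sqi sphi => [|x].
    by apply: measurable_funM => //; exact: (measurableT_comp (mp c) mY).
  rewrite !normrM ler_wpM2l//; have [_|_] := leP (c * phi (Y x)) 0; rewrite ?normr0//.
  by rewrite normrM c1 mul1r.
have := closed_subspaceB (H 1 (normr1 _)) (H (-1) _).
rewrite normrN1 => /(_ erefl); congr W; apply/funext => x.
rewrite -mulrBr mul1r mulN1r; congr (_ * _).
by have [] := leP (phi (Y x)) 0; have [] := leP (- phi (Y x)) 0; lra.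
Qed.

End closed_subspaces.

Opaque partial omega smooth Cc_infty.

(* Conversion tests between derivatives are what makes [ring] slow: abstract them. *)
Ltac abstract_atoms := repeat match goal with
  | |- context [@partial ?R ?n ?i ?u ?x] => generalize (@partial R n i u x); intro
  | |- context [@laplacian ?R ?n ?u ?x] => generalize (@laplacian R n u x); intro
  | |- context [@dot ?R ?n ?x ?y] => generalize (@dot R n x y); intro
  | |- context [@gdot ?R ?n ?u ?v ?x] => generalize (@gdot R n u v x); intro
  | |- context [@derive ?R ?V ?W ?f ?x ?v] => generalize (@derive R V W f x v); intro
  | |- context [@powR ?R ?a ?b] => generalize (@powR R a b); intro
  | |- context [@omega ?R ?n ?x] => generalize (@omega R n x); intro
  end.

(** * L on products, homogeneous polynomials and radial functions *)

Section cauchy_L_calculus.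
Context (R : realType) (n : nat) (beta : R).
Local Notation rV := 'rV[R]_n.
Local Notation L := (cauchy_L beta).
Implicit Types u v p : rV -> R.

Let natr_sum1 : n%:R = \sum_(i < n) (1 : R).
Proof. by rewrite sumr_const card_ord. Qed.

Lemma dot_gradE u (x : rV) : dot x (grad u x) = \sum_(i < n) x ord0 i * partial i u x.
Proof. by apply: eq_bigr => i _; rewrite mxE. Qed.

Lemma laplacianD u v x : smooth u -> smooth v ->
  laplacian (fun x => u x + v x) x = laplacian u x + laplacian v x.
Proof.
move=> su sv; rewrite !laplacianE -big_split/=; apply: eq_bigr => i _.
have -> : partial i (fun x => u x + v x) = (fun x => partial i u x + partial i v x).
  by apply/funext => y; exact: partialD.
exact: partialD (smooth_partial i su) (smooth_partial i sv).
Qed.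

Lemma laplacianZ c u x : smooth u -> laplacian (fun x => c * u x) x = c * laplacian u x.
Proof.
move=> su; rewrite !laplacianE mulr_sumr; apply: eq_bigr => i _.
have -> : partial i (fun x => c * u x) = (fun x => c * partial i u x).
  by apply/funext => y; exact: partialZ.
exact: partialZ (smooth_partial i su).
Qed.

Lemma laplacianM u v x : smooth u -> smooth v ->
  laplacian (fun x => u x * v x) x =
  u x * laplacian v x + v x * laplacian u x + 2 * gdot u v x.
Proof.
move=> su sv; rewrite !laplacianE /gdot !mulr_sumr -!big_split/=; apply: eq_bigr => i _.
have -> : partial i (fun x => u x * v x) = (fun x => u x * partial i v x + v x * partial i u x).
  by apply/funext => y; exact: partialM.
have spu := smooth_partial i su; have spv := smooth_partial i sv.
rewrite (@partialD _ _ _ (fun x => u x * partial i v x) _ _ (smoothM su spv) (smoothM sv spu)).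
by rewrite (@partialM _ _ _ u _ _ su spv) (@partialM _ _ _ v _ _ sv spu); abstract_atoms; ring.
Qed.

Lemma dot_gradD u v x : smooth u -> smooth v ->
  dot x (grad (fun x => u x + v x) x) = dot x (grad u x) + dot x (grad v x).
Proof.
move=> su sv; rewrite !dot_gradE -big_split/=; apply: eq_bigr => i _.
by rewrite (@partialD _ _ _ u)// mulrDr.
Qed.

Lemma dot_gradZ c u x : smooth u ->
  dot x (grad (fun x => c * u x) x) = c * dot x (grad u x).
Proof.
move=> su; rewrite !dot_gradE mulr_sumr; apply: eq_bigr => i _.
by rewrite (@partialZ _ _ _ _ u)// mulrCA.
Qed.

Lemma dot_gradM u v x : smooth u -> smooth v ->
  dot x (grad (fun x => u x * v x) x) = u x * dot x (grad v x) + v x * dot x (grad u x).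
Proof.
move=> su sv; rewrite !dot_gradE !mulr_sumr -big_split/=; apply: eq_bigr => i _.
by rewrite (@partialM _ _ _ u)//; ring.
Qed.

Lemma cauchy_LD u v x : smooth u -> smooth v ->
  L (fun x => u x + v x) x = L u x + L v x.
Proof. by move=> su sv; rewrite /cauchy_L (laplacianD _ su sv) (dot_gradD _ su sv); abstract_atoms; ring. Qed.

Lemma cauchy_LZ c u x : smooth u -> L (fun x => c * u x) x = c * L u x.
Proof. by move=> su; rewrite /cauchy_L (laplacianZ _ _ su) (dot_gradZ _ _ su); abstract_atoms; ring. Qed.

Lemma cauchy_LM u v x : smooth u -> smooth v ->
  L (fun x => u x * v x) x = u x * L v x + v x * L u x + 2 * omega x * gdot u v x.
Proof. by move=> su sv; rewrite /cauchy_L (laplacianM _ su sv) (dot_gradM _ su sv); abstract_atoms; ring. Qed.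

Inductive hpoly : nat -> (rV -> R) -> Prop :=
| hpoly0 l : hpoly l (fun=> 0)
| hpoly_cst c : hpoly 0 (fun=> c)
| hpolyM l i p : hpoly l p -> hpoly l.+1 (fun x => coord i x * p x)
| hpolyD l p q : hpoly l p -> hpoly l q -> hpoly l (fun x => p x + q x).

Lemma hpoly_smooth l p : hpoly l p -> smooth p.
Proof.
elim=> {l p} [l|c|l i p _ sp|l p q _ sp _ sq].
- exact: smooth_cst.
- exact: smooth_cst.
- exact: smoothM (@smooth_coord _ _ i) sp.
- exact: smoothD.
Qed.

Lemma hpolyZ l p c : hpoly l p -> hpoly l (fun x => c * p x).
Proof.
elim=> {l p} [l|c'|l i p _ IH|l p q _ IHp _ IHq].
- by under eq_fun do rewrite mulr0; exact: hpoly0.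
- exact: hpoly_cst.
- by under eq_fun do rewrite mulrCA; exact: hpolyM.
- by under eq_fun do rewrite mulrDr; exact: hpolyD.
Qed.

Lemma hpoly_sum (I : Type) (s : seq I) l (p : I -> rV -> R) :
  (forall i, hpoly l (p i)) -> hpoly l (fun x => \sum_(i <- s) p i x).
Proof.
move=> hp; elim: s => [|i s IH].
  by under eq_fun do rewrite big_nil; exact: hpoly0.
by under eq_fun do rewrite big_cons; exact: hpolyD.
Qed.

Lemma hpoly_cstE p : hpoly 0 p -> exists c, p = fun=> c.
Proof.
move: {1 3}0%N (erefl 0%N) => l + hp; elim: hp => {l p} [l|c|//|l p q _ IHp _ IHq l0].
- by exists 0.
- by exists c.
- by have [a ->] := IHp l0; have [b ->] := IHq l0; exists (a + b).
Qed.

Lemma hpoly_partial i l p : hpoly l p ->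
  if l is k.+1 then hpoly k (partial i p) else partial i p = fun=> 0.
Proof.
have p0 c : partial i (fun _ : rV => c) = fun=> 0.
  by apply/funext => x; exact: partial_cst.
elim=> {l p} [[|k]|c|l j p hp IH|l p q hp IHp hq IHq]; rewrite ?p0//.
- exact: hpoly0.
- have -> : partial i (fun x => coord j x * p x) =
      fun x => coord j x * partial i p x + (i == j)%:R * p x.
    apply/funext => x; rewrite (partialM _ _ (@smooth_coord _ _ j) (hpoly_smooth hp)).
    by rewrite partial_coord [p x * _]mulrC.
  apply: hpolyD; last exact: hpolyZ.
  case: l hp IH => [|l] hp IH; last exact: hpolyM.
  by rewrite IH; under eq_fun do rewrite mulr0; exact: hpoly0.
- have -> : partial i (fun x => p x + q x) = fun x => partial i p x + partial i q x.
    by apply/funext => x; exact: partialD (hpoly_smooth hp) (hpoly_smooth hq).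
  case: l hp hq IHp IHq => [|l] hp hq IHp IHq; last exact: hpolyD.
  by rewrite IHp IHq; apply/funext => x; rewrite addr0.
Qed.

Lemma hpoly_laplacian l p : hpoly l p ->
  if l is k.+2 then hpoly k (laplacian p) else laplacian p = fun=> 0.
Proof.
move=> hp; case: l hp => [|[|k]] hp.
- apply/funext => x; rewrite laplacianE big1// => i _.
  by rewrite (hpoly_partial i hp) partial_cst.
- apply/funext => x; rewrite laplacianE big1// => i _.
  by rewrite (hpoly_partial i (hpoly_partial i hp)).
- rewrite (_ : laplacian p = fun x => \sum_(i < n) partial i (partial i p) x); last first.
    by apply/funext => x; exact: laplacianE.
  by apply: hpoly_sum => i; exact: (hpoly_partial i (hpoly_partial i hp)).
Qed.

Lemma hpoly_euler l p (x : rV) : hpoly l p ->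
  dot x (grad p x) = l%:R * p x.
Proof.
elim=> {l p} [l|c|l j p hp IH|l p q hp IHp hq IHq].
- by rewrite mulr0 dot_gradE big1// => i _; rewrite partial_cst mulr0.
- by rewrite mul0r dot_gradE big1// => i _; rewrite partial_cst mulr0.
- rewrite (dot_gradM _ (@smooth_coord _ _ j) (hpoly_smooth hp)) IH.
  rewrite dot_gradE (bigD1 j)//= partial_coord eqxx big1 => [|i ij]; last first.
    by rewrite partial_coord (negbTE ij) mulr0.
  by rewrite -natr1 /coord /=; ring.
- by rewrite (dot_gradD _ (hpoly_smooth hp) (hpoly_smooth hq)) IHp IHq mulrDr.
Qed.

Lemma coord_le_omega i (x : rV) : `|coord i x| <= omega x `^ 2^-1.
Proof.
rewrite -ler_sqr ?nnegrE ?powR_ge0// real_normK ?num_real//.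
have -> : omega x `^ 2^-1 ^+ 2 = omega x.
  by rewrite -powR_mulrn ?powR_ge0// -powRrM mulVf// powRr1// ltW// omega_gt0.
rewrite omegaE (bigD1 i)//= addrCA lerDl addr_ge0// sumr_ge0// => j _.
exact: sqr_ge0.
Qed.

Lemma hpoly_bound l p : hpoly l p ->
  exists2 C, 0 <= C & forall x, `|p x| <= C * omega x `^ (l%:R / 2).
Proof.
elim=> {l p} [l|c|l i p _ [C C0 hC]|l p q _ [C C0 hC] _ [D D0 hD]].
- by exists 0 => // x; rewrite normr0 mul0r.
- by exists `|c| => // x; rewrite mul0r powRr0 mulr1.
- exists C => // x; rewrite normrM -natr1 mulrDl mul1r addrC powRD; last first.
    by rewrite (gt_eqF (omega_gt0 x)) implybT.
  by rewrite mulrCA; apply: ler_pM => //; exact: coord_le_omega.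
- exists (C + D) => [|x]; first exact: addr_ge0.
  by rewrite mulrDl; apply: le_trans (ler_normD _ _) (lerD _ _).
Qed.

Let powB1 s (x : rV) : omega x `^ (- s - 1) = omega x `^ (- s) * (omega x)^-1.
Proof.
rewrite powRD; last by rewrite (gt_eqF (omega_gt0 x)) implybT.
by rewrite powR_inv1// ltW// omega_gt0.
Qed.

Let sqr_sum (x : rV) : \sum_(i < n) x ord0 i ^+ 2 = omega x - 1.
Proof. by rewrite omegaE addrAC subrr add0r. Qed.

Let partial_pow i s : partial i (fun x : rV => omega x `^ (- s)) =
  fun x => (- 2 * s) * (coord i x * omega x `^ (- s - 1)).
Proof. by apply/funext => y; rewrite partial_omega_pow /coord; ring. Qed.

Lemma laplacian_omega_pow s (x : rV) : laplacian (fun x => omega x `^ (- s)) x =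
  omega x `^ (- s) * (omega x)^-1 * (- 2 * s * n%:R) +
  4 * s * (s + 1) * omega x `^ (- s) * (omega x)^-1 ^+ 2 * (omega x - 1).
Proof.
rewrite -sqr_sum laplacianE natr_sum1 !mulr_sumr -big_split/=; apply: eq_bigr => i _.
rewrite partial_pow partialZ; last first.
  exact: smoothM (@smooth_coord _ _ i) (@smooth_omega_pow _ _ _).
rewrite (partialM _ _ (@smooth_coord _ _ i) (@smooth_omega_pow _ _ _)).
rewrite partial_coord eqxx partial_omega_pow.
rewrite [in X in 2 * (- s - 1) * _ * X](_ : - s - 1 - 1 = - (s + 1) - 1); last by ring.
rewrite powB1 [- (s + 1)]opprD powB1 /coord /=.
by ring.
Qed.

Lemma dot_grad_omega_pow s (x : rV) : dot x (grad (fun x => omega x `^ (- s)) x) =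
  - 2 * s * omega x `^ (- s) * (omega x)^-1 * (omega x - 1).
Proof.
rewrite -sqr_sum dot_gradE mulr_sumr; apply: eq_bigr => i _.
by rewrite partial_pow powB1 /coord; ring.
Qed.

Lemma gdot_omega_pow u s (x : rV) : gdot u (fun x => omega x `^ (- s)) x =
  - 2 * s * omega x `^ (- s) * (omega x)^-1 * dot x (grad u x).
Proof.
rewrite dot_gradE mulr_sumr; apply: eq_bigr => i _.
by rewrite partial_pow powB1 /coord; ring.
Qed.

(** Leibniz, Euler's identity for p and |x|^2 = omega - 1 leave the same p times two consecutive
    powers of omega, plus a term in the Laplacian of p, of degree l - 2. The density of the range
    rests on this two-term recursion. *)
Lemma cauchy_L_hpoly_pow l p s x : hpoly l p ->
  L (fun x => p x * omega x `^ (- s)) x =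
  (4 * s * (s + (beta - n%:R / 2) - l%:R) - 2 * (beta - 1) * l%:R) * (p x * omega x `^ (- s))
  - 4 * s * (s + beta) * (p x * omega x `^ (- s - 1))
  + laplacian p x * omega x `^ (1 - s).
Proof.
move=> hp; have w0 : omega x != 0 by rewrite gt_eqF// omega_gt0.
have sp := hpoly_smooth hp; have so := @smooth_omega_pow R n (- s).
rewrite (cauchy_LM _ sp so) /cauchy_L laplacian_omega_pow dot_grad_omega_pow gdot_omega_pow.
rewrite (hpoly_euler x hp) powB1.
have -> : omega x `^ (1 - s) = omega x `^ (- s) * omega x.
  rewrite addrC powRD; last by rewrite w0 implybT.
  by rewrite powRr1// ltW// omega_gt0.
by move: (omega x `^ (- s)) (laplacian p x) (omega x) w0 => P D w w0; field.
Qed.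

Section radial.
Context (h : R -> R) (c : R) (sh : smooth1 h).
Let hw (x : rV) := h (c * omega x).

Let sco : smooth (fun x : rV => c * omega x).
Proof. exact: smoothZ (@smooth_omega _ _). Qed.

Let partial_comp_omega (g : R -> R) i : smooth1 g ->
  partial i (fun x : rV => g (c * omega x)) = fun x => 2 * c * ('D_1 g (c * omega x) * coord i x).
Proof.
move=> sg; apply/funext => y; rewrite (partial_comp (h := g) i y sg sco).
by rewrite (partialZ _ _ _ (@smooth_omega _ _)) partial_omega /coord; ring.
Qed.

Let sh1 : smooth (fun x : rV => 'D_1 h (c * omega x)).
Proof. by apply: (@smooth_comp _ _ ('D_1 h)) => //; exact: smooth1_derive. Qed.

(** Applied to cut-offs with c = 1/(k+1). With t = c omega, the terms are t^2 h''(t) and t h'(t) up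
    to bounded factors, so they are controlled uniformly in c. *)
Lemma cauchy_L_comp_omega (x : rV) : L (fun x => h (c * omega x)) x =
    4 * c ^+ 2 * omega x * (omega x - 1) * 'D_1 ('D_1 h) (c * omega x) +
    2 * n%:R * c * omega x * 'D_1 h (c * omega x) -
    4 * (beta - 1) * c * (omega x - 1) * 'D_1 h (c * omega x).
Proof.
have e1 : laplacian (fun x => h (c * omega x)) x =
    2 * c * 'D_1 h (c * omega x) * n%:R +
    4 * c ^+ 2 * 'D_1 ('D_1 h) (c * omega x) * (omega x - 1).
  rewrite -sqr_sum laplacianE natr_sum1 !mulr_sumr -big_split/=; apply: eq_bigr => i _.
  rewrite (partial_comp_omega i sh) (partialZ _ _ _ (smoothM sh1 (@smooth_coord _ _ i))).
  rewrite (partialM _ _ sh1 (@smooth_coord _ _ i)) partial_coord eqxx.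
  by rewrite (partial_comp_omega i (smooth1_derive sh)) /coord; abstract_atoms; rewrite /=; ring.
have e2 : dot x (grad (fun x => h (c * omega x)) x) =
    2 * c * 'D_1 h (c * omega x) * (omega x - 1).
  rewrite -sqr_sum dot_gradE mulr_sumr; apply: eq_bigr => i _.
  by rewrite (partial_comp_omega i sh) /coord; abstract_atoms; ring.
by rewrite /cauchy_L e1 e2; abstract_atoms; ring.
Qed.

Lemma gdot_comp_omega u (x : rV) : gdot (fun x => h (c * omega x)) u x =
  2 * c * 'D_1 h (c * omega x) * dot x (grad u x).
Proof.
rewrite dot_gradE mulr_sumr; apply: eq_bigr => i _.
by rewrite (partial_comp_omega i sh) /coord; abstract_atoms; ring.
Qed.

End radial.

Lemma dot_grad_hpoly_pow l p s (x : rV) : hpoly l p ->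
  dot x (grad (fun x => p x * omega x `^ (- s)) x) =
  (l%:R - 2 * s * ((omega x - 1) / omega x)) * (p x * omega x `^ (- s)).
Proof.
move=> hp; rewrite (dot_gradM _ (hpoly_smooth hp) (@smooth_omega_pow _ _ _)).
by rewrite dot_grad_omega_pow (hpoly_euler x hp); abstract_atoms; ring.
Qed.

End cauchy_L_calculus.

(** * A cut-off function *)

Section cutoff.
Context (R : realType).

(** Equal to 1 at t = 0 and to 0 for t >= 1. As omega/(k+1) tends to 0, the rescaled cut-offs
    converge pointwise to the value at 0; together with uniform bounds this is enough for dominated
    convergence. *)
Definition cutoff (t : R) : R := expR 1 * theta 1 (1 - t).

Lemma is_derive_cutoff q (t : R) :
  is_derive t 1 (fun t => expR 1 * theta q (1 - t)) (expR 1 * theta (- ((q - q^`()) * 'X^2)) (1 - t)).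
Proof.
have d0 : is_derive t 1 (fun t : R => 1 - t) (- 1).
  have := is_deriveB (is_derive_cst (1 : R) t 1) (is_derive_id t (1 : R)).
  by rewrite sub0r.
have d1 := @is_derive1_comp R (theta q) (fun t => 1 - t) t _ _ (is_derive_theta _ _) d0.
have [a b] := is_deriveZ (expR 1) d1.
apply: DeriveDef; first exact: a.
apply: (etrans b); rewrite /GRing.scale/= mulrN1 /theta; case: ifP => _; rewrite ?oppr0 ?mulr0//.
by rewrite hornerN mulNr.
Qed.

Lemma derive_cutoff q : 'D_1 (fun t : R => expR 1 * theta q (1 - t)) =
  fun t => expR 1 * theta (- ((q - q^`()) * 'X^2)) (1 - t).
Proof.
by apply/funext => t; exact: (@derive_val _ _ _ _ _ _ _ (is_derive_cutoff q t)).
Qed.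

Lemma smooth1_cutoff : smooth1 cutoff.
Proof.
apply: (smooth1_coind (S := fun g => exists q, g = fun t => expR 1 * theta q (1 - t))).
  move=> _ [q ->]; split=> [t|]; first by case: (is_derive_cutoff q t).
  by rewrite derive_cutoff; eexists.
by exists 1.
Qed.

Lemma cutoff0 : cutoff 0 = 1.
Proof. by rewrite /cutoff /theta subr0 ltr01 hornerC invr1 mul1r -expRD subrr expR0. Qed.

Let bound (q : {poly R}) : exists2 C : R, 0 <= C & forall t : R, 0 <= t -> `|expR 1 * theta q (1 - t)| <= C /\
  `|t * (expR 1 * theta q (1 - t))| <= C /\ `|t ^+ 2 * (expR 1 * theta q (1 - t))| <= C.
Proof.
have [C C0 hC] := theta_bound q.
exists (expR 1 * C) => [|t t0]; first by rewrite mulr_ge0 ?expR_ge0.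
have [t1|t1] := leP 1 t.
  rewrite /theta ltNge (_ : 1 - t <= 0) ?subr_le0//=.
  by rewrite !(mulr0, normr0) mulr_ge0 ?expR_ge0.
have H : `|expR 1 * theta q (1 - t)| <= expR 1 * C.
  rewrite normrM (ger0_norm (expR_ge0 _)) ler_wpM2l ?expR_ge0//.
  apply: le_trans (hC _) _; rewrite ler_piMr// exprn_ile1//; lra.
split=> //; split; rewrite normrM (le_trans _ H)// ler_piMl// ger0_norm ?exprn_ge0// ?(ltW t1)//.
by rewrite exprn_ile1// ltW.
Qed.

(** The weights t and t^2 make the bounds invariant under scaling, hence uniform in k for the
    cut-offs at scale k. *)
Lemma cutoff_bound : exists2 C : R, 0 <= C & forall t : R, 0 <= t ->
  [/\ `|cutoff t| <= C, `|t * 'D_1 cutoff t| <= C & `|t ^+ 2 * 'D_1 ('D_1 cutoff) t| <= C].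
Proof.
pose g1 t : R := expR 1 * theta (- ((1 - 1^`()) * 'X^2)) (1 - t).
pose g2 t : R := expR 1 * theta (- ((- ((1 - 1^`()) * 'X^2) - (- ((1 - 1^`()) * 'X^2))^`()) * 'X^2)) (1 - t).
have e1 : 'D_1 cutoff = g1 by exact: derive_cutoff.
have e2 : 'D_1 ('D_1 cutoff) = g2 by rewrite e1; exact: derive_cutoff.
have [C0 C00 h0] := bound 1; have [C1 C10 h1] := bound (- ((1 - 1^`()) * 'X^2)).
have [C2 C20 h2] := bound (- ((- ((1 - 1^`()) * 'X^2) - (- ((1 - 1^`()) * 'X^2))^`()) * 'X^2)).
exists (C0 + C1 + C2) => [|t t0]; first by rewrite !addr_ge0.
have [a _] := h0 t t0; have [_ [b _]] := h1 t t0; have [_ [_ c]] := h2 t t0.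
rewrite [derive cutoff t 1](congr1 (@^~ t) e1) [derive ('D_1 cutoff) t 1](congr1 (@^~ t) e2).
by split; [apply: le_trans a _|apply: le_trans b _|apply: le_trans c _]; lra.
Qed.

Lemma cutoff_ge1 t : 1 <= t -> cutoff t = 0.
Proof. by move=> t1; rewrite /cutoff /theta ltNge subr_le0 t1 mulr0. Qed.

End cutoff.

(** * Density of the range of L up to constants *)

Section dense_range.
Context (R : realType) (n : nat) (beta : R).
Hypothesis n2 : (2 <= n)%N.
Hypothesis beta_gt : n%:R / 2 < beta.
Local Notation rV := 'rV[R]_n.
Local Notation mu := (@cauchy_measure R n beta).
Local Notation L := (cauchy_L beta).
Local Notation sqi := (sqi mu).
Local Notation nrm := (nrm mu).
Local Notation ip := (ip mu).
Implicit Types u v p : rV -> R.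

Let n0 : (0 < n)%N. Proof. exact: ltn_trans n2. Qed.

Lemma beta_gt1 : 1 < beta.
Proof.
apply: le_lt_trans beta_gt; rewrite ler_pdivlMr// mul1r.
by rewrite ler_nat.
Qed.

Lemma measurable_omega_pow a : measurable_fun setT (fun x : rV => omega x `^ a).
Proof. exact: (measurableT_comp (measurable_powR _) (@measurable_omega R n)). Qed.

Lemma sqi_omega_bound (C a : R) u : measurable_fun setT u ->
  4 * a < 2 * beta - n%:R -> (forall x, `|u x| <= C * omega x `^ a) -> sqi u.
Proof.
move=> mu_ aa uC.
have C0 : 0 <= C.
  have := le_trans (normr_ge0 _) (uC 0).
  by rewrite pmulr_lge0// powR_gt0// omega_gt0.
apply: (@le_sqi _ _ _ _ _ (fun x => C * omega x `^ a)) => //.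
  by move=> x; rewrite [leRHS]ger0_norm ?uC// mulr_ge0// powR_ge0.
apply: sqiZ; split; first exact: measurable_omega_pow.
have := @cauchy_integrable_omega R n beta n0 beta_gt (2 * a).
rewrite (_ : 2 * (2 * a) = 4 * a); last by ring.
move=> /(_ aa); congr (integrable _ _ _); apply/funext => x; congr EFin.
by rewrite -powR_mulrn ?powR_ge0// -powRrM mulrC.
Qed.

Lemma sqi_bounded (C : R) u : measurable_fun setT u -> (forall x, `|u x| <= C) -> sqi u.
Proof.
move=> mu_ uC; apply: (@sqi_omega_bound C 0) => //; first by rewrite mulr0; move: beta_gt; lra.
by move=> x; rewrite powRr0 mulr1.
Qed.

Lemma sqi_cst (c : R) : sqi (fun=> c).
Proof. by apply: (@sqi_bounded `|c|). Qed.

Lemma sqi_Cc u : Cc_infty u -> sqi u.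
Proof.
move=> cu; have su := Cc_smooth cu.
have [C C0 hC] := continuous_bounded_bsupp (smooth_continuous su) (Cc_bsupp cu).
exact: sqi_bounded (smooth_measurable su) hC.
Qed.

Lemma sqi_cauchy_L u : Cc_infty u -> sqi (L u).
Proof. by move=> cu; apply: sqi_Cc; exact: Cc_cauchy_L. Qed.

(** Constants are added to the range because every L phi has mean zero. *)
Definition cauchy_range u := sqi u /\ forall e, 0 < e ->
  exists phi c, Cc_infty phi /\ nrm (fun x => L phi x + c - u x) < e.

Lemma cauchy_range_closed : closed_subspace mu cauchy_range.
Proof.
have sLc phi c : Cc_infty phi -> sqi (fun x => L phi x + c).
  by move=> cphi; apply: sqiD (sqi_cauchy_L cphi) (sqi_cst c).
split=> [f []//|f g [sf Wf] [sg Wg]|c f [sf Wf]|f sf Wf].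
- split=> [|e e0]; first exact: sqiD.
  have e20 : 0 < e / 2 by rewrite divr_gt0.
  have [p1 [c1 [cp1 h1]]] := Wf _ e20; have [p2 [c2 [cp2 h2]]] := Wg _ e20.
  exists (fun x => p1 x + p2 x), (c1 + c2); split; first exact: CcD.
  have -> : (fun x => L (fun x => p1 x + p2 x) x + (c1 + c2) - (f x + g x)) =
      fun x => (L p1 x + c1 - f x) + (L p2 x + c2 - g x).
    by apply/funext => x; rewrite (cauchy_LD _ _ (Cc_smooth cp1) (Cc_smooth cp2)); ring.
  apply: le_lt_trans (nrmD (sqiB (sLc _ _ cp1) sf) (sqiB (sLc _ _ cp2) sg)) _.
  by rewrite (splitr e) ltrD.
- split=> [|e e0]; first exact: sqiZ.
  have e1 : 0 < e / (`|c| + 1) by rewrite divr_gt0// ltr_wpDl.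
  have [p1 [c1 [cp1 h1]]] := Wf _ e1.
  exists (fun x => c * p1 x), (c * c1); split; first exact: CcZ.
  have -> : (fun x => L (fun x => c * p1 x) x + c * c1 - c * f x) = fun x => c * (L p1 x + c1 - f x).
    by apply/funext => x; rewrite (cauchy_LZ _ _ _ (Cc_smooth cp1)); ring.
  rewrite nrmZ; last exact: sqiB (sLc _ _ cp1) sf.
  move: h1; rewrite ltr_pdivlMr ?ltr_wpDl//.
  by have := nrm_ge0 mu (fun x => L p1 x + c1 - f x); nra.
- split=> // e e0; have e20 : 0 < e / 2 by rewrite divr_gt0.
  have [g [sg Wg] gf] := Wf _ e20; have [p1 [c1 [cp1 h1]]] := Wg _ e20.
  exists p1, c1; split=> //.
  apply: le_lt_trans (nrm_triangle (sLc p1 c1 cp1) sg sf) _.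
  by rewrite (splitr e) ltrD.
Qed.

Lemma cauchy_range_L u : Cc_infty u -> cauchy_range (L u).
Proof.
move=> cu; split; first exact: sqi_cauchy_L.
move=> e e0; exists u, 0; split=> //.
rewrite (_ : (fun x => _) = fun=> 0); last by apply/funext => x; ring.
by rewrite /nrm ip0l sqrtr0.
Qed.

Lemma cauchy_L_cst c (x : rV) : L (fun=> c) x = 0.
Proof.
have e i d : partial i (fun _ : rV => d) = fun=> 0.
  by apply/funext => y; exact: partial_cst.
rewrite /cauchy_L dot_gradE laplacianE big1 => [|i _]; last by rewrite !e.
by rewrite big1 ?mulr0 ?subr0// => i _; rewrite e mulr0.
Qed.

Lemma cauchy_range_cst c : cauchy_range (fun=> c).
Proof.
split; first exact: sqi_cst.
move=> e e0; exists (fun=> 0), c; split; first exact: Cc0.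
have -> : (fun x : rV => L (fun=> 0) x + c - c) = fun=> 0.
  by apply/funext => x; rewrite cauchy_L_cst; ring.
by rewrite /nrm ip0l sqrtr0.
Qed.

Lemma bsupp_cutoff (k : nat) : bsupp (fun x : rV => cutoff (k.+1%:R^-1 * omega x)).
Proof.
exists k.+1%:R => x; rewrite /box/= => cx i.
have : omega x < k.+1%:R.
  rewrite ltNge; apply: contra cx => kx; apply/eqP/cutoff_ge1.
  by rewrite ler_pdivlMl// mulr1.
have : x ord0 i ^+ 2 <= omega x - 1.
  rewrite omegaE addrAC subrr add0r (bigD1 i)//= lerDl sumr_ge0// => j _; exact: sqr_ge0.
rewrite ler_norml => a b; have k1 : 1 <= k.+1%:R :> R by rewrite ler1n.
by apply/andP; split; nra.
Qed.

(** The condition on s is what makes p omega^(-s) square integrable, as |p| <= C omega^(l/2).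
    Cutting off at scale k and applying [L] gives functions dominated by a multiple of |L f| + |f|
    that converge to L f. *)
Lemma cauchy_range_L_hpoly l p s : hpoly l p -> l%:R - (beta - n%:R / 2) < 2 * s ->
  cauchy_range (L (fun x => p x * omega x `^ (- s))).
Proof.
move=> hp ls; have sp := hpoly_smooth hp.
pose f (x : rV) := p x * omega x `^ (- s).
have sf : smooth f := smoothM sp (@smooth_omega_pow _ _ _).
have [C C0 hC] := hpoly_bound hp.
have [K K0 hK] := @cutoff_bound R.
have fC x : `|f x| <= C * omega x `^ (l%:R / 2 - s).
  rewrite /f normrM (ger0_norm (powR_ge0 _ _)) powRD; last first.
    by rewrite (gt_eqF (omega_gt0 x)) implybT.
  by rewrite mulrA ler_wpM2r ?powR_ge0.
have sqf : sqi f.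
  apply: sqi_omega_bound (smooth_measurable sf) _ fC.
  by move: ls; lra.
pose a := 4 * s * (s + (beta - n%:R / 2) - l%:R) - 2 * (beta - 1) * l%:R.
pose b := 4 * s * (s + beta).
have LfE x : L f x = a * f x - b * (f x / omega x) + laplacian p x * omega x `^ (1 - s).
  rewrite (cauchy_L_hpoly_pow _ _ _ hp) -/a -/b /f; congr (_ - _ * _ + _).
  rewrite powRD; last by rewrite (gt_eqF (omega_gt0 x)) implybT.
  by rewrite powR_inv1 ?mulrA// ltW// omega_gt0.
have mLf : measurable_fun setT (L f) by apply: smooth_measurable; exact: smooth_cauchy_L.
have slap : sqi (fun x => laplacian p x * omega x `^ (1 - s)).
  have := hpoly_laplacian hp; case: l hp ls {hC fC a LfE} => [|[|l]] hp ls hl.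
  - by rewrite hl; under eq_fun do rewrite mul0r; exact: sqi0.
  - by rewrite hl; under eq_fun do rewrite mul0r; exact: sqi0.
  - have [D D0 hD] := hpoly_bound hl.
    apply: (@sqi_omega_bound D (l%:R / 2 + (1 - s))).
    + apply: measurable_funM; last exact: measurable_omega_pow.
      by apply: smooth_measurable; exact: hpoly_smooth hl.
    + by move: ls; rewrite -[l.+2%:R]natr1 -[l.+1%:R]natr1; lra.
    + move=> x; rewrite normrM (ger0_norm (powR_ge0 _ _)) [omega x `^ (l%:R / 2 + _)]powRD; last first.
        by rewrite (gt_eqF (omega_gt0 x)) implybT.
      by rewrite mulrA ler_wpM2r ?powR_ge0.
have mw : measurable_fun setT (fun x : rV => (omega x)^-1).
  apply: (@eq_measurable_fun _ _ _ _ _ (fun x : rV => omega x `^ (-1))).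
    by move=> x _; rewrite powR_inv1// ltW// omega_gt0.
  exact: measurable_omega_pow.
have wi (x : rV) : 0 <= (omega x)^-1 <= 1.
  by rewrite invr_ge0 ltW ?omega_gt0//= invf_le1 ?omega_gt0// omega_ge1.
have sqLf : sqi (L f).
  rewrite (_ : L f = fun x => a * f x - b * (f x / omega x) + laplacian p x * omega x `^ (1 - s)).
    apply: sqiD => //; apply: sqiB; apply: sqiZ => //.
    apply: (le_sqi _ _ sqf) => [|x]; first exact: measurable_funM sqf.1 mw.
    rewrite normrM ler_piMr// ger0_norm; by have /andP[] := wi x.
  exact/funext.
pose c (k : nat) : R := k.+1%:R^-1.
have c0 k : 0 <= c k by rewrite invr_ge0.
pose e k (x : rV) := cutoff (c k * omega x).
have sco k : smooth (fun x : rV => c k * omega x) := smoothZ _ (@smooth_omega _ _).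
have se k : smooth (e k) := smooth_comp (@smooth1_cutoff R) (sco k).
have cc k : Cc_infty (fun x => e k x * f x).
  apply/Cc_inftyP; split; first exact: smoothM (se k) sf.
  by apply: bsuppMl; exact: bsupp_cutoff.
(* [F] isolates the dependence on the cut-off: g0, g1, g2 are its value and its weighted first and
   second derivatives at c omega. They are bounded uniformly and tend to 1, 0, 0. *)
pose F (g0 g1 g2 : R) (x : rV) := g0 * L f x + f x * (
    4 * ((omega x - 1) / omega x) * g2 + 2 * n%:R * g1 - 4 * (beta - 1) * ((omega x - 1) / omega x) * g1 +
    4 * g1 * (l%:R - 2 * s * ((omega x - 1) / omega x))).
have LkE k x : L (fun x => e k x * f x) x =
    F (cutoff (c k * omega x)) (c k * omega x * 'D_1 (@cutoff R) (c k * omega x))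
      ((c k * omega x) ^+ 2 * 'D_1 ('D_1 (@cutoff R)) (c k * omega x)) x.
  have w0 : omega x != 0 by rewrite gt_eqF// omega_gt0.
  rewrite (cauchy_LM _ _ (se k) sf) (cauchy_L_comp_omega _ _ (@smooth1_cutoff R)).
  rewrite (gdot_comp_omega _ (@smooth1_cutoff R)) (dot_grad_hpoly_pow _ _ hp) -/(f x) /F /e.
  move: (derive ('D_1 (@cutoff R)) (c k * omega x) 1) (derive (@cutoff R) (c k * omega x) 1) => g2 g1.
  move: (L f x) (f x) (cutoff (c k * omega x)) (omega x) (c k) w0.
  by move=> A B g0 w d w0; field.
have wr (x : rV) : `|(omega x - 1) / omega x| <= 1.
  have /andP[w1 w2] := wi x; have w0 := omega_gt0 x.
  by rewrite mulrBl divff ?gt_eqF// mul1r ger0_norm; lra.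
pose M := K * (4 + 2 * n%:R + 4 * `|beta - 1| + 4 * (l%:R + 2 * `|s|)).
have FM g0 g1 g2 x : `|g0| <= K -> `|g1| <= K -> `|g2| <= K ->
    `|F g0 g1 g2 x| <= K * `|L f x| + M * `|f x|.
  move=> h0 h1 h2; rewrite /F; apply: le_trans (ler_normD _ _) (lerD _ _).
    by rewrite normrM ler_wpM2r.
  rewrite normrM mulrC ler_wpM2r//.
  move: (wr x); move: ((omega x - 1) / omega x) => t t1.
  have h3 : `|4 * t * g2| <= 4 * K.
    by rewrite !normrM (ger0_norm (ler0n _ 4)); have := normr_ge0 t; have := normr_ge0 g2; nra.
  have h4 : `|2 * n%:R * g1| <= 2 * n%:R * K.
    by rewrite !normrM (ger0_norm (ler0n _ 2)) (ger0_norm (ler0n _ n)) ler_wpM2l.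
  have h5 : `|4 * (beta - 1) * t * g1| <= 4 * `|beta - 1| * K.
    rewrite !normrM (ger0_norm (ler0n _ 4)) -mulrA ler_wpM2l ?mulr_ge0//.
    by have := normr_ge0 t; have := normr_ge0 g1; nra.
  have h6 : `|4 * g1 * (l%:R - 2 * s * t)| <= 4 * K * (l%:R + 2 * `|s|).
    rewrite !normrM (ger0_norm (ler0n _ 4)) ler_pM ?mulr_ge0//.
      by rewrite ler_wpM2l.
    apply: le_trans (ler_normB _ _) _; rewrite (ger0_norm (ler0n _ l)) lerD2l.
    by rewrite !normrM (ger0_norm (ler0n _ 2)) ler_piMr// mulr_ge0.
  apply: le_trans (ler_normD _ _) _; apply: le_trans (lerD (ler_normB _ _) h6) _.
  apply: le_trans (_ : 4 * K + 2 * n%:R * K + 4 * `|beta - 1| * K + 4 * K * (l%:R + 2 * `|s|) <= _); last first.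
    by rewrite /M; lra.
  rewrite lerD2r; apply: lerD h5; apply: le_trans (ler_normD _ _) (lerD h3 h4).
apply: (@closed_subspace_dominated _ _ _ _ _ cauchy_range_closed (fun k => L (fun x => e k x * f x))
   (L f) (fun x => K * `|L f x| + M * `|f x|)).
- by move=> k; exact: cauchy_range_L.
- exact: mLf.
- by apply: sqiD; apply: sqiZ; exact: sqi_norm.
- move=> k x; rewrite LkE; have w0 := ltW (omega_gt0 x).
  by have [h0 h1 h2] := hK _ (mulr_ge0 (c0 k) w0); exact: FM.
- move=> x; under eq_cvg do rewrite LkE.
  have -> : L f x = F 1 0 0 x by rewrite /F; ring.
  have s1 := @smooth1_cutoff R.
  have cw : c k * omega x @[k --> \oo] --> 0.
    rewrite -(mul0r (omega x)); apply: cvgM; last exact: cvg_cst.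
    exact: cvg_harmonic.
  have ccv g : smooth1 g -> g (c k * omega x) @[k --> \oo] --> g 0.
    move=> sg; apply: (cvg_comp _ g cw).
    exact: derivable_continuous (sg 0%N 0).
  have h0 := ccv _ s1; rewrite cutoff0 in h0.
  have h1 : c k * omega x * 'D_1 (@cutoff R) (c k * omega x) @[k --> \oo] --> (0 : R).
    by rewrite -(mul0r ('D_1 (@cutoff R) (0 : R))); apply: cvgM cw (ccv _ (smooth1_derive s1)).
  have h2 : (c k * omega x) ^+ 2 * 'D_1 ('D_1 (@cutoff R)) (c k * omega x) @[k --> \oo] --> (0 : R).
    rewrite -(mul0r ('D_1 ('D_1 (@cutoff R)) (0 : R))) -[X in X * _](mulr0 (0 : R)).
    under eq_cvg do rewrite expr2.
    exact: cvgM (cvgM cw cw) (ccv _ (smooth1_derive (smooth1_derive s1))).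
  apply: cvgD; first by apply: cvgM h0 _; exact: cvg_cst.
  apply: cvgM; first exact: cvg_cst.
  apply: cvgD; last by apply: cvgM; [apply: cvgM h1; exact: cvg_cst|exact: cvg_cst].
  apply: cvgB; last by apply: cvgM h1; exact: cvg_cst.
  by apply: cvgD; [apply: cvgM h2|apply: cvgM h1]; exact: cvg_cst.
Qed.


Lemma sqi_hpoly_pow l p a : hpoly l p -> l%:R - (beta - n%:R / 2) < 2 * a ->
  sqi (fun x => p x * omega x `^ (- a)).
Proof.
move=> hp la; have [C C0 hC] := hpoly_bound hp.
apply: (@sqi_omega_bound C (l%:R / 2 - a)).
- apply: measurable_funM (measurable_omega_pow _).
  by apply: smooth_measurable; exact: hpoly_smooth hp.
- by move: la; lra.
- move=> x; rewrite normrM (ger0_norm (powR_ge0 _ _)) [omega x `^ (l%:R / 2 - a)]powRD; last first.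
    by rewrite (gt_eqF (omega_gt0 x)) implybT.
  by rewrite mulrA ler_wpM2r ?powR_ge0.
Qed.

(** The statement proved by strong induction on the degree; lower degrees take care of the Laplacian
    of p. *)
Definition radial_range l := forall p (phi : R -> R), hpoly l p ->
  measurable_fun setT phi -> sqi (fun x => p x * phi (omega x)) ->
  cauchy_range (fun x => p x * phi (omega x)).

(* Up to the Laplacian of [p], which has smaller degree, this combination is
   [L (p omega^(-s))]. *)
Lemma cauchy_range_recursion l p s :
  (forall k, (k < l)%N -> radial_range k) -> hpoly l p ->
  l%:R - (beta - n%:R / 2) < 2 * s ->
  cauchy_range (fun x =>
    (4 * s * (s + (beta - n%:R / 2) - l%:R) - 2 * (beta - 1) * l%:R) * (p x * omega x `^ (- s))
    - 4 * s * (s + beta) * (p x * omega x `^ (- s - 1))).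
Proof.
move=> IH hp ls; have WL := cauchy_range_L_hpoly hp ls.
suff Wlap : cauchy_range (fun x => laplacian p x * omega x `^ (1 - s)).
  have := closed_subspaceB cauchy_range_closed WL Wlap; congr cauchy_range.
  by apply/funext => x; rewrite (cauchy_L_hpoly_pow _ _ _ hp) addrK.
have := hpoly_laplacian hp; case: l hp IH ls WL => [|[|l]] hp IH ls WL hl.
- by rewrite hl; under eq_fun do rewrite mul0r; exact: cauchy_range_cst.
- by rewrite hl; under eq_fun do rewrite mul0r; exact: cauchy_range_cst.
- apply: (IH l _ (laplacian p) (fun w => w `^ (1 - s))) => //.
  rewrite (_ : 1 - s = - (s - 1)); last by ring.
  apply: sqi_hpoly_pow hl _.
  by move: ls; rewrite -[l.+2%:R]natr1 -[l.+1%:R]natr1; lra.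
Qed.

Let dlt := beta - n%:R / 2.
Let dlt_gt0 : 0 < dlt. Proof. by rewrite subr_gt0. Qed.
Let beta_gt0 : 0 < beta. Proof. exact: lt_trans ltr01 beta_gt1. Qed.

(* At the positive root [s0] of the first coefficient in [cauchy_range_recursion]
   only the term in [omega^(-s0-1)] survives; for [l = 0] the root is 0, where the
   recursion is empty, and one divides it by [s] and lets [s] tend to 0. *)
Lemma cauchy_range_start l p : (forall k, (k < l)%N -> radial_range k) -> hpoly l p ->
  exists s0, [/\ 0 <= s0, l%:R - dlt < 2 * s0 &
    cauchy_range (fun x => p x * omega x `^ (- s0 - 1))].
Proof.
move=> IH hp; case: l => [|l] in IH hp *; last first.
  (* The coefficient to kill is 4 times s^2 + b s - (beta - 1) l / 2, with l the current degree,
     whose discriminant is [D]. As beta > 1, sqrt D exceeds |b|, which makes the larger root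
     positive and gives the integrability condition 2 s0 > -b. *)
  pose b := dlt - l.+1%:R; pose D := b ^+ 2 + 2 * (beta - 1) * l.+1%:R.
  have l0 : 0 < l.+1%:R :> R by rewrite ltr0n.
  have bl : 0 < 2 * (beta - 1) * l.+1%:R by rewrite !mulr_gt0// subr_gt0 beta_gt1.
  have D0 : 0 <= D by rewrite addr_ge0 ?sqr_ge0// ltW.
  have sD : Num.sqrt D ^+ 2 = D by rewrite sqr_sqrtr.
  have bD : `|b| < Num.sqrt D by rewrite -sqrtr_sqr ltr_sqrt ?ltrDl// (lt_le_trans bl)// lerDr sqr_ge0.
  pose s0 := (Num.sqrt D - b) / 2.
  have s0_gt0 : 0 < s0 by rewrite divr_gt0// subr_gt0 (le_lt_trans (ler_norm _)).
  have ls : l.+1%:R - dlt < 2 * s0.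
    rewrite -(opprB dlt) -/b /s0 mulrCA divff ?mulr1//.
    by rewrite ltrBrDl subrr (le_lt_trans _ bD).
  exists s0; split=> //; first exact: ltW.
  have := cauchy_range_recursion IH hp ls.
  rewrite (_ : 4 * s0 * (s0 + (beta - n%:R / 2) - l.+1%:R) - 2 * (beta - 1) * l.+1%:R = 0); last first.
    rewrite -/dlt -addrA -/b /s0.
    have -> : 4 * ((Num.sqrt D - b) / 2) * ((Num.sqrt D - b) / 2 + b) = Num.sqrt D ^+ 2 - b ^+ 2 by field.
    by rewrite sD /D; ring.
  have [_ _ WZ _] := cauchy_range_closed.
  move=> /(WZ (- (4 * s0 * (s0 + beta))^-1)); congr cauchy_range; apply/funext => x.
  have : 4 * s0 * (s0 + beta) != 0.
    by apply: lt0r_neq0; apply: mulr_gt0; [exact: mulr_gt0|exact: addr_gt0].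
  move: (4 * s0 * (s0 + beta)) (omega x `^ (- s0 - 1)) (omega x `^ (- s0)) => c P Q c0.
  by field.
exists 0; split=> //; first by rewrite mulr0 sub0r oppr_lt0.
have Wp : cauchy_range p by have [c ->] := hpoly_cstE hp; exact: cauchy_range_cst.
have [_ WD WZ _] := cauchy_range_closed.
have W1 : cauchy_range (fun x => dlt * p x - beta * (p x * omega x `^ (- 1))).
  pose c (k : nat) : R := k.+1%:R^-1.
  have c1 k : 0 < c k <= 1 by rewrite invr_gt0 ltr0n/= invf_le1 ?ler1n ?ltr0n.
  have W2 k : cauchy_range (fun x => (c k + dlt) * (p x * omega x `^ (- c k)) -
      (c k + beta) * (p x * omega x `^ (- c k - 1))).
    have /andP[ck _] := c1 k.
    have cd : 0%:R - (beta - n%:R / 2) < 2 * c k by move: dlt_gt0; rewrite /dlt; lra.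
    have := WZ (4 * c k)^-1 _ (cauchy_range_recursion IH hp cd).
    congr cauchy_range; apply/funext => x.
    move: (omega x `^ (- c k - 1)) (omega x `^ (- c k)) => P Q.
    by rewrite /dlt; field; rewrite gt_eqF.
  have ow (a : R) x : 0 <= a -> `|omega (x : rV) `^ (- a)| <= 1.
    move=> a0; rewrite ger0_norm ?powR_ge0// -[leRHS](powRr0 (omega x)).
    by rewrite ler_powR ?omega_ge1// oppr_le0.
  have sp := hpoly_smooth hp.
  have mp : measurable_fun setT p := smooth_measurable sp.
  apply: (@closed_subspace_dominated _ _ _ _ _ cauchy_range_closed _ _ (fun x => (1 + dlt + (1 + beta)) * `|p x|) W2).
  - apply: measurable_funB; apply: measurable_funM => //.
    by apply: measurable_funM => //; exact: measurable_omega_pow.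
  - apply: sqiZ; apply: sqi_norm; by case: Wp.
  - move=> k x; have /andP[ck ck1] := c1 k; rewrite [leRHS]mulrDl.
    have b1 := beta_gt1.
    apply: le_trans (ler_normB _ _) (lerD _ _).
      rewrite !normrM ler_pM ?normr_ge0 ?mulr_ge0//.
        by rewrite ger0_norm ?lerD2r// addr_ge0// ltW.
      by rewrite ler_piMr// ow// ltW.
    rewrite !normrM ler_pM ?normr_ge0 ?mulr_ge0//.
      by rewrite ger0_norm; lra.
    rewrite ler_piMr// -opprD ow//; lra.
  - move=> x.
    have c0 : c k @[k --> \oo] --> (0 : R) by exact: cvg_harmonic.
    have cw (a : R) : omega x `^ (- c k - a) @[k --> \oo] --> omega x `^ (- a).
      have pE b : omega x `^ b = expR (b * ln (omega x)).
        by rewrite /powR gt_eqF// omega_gt0.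
      rewrite pE; under eq_cvg do rewrite pE.
      apply: continuous_cvg; first exact: continuous_expR.
      apply: cvgM; last exact: cvg_cst.
      rewrite -[X in _ --> X]sub0r; apply: cvgB; last exact: cvg_cst.
      by rewrite -[X in _ --> X]oppr0; exact: cvgN.
    have cw0 := cw 0; rewrite oppr0 powRr0 in cw0.
    have -> : dlt * p x - beta * (p x * omega x `^ (-1)) =
        (0 + dlt) * (p x * 1) - (0 + beta) * (p x * omega x `^ (-1)) by ring.
    apply: cvgB; (apply: cvgM; first by apply: cvgD => //; exact: cvg_cst).
      apply: cvgM; first exact: cvg_cst.
      by rewrite (_ : (fun k => omega x `^ - c k) = fun k => omega x `^ (- c k + 0))//; apply/funext => k; rewrite addr0.
    by apply: cvgM => //; exact: cvg_cst.
have := WZ (- beta^-1) _ (WD _ _ W1 (WZ (- dlt) _ Wp)); congr cauchy_range.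
apply/funext => x; rewrite oppr0 sub0r.
have b0 : beta != 0 by rewrite gt_eqF.
by move: (omega x `^ (-1)) => P; field.
Qed.

(** From p omega^(-s0-1) the recursion climbs to all p omega^(-s0-1-k), its second coefficient being
    nonzero for s > 0. Polynomials in 1/omega times h are thus reached, and the monotone class
    theorem applies with the single bounded coordinate 1/omega. *)
Lemma radial_range_all l : radial_range l.
Proof.
elim/ltn_ind: l => l IH p phi hp mphi sphi.
have [s0 [s00 ls0 Ws0]] := cauchy_range_start IH hp.
have [WS WD WZ _] := cauchy_range_closed.
have powB1 a (x : rV) : omega x `^ (a - 1) = omega x `^ a * (omega x)^-1.
  rewrite powRD; last by rewrite (gt_eqF (omega_gt0 x)) implybT.
  by rewrite powR_inv1// ltW// omega_gt0.
pose h (x : rV) := p x * omega x `^ (- s0 - 1).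
have Wk k : cauchy_range (fun x => (omega x)^-1 ^+ k * h x).
  elim: k => [|k IHk]; first by under eq_fun do rewrite expr0 mul1r.
  (* At this s the first power in the recursion is the one reached for k, and the second is the one
     wanted for k + 1. *)
  pose s := s0 + k.+1%:R.
  have hk j (x : rV) : p x * omega x `^ (- (s0 + j%:R) - 1) = (omega x)^-1 ^+ j * h x.
    elim: j => [|j IHj]; first by rewrite addr0 mul1r.
    rewrite -natr1 (_ : - (s0 + (j%:R + 1)) - 1 = - (s0 + j%:R) - 1 - 1); last by ring.
    by rewrite powB1 mulrA IHj exprS; ring.
  have s_gt0 : 0 < s by rewrite ltr_wpDl// ltr0n.
  have ls : l%:R - dlt < 2 * s.
    by apply: lt_le_trans ls0 _; rewrite ler_pM2l// lerDl.
  have := cauchy_range_recursion IH hp ls.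
  set a := 4 * s * _ - _; set b := 4 * s * _ => W1.
  have b0 : b != 0 by apply: lt0r_neq0; apply: mulr_gt0; [exact: mulr_gt0|exact: addr_gt0].
  have := WZ (- b^-1) _ (WD _ _ W1 (WZ (- a) _ IHk)).
  congr cauchy_range; apply/funext => x; rewrite -(hk k.+1) -(hk k) -/s.
  rewrite (_ : - (s0 + k%:R) - 1 = - s); last by rewrite /s -natr1; ring.
  move: (omega x `^ (- s)) (omega x `^ (- s - 1)) => P Q.
  by field.
pose Y (x : rV) : 'rV[R]_1 := \row_(i < 1) (omega x)^-1.
have mw : measurable_fun setT (fun x : rV => (omega x)^-1).
  apply: (@eq_measurable_fun _ _ _ _ _ (fun x : rV => omega x `^ (-1))).
    by move=> x _; rewrite powR_inv1// ltW// omega_gt0.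
  exact: measurable_omega_pow.
pose S u := exists q : {poly R}, u = fun x => q.[(omega x)^-1] * h x.
(* The target is rewritten as h times a function of y = 1/omega; the exponent -1 gives a total
   measurable inverse on all of R. *)
have Wh x : p x * phi (omega x) = h x * (phi (Y x ord0 ord0 `^ (-1)) * (Y x ord0 ord0 `^ (-1)) `^ (s0 + 1)).
  rewrite mxE powR_inv1 ?invr_ge0 ?ltW ?omega_gt0// invrK /h mulrACA -mulrA -powRD; last by rewrite (gt_eqF (omega_gt0 x)) implybT.
  by rewrite (_ : - s0 - 1 + _ = 0) ?powRr0 ?mulr1//; ring.
pose phi1 (v : 'rV[R]_1) := phi (v ord0 ord0 `^ (-1)) * (v ord0 ord0 `^ (-1)) `^ (s0 + 1).
have {}Wh : (fun x => p x * phi (omega x)) = fun x => h x * phi1 (Y x) by exact/funext.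
rewrite Wh in sphi *.
apply: (@comp_closed_subspace _ _ _ _ _ cauchy_range_closed 1 Y h _ _ S _ _ _ _ _ phi1) => //.
- by apply: measurable_fun_coordP => i; under eq_fun do rewrite mxE.
- move=> i x; rewrite mxE; have w1 := omega_ge1 x; have w0 := omega_gt0 x.
  by rewrite (le_trans (_ : -1 <= 0)) ?invr_ge0 ?(ltW w0)// invf_le1.
- by exists 1; apply/funext => x; rewrite hornerC mul1r.
- move=> _ _ [q ->] [r ->]; exists (q + r); apply/funext => x.
  by rewrite hornerD mulrDl.
- move=> c _ [q ->]; exists (c *: q); apply/funext => x.
  by rewrite hornerZ mulrA.
- move=> i _ [q ->]; exists ('X * q); apply/funext => x.
  by rewrite hornerM hornerX mxE mulrA.
- move=> _ [q ->].
  rewrite (_ : (fun x => _) = fun x => \sum_(i < size q) q`_i * ((omega x)^-1 ^+ i * h x)).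
    by apply: (closed_subspace_sum cauchy_range_closed _ (Wk 0%N)) => i; exact: WZ.
  by apply/funext => x; rewrite horner_coef mulr_suml; apply: eq_bigr => i _; rewrite -mulrA.
- have mc := @measurable_coord R 1 ord0.
  have mi : measurable_fun setT (fun v : 'rV[R]_1 => v ord0 ord0 `^ (-1)).
    exact: (measurableT_comp (measurable_powR _) mc).
  apply: measurable_funM; first exact: (measurableT_comp mphi mi).
  exact: (measurableT_comp (measurable_powR _) mi).
Qed.

(** Polynomials in 1/omega and x_i/omega. A factor x_i/omega raises the degree l and leaves k, a
    factor 1/omega raises k; the exponent l + k is always enough for square integrability. *)
Inductive hpoly_frac : (rV -> R) -> Prop :=
| hpoly_frac_pow l k p : hpoly l p -> hpoly_frac (fun x => p x * omega x `^ (- (l + k)%:R))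
| hpoly_fracD u v : hpoly_frac u -> hpoly_frac v -> hpoly_frac (fun x => u x + v x).

(* [x] is a function of the bounded coordinates [1/omega] and [x_i/omega], in which
   polynomials are dense. *)
Lemma cauchy_range_sqi u : sqi u -> cauchy_range u.
Proof.
move=> su; have [WS WD WZ _] := cauchy_range_closed.
have powB1 a (x : rV) : omega x `^ (a - 1) = omega x `^ a * (omega x)^-1.
  rewrite powRD; last by rewrite (gt_eqF (omega_gt0 x)) implybT.
  by rewrite powR_inv1// ltW// omega_gt0.
have mw : measurable_fun setT (fun x : rV => (omega x)^-1).
  apply: (@eq_measurable_fun _ _ _ _ _ (fun x : rV => omega x `^ (-1))).
    by move=> x _; rewrite powR_inv1// ltW// omega_gt0.
  exact: measurable_omega_pow.
pose T (x : rV) : 'rV[R]_n := \row_i (x ord0 i / omega x).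
pose Y (x : rV) : 'rV[R]_n.+1 := rV_cons ((omega x)^-1, T x).
pose back (v : 'rV[R]_n.+1) : 'rV[R]_n := \row_i (v ord0 (lift ord0 i) * v ord0 ord0 `^ (-1)).
have backY x : back (Y x) = x.
  apply/rowP => i; rewrite !mxE liftK unlift_none /= !mxE.
  by rewrite powR_inv1 ?invr_ge0 ?ltW ?omega_gt0// invrK mulfVK// gt_eqF// omega_gt0.
have mback : measurable_fun setT back.
  apply: measurable_fun_coordP => i; under eq_fun do rewrite mxE.
  apply: measurable_funM; first exact: measurable_coord.
  exact: (measurableT_comp (measurable_powR _) (measurable_coord ord0)).
suff : cauchy_range (fun x => 1 * u (back (Y x))).
  by under eq_fun do rewrite mul1r backY.
apply: (@comp_closed_subspace _ _ _ _ _ cauchy_range_closed n.+1 Y (fun=> 1) _ _ hpoly_frac _ _ _ _ _ (u \o back)) => //.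
- apply: measurable_fun_coordP => i; rewrite /Y; under eq_fun do rewrite mxE.
  case: (unlift ord0 i) => [j|] //=; under eq_fun do rewrite mxE.
  by apply: measurable_funM => //; exact: measurable_coord.
- move=> i x; have w0 := omega_gt0 x; have w1 := omega_ge1 x.
  rewrite mxE; case: (unlift ord0 i) => [j|] /=; last first.
    by rewrite (le_trans (_ : -1 <= 0)) ?invr_ge0 ?(ltW w0)// invf_le1.
  rewrite mxE -ler_norml normrM normfV (ger0_norm (ltW w0)) ler_pdivrMr// mul1r.
  apply: le_trans (coord_le_omega j x) _.
  by rewrite -[leRHS]powRr1 ?(ltW w0)// ler_powR// invf_le1//; lra.
- have := hpoly_frac_pow 0 (@hpoly_cst R n 1); congr hpoly_frac.
  by apply/funext => x; rewrite oppr0 powRr0 mulr1.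
- exact: hpoly_fracD.
- move=> c f; elim=> {f} [l k p hp|f g _ IHf _ IHg]; last by under eq_fun do rewrite mulrDr; exact: hpoly_fracD.
  by under eq_fun do rewrite mulrA; apply: hpoly_frac_pow; exact: hpolyZ.
- move=> i f; elim=> {f} [l k p hp|f g _ IHf _ IHg]; last by under eq_fun do rewrite mulrDr; exact: hpoly_fracD.
  rewrite /Y; case: (unliftP ord0 i) => [j|] ->; last first.
    have := hpoly_frac_pow k.+1 hp; congr hpoly_frac; apply/funext => x.
    by rewrite mxE unlift_none/= addnS -natr1 opprD powB1; ring.
  have := hpoly_frac_pow k (hpolyM j hp); congr hpoly_frac; apply/funext => x.
  by rewrite mxE liftK/= mxE addSn -natr1 opprD powB1 /coord; ring.
- move=> f; elim=> {f} [l k p hp|f g _ IHf _ IHg]; last exact: WD.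
  apply: (radial_range_all (p := p) (phi := fun w => w `^ (- (l + k)%:R)) hp) => //.
  apply: sqi_hpoly_pow hp _; rewrite natrD.
  have l0 : 0 <= l%:R :> R by []. have k0 : 0 <= k%:R :> R by [].
  by move: dlt_gt0; rewrite /dlt; lra.
- exact: measurableT_comp su.1 mback.
- by under eq_fun do rewrite mul1r /= backY.
Qed.

End dense_range.

Opaque cauchy_L gdot laplacian.

(** * Poincare inequality and closure of the operator *)

Section L2norm_convergence.
Context d (T : measurableType d) (R : realType) (mu : {measure set T -> \bar R}).

Lemma L2norm_cvg0 (I : Type) (F : set_system I) {FF : Filter F} (h : I -> T -> R) :
  (\forall k \near F, sqi mu (h k)) ->
  (L2norm mu (h k) @[k --> F] --> 0%E) <-> (nrm mu (h k) @[k --> F] --> (0 : R)).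
Proof.
move=> sh.
have E : \forall k \near F, L2norm mu (h k) = (nrm mu (h k))%:E.
  by near=> k; apply: L2norm_nrm; near: k.
split=> H.
  have : (nrm mu (h k))%:E @[k --> F] --> (0%:E : \bar R).
    by apply: cvg_trans H; apply: near_eq_cvg.
  by move=> /fine_cvgP[_].
have H' : (nrm mu (h k))%:E @[k --> F] --> (0%:E : \bar R).
  by apply: cvg_EFin => //; near=> k.
by apply: cvg_trans H'; apply: near_eq_cvg; apply: filterS E => k ->.
Unshelve. all: by end_near. Qed.

Lemma ipDMD f g f' g' c : sqi mu f -> sqi mu g -> sqi mu f' -> sqi mu g' ->
  ip mu (fun x => f x + c * g x) (fun x => f' x + c * g' x) =
  ip mu f f' + c * ip mu f g' + c * ip mu g f' + c ^+ 2 * ip mu g g'.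
Proof.
move=> sf sg sf' sg'; have sg1 := sqiZ c sg; have sg1' := sqiZ c sg'.
rewrite (ipDl sf sg1 (sqiD sf' sg1')) !(ipDr sf' sg1') ?(ipZl _ sg) ?(ipZr _ sg')//.
by ring.
Qed.

Lemma ipBB f g : sqi mu f -> sqi mu g ->
  ip mu (fun x => f x - g x) (fun x => f x - g x) = ip mu f f - 2 * ip mu f g + ip mu g g.
Proof.
move=> sf sg; rewrite (ipBl sf sg (sqiB sf sg)) !ipBr// [ip mu g f]ipC.
by ring.
Qed.

End L2norm_convergence.

(** * Energy inequalities on test functions *)

Section poincare.
Context (R : realType) (n : nat) (beta : R).
Hypothesis n2 : (2 <= n)%N.
Hypothesis beta_gt : n%:R / 2 < beta.
Hypothesis beta_le : beta <= n%:R / 2 + 2.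
Local Notation rV := 'rV[R]_n.
Local Notation mu := (@cauchy_measure R n beta).
Local Notation L := (cauchy_L beta).
Local Notation sqi := (sqi mu).
Local Notation nrm := (nrm mu).
Local Notation ip := (ip mu).
Local Notation lambda := ((beta - n%:R / 2) ^+ 2).
Implicit Types u v f g : rV -> R.

Let n0 : (0 < n)%N. Proof. exact: ltn_trans n2. Qed.
Let s1 : sqi (fun=> 1). Proof. exact: sqi_cst. Qed.

Lemma sqi_integrable f : sqi f -> mu.-integrable setT (EFin \o f).
Proof.
move=> sf; have := sqi_integrableM sf s1; congr (integrable _ _ _).
by apply/funext => x /=; rewrite mulr1.
Qed.

Lemma ip_cst1 f : ip f (fun=> 1) = \int[mu]_x f x.
Proof. by apply: eq_Rintegral => x _; rewrite mulr1. Qed.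

Lemma Rintegral_cauchy_cst c : \int[mu]_x c = c.
Proof.
rewrite Rintegral_cst//; transitivity (c * fine (1%E : \bar R)); last by rewrite mulr1.
by congr (_ * fine _); exact: cauchy_measure_setT.
Qed.

Lemma ip11 : ip (fun=> 1) (fun=> 1) = 1.
Proof.
by rewrite ip_cst1 Rintegral_cauchy_cst.
Qed.

Lemma variance_ip f : sqi f -> variance_of mu f = ip f f - (\int[mu]_x f x) ^+ 2.
Proof.
move=> sf; rewrite /variance_of.
under eq_Rintegral do rewrite expr2.
set m := \int[mu]_y f y; have sm : sqi (fun=> m * 1) := sqiZ m s1.
rewrite -[LHS]/(ip (fun x => f x - m) (fun x => f x - m)).
have -> : (fun x : rV => f x - m) = (fun x => f x - m * 1) by apply/funext => x; rewrite mulr1.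
rewrite ipBB// (ipZr _ s1 sf) (ipZl _ s1 sm) (ipZr _ s1 s1) ip11 ip_cst1 -/m.
by ring.
Qed.

Lemma sqi_mean f : sqi f -> sqi (fun x => f x - \int[mu]_y f y).
Proof. by move=> sf; apply: sqiB sf _; exact: sqi_cst. Qed.

(** The Dirichlet form of [L]. In this form symmetry and nonnegativity are pointwise, while [dformE]
    links it to the operator. *)
Definition dform u v := \int[mu]_x (omega x * gdot u v x).

Lemma Cc_dform u v : Cc_infty u -> smooth v -> Cc_infty (fun x => omega x * gdot u v x).
Proof.
move=> cu sv; apply: CcMr (@smooth_omega _ _); apply: Cc_sum => i.
exact: CcMl (Cc_partial i cu) (smooth_partial i sv).
Qed.

Lemma dformE u v : Cc_infty u -> smooth v -> dform u v = - ip v (L u).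
Proof.
move=> cu sv; have := cauchy_green beta cu sv; rewrite RintegralD//.
- by move/eqP; rewrite addr_eq0 => /eqP H; rewrite /dform /ip H opprK.
- exact: sqi_integrable (sqi_Cc n2 beta_gt (CcMr (Cc_cauchy_L beta cu) sv)).
- exact: sqi_integrable (sqi_Cc n2 beta_gt (Cc_dform cu sv)).
Qed.

Lemma dformC u v : dform u v = dform v u.
Proof.
apply: eq_Rintegral => x _; congr (_ * _); apply: eq_bigr => i _; exact: mulrC.
Qed.

Lemma ip_cauchy_LC u v : Cc_infty u -> Cc_infty v -> ip u (L v) = ip v (L u).
Proof.
move=> cu cv; apply: oppr_inj.
have e1 := dformE cv (Cc_smooth cu); have e2 := dformE cu (Cc_smooth cv).
exact: etrans (esym e1) (etrans (dformC v u) e2).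
Qed.

Lemma dform_ge0 u : 0 <= dform u u.
Proof.
apply: Rintegral_ge0 => x _; apply: mulr_ge0; first exact/ltW/omega_gt0.
Transparent gdot.
by apply: sumr_ge0 => i _; rewrite -expr2 sqr_ge0.
Qed.

Lemma gdot_cst u c x : gdot u (fun=> c) x = 0.
Proof. by apply: big1 => i _; rewrite partial_cst mulr0. Qed.

Lemma mean_cauchy_L u : Cc_infty u -> \int[mu]_x L u x = 0.
Proof.
move=> cu; rewrite -ip_cst1 ipC; apply: oppr_inj; rewrite oppr0.
rewrite -(dformE cu (@smooth_cst _ _ 1)) /dform -[RHS](Rintegral_cauchy_cst 0).
by apply: eq_Rintegral => x _; rewrite gdot_cst mulr0.
Qed.

Lemma integral_gamma2 u : Cc_infty u ->
  \int[mu]_x gamma2_form beta x (grad u x) (hess u x) = ip (L u) (L u) - lambda * dform u u.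
Proof.
move=> cu; have su := Cc_smooth cu.
have cL := Cc_cauchy_L beta cu.
have iQ : mu.-integrable setT (EFin \o (fun x => gamma2_form beta x (grad u x) (hess u x))).
  apply: (sqi_integrable (sqi_Cc n2 beta_gt _)).
  by apply/Cc_inftyP; split; [exact: smooth_gamma2|exact: bsupp_gamma2].
have iL : mu.-integrable setT (EFin \o (fun x => L u x ^+ 2)).
  apply: (sqi_integrable (sqi_Cc n2 beta_gt _)).
  by under eq_fun do rewrite expr2; exact: CcMl cL (Cc_smooth cL).
have iD : mu.-integrable setT (EFin \o (fun x => omega x * gdot u u x)).
  exact: sqi_integrable (sqi_Cc n2 beta_gt (Cc_dform cu su)).
have iD2 : mu.-integrable setT (EFin \o (fun x => lambda * (omega x * gdot u u x))).
  exact: (@integrableZl _ _ _ mu setT measurableT lambda _ iD).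
have := gamma2_integral beta n2 cu; rewrite RintegralB//; last exact: (integrableB measurableT iL iD2).
rewrite RintegralB// RintegralZl// => /eqP; rewrite subr_eq0 => /eqP <-.
by congr (_ - _); apply: eq_Rintegral => x _; rewrite expr2.
Qed.

Lemma dform_le_L u : Cc_infty u -> lambda * dform u u <= ip (L u) (L u).
Proof.
move=> cu; rewrite -subr_ge0 -integral_gamma2//; apply: Rintegral_ge0 => x _.
exact: gamma2_form_ge0.
Qed.

Let poincare_arith1 (y d l : R) : 0 < l -> 0 < d -> y <= d / (8 * l) -> l * (4 * y) < d.
Proof. by move=> l1 d0; rewrite ler_pdivlMr ?mulr_gt0//; lra. Qed.

Let poincare_arith2 (E b c d q l e : R) : l * (l * E) <= l * d ->
  l * (d - 2 * c + q) <= l * (4 * e) -> l * (4 * e) < l * q - - b ->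
  0 <= - (b + l * c + l * c + l ^+ 2 * - E) -> False.
Proof. by lra. Qed.

(* If [L phi] is close to [f] minus its mean, then the energy of [f + lambda phi],
   which is nonnegative, is about that of [f] minus [lambda Var f]. *)
Lemma poincare_Cc f : Cc_infty f -> lambda * variance_of mu f <= dform f f.
Proof.
move=> cf; have sf := sqi_Cc n2 beta_gt cf.
pose m := \int[mu]_x f x; pose g (x : rV) := f x - m.
have sg : sqi g by exact: sqi_mean.
have vE : variance_of mu f = ip g g by apply: eq_Rintegral => x _; rewrite expr2.
have l0 : 0 < lambda by rewrite exprn_gt0// subr_gt0.
rewrite vE leNgt; apply/negP => D0.
pose D := lambda * ip g g - dform f f; have {}D0 : 0 < D by rewrite subr_gt0.
(* The mean of the error r is c - m, so replacing c by -m costs at most another e and |h| <= 2 e.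
   The cap 1 gives |h|^2 <= 4 e, and the second bound makes lambda times 4 e smaller than [D]. *)
pose e := Num.min 1 (D / (8 * lambda)).
have e0 : 0 < e by rewrite lt_min ltr01 divr_gt0// mulr_gt0.
have [_ /(_ _ e0)[phi [c [cphi he]]]] := cauchy_range_sqi n2 beta_gt sf.
have sL := sqi_cauchy_L n2 beta_gt cphi.
pose r x := L phi x + c - f x.
have sr : sqi r by apply: sqiB sf; apply: sqiD sL _; exact: sqi_cst.
have rm : ip r (fun=> 1) = c - m.
  rewrite /r (ipBl _ sf s1); last by apply: sqiD sL _; exact: sqi_cst.
  rewrite (ipDl sL _ s1); last exact: sqi_cst.
  by rewrite !ip_cst1 mean_cauchy_L// add0r Rintegral_cauchy_cst.
have cm : `|c - m| <= e.
  rewrite -rm; apply: le_trans (CauchySchwarz sr s1) _.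
  by rewrite /nrm ip11 sqrtr1 mulr1 ltW.
pose h x := L phi x - g x.
have sh : sqi h by exact: sqiB.
have hn : nrm h <= 2 * e.
  have -> : h = fun x => r x + (m - c) * 1 by apply/funext => x; rewrite /h /r /g; ring.
  apply: le_trans (nrmD sr (sqiZ _ s1)) _; rewrite nrmZ// /nrm ip11 sqrtr1 mulr1 distrC.
  by have := he; rewrite -/r -/(nrm r) => he'; lra.
have hh : ip h h <= 4 * e.
  have e1 : e <= 1 by rewrite ge_min lexx.
  by rewrite -sqr_nrm; have := nrm_ge0 mu h; nra.
have : 0 <= dform (fun x => f x + lambda * phi x) (fun x => f x + lambda * phi x) by exact: dform_ge0.
have cl : Cc_infty (fun x => lambda * phi x) by exact: CcZ.
rewrite dformE; last 2 first.
- exact: CcD.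
- exact: smoothD (Cc_smooth cf) (Cc_smooth cl).
have -> : L (fun x => f x + lambda * phi x) = fun x => L f x + lambda * L phi x.
  apply/funext => x; rewrite (cauchy_LD _ _ (Cc_smooth cf) (Cc_smooth cl)).
  by rewrite (cauchy_LZ _ _ _ (Cc_smooth cphi)).
have sLf := sqi_cauchy_L n2 beta_gt cf; have sphi := sqi_Cc n2 beta_gt cphi.
rewrite (ipDMD _ sf sphi sLf sL) (ip_cauchy_LC cphi cf).
have := dformE cf (Cc_smooth cf); have := dformE cphi (Cc_smooth cphi).
have := dform_le_L cphi; move: (dform phi phi) => E1 h1 h2.
have fg : ip f (L phi) = ip g (L phi).
  have -> : g = fun x => f x - m * 1 by apply/funext => x; rewrite mulr1.
  by rewrite (ipBl sf (sqiZ m s1) sL) (ipZl _ s1 sL) [ip (fun=> 1) _]ipC ip_cst1 mean_cauchy_L// mulr0 subr0.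
have hE : ip h h = ip (L phi) (L phi) - 2 * ip g (L phi) + ip g g.
  by rewrite /h (ipBB sL sg) [ip (L phi) g]ipC.
have De : lambda * (4 * e) < D.
  by apply: poincare_arith1 => //; rewrite ge_min lexx orbT.
move=> EE; have {}h2 : ip phi (L phi) = - E1 by rewrite h2 opprK.
rewrite fg h2; move: De; move/(ler_wpM2l (ltW l0)): hh; rewrite hE /D EE.
have /poincare_arith2 := ler_wpM2l (ltW l0) h1; apply.
Qed.

End poincare.

Opaque gdot.

(** * The L^2-closure of L *)

Section closure.
Context (R : realType) (n : nat) (beta : R).
Hypothesis n2 : (2 <= n)%N.
Hypothesis beta_gt : n%:R / 2 < beta.
Hypothesis beta_le : beta <= n%:R / 2 + 2.
Local Notation rV := 'rV[R]_n.
Local Notation mu := (@cauchy_measure R n beta).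
Local Notation L := (cauchy_L beta).
Local Notation sqi := (sqi mu).
Local Notation nrm := (nrm mu).
Local Notation ip := (ip mu).
Local Notation lambda := ((beta - n%:R / 2) ^+ 2).
Implicit Types (f g : rV -> R).

Let n0 : (0 < n)%N. Proof. exact: ltn_trans n2. Qed.
Let s1 : sqi (fun=> 1). Proof. exact: sqi_cst. Qed.

Definition graph_approx f g (u : nat -> rV -> R) := [/\ forall k, Cc_infty (u k),
  nrm (fun x => u k x - f x) @[k --> \oo] --> (0 : R) &
  nrm (fun x => L (u k) x - g x) @[k --> \oo] --> (0 : R)].

Lemma cauchy_domP f g : cauchy_dom n beta f g <->
  [/\ sqi f, sqi g & exists u, graph_approx f g u].
Proof.
split.
- move=> [/Lfun2P sf /Lfun2P sg [u [cu uf Lug]]]; split=> //; exists u; split=> //.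
    apply/(L2norm_cvg0 _).1 => //; apply: nearW => k; exact: sqiB (sqi_Cc n2 beta_gt (cu k)) sf.
  apply/(L2norm_cvg0 _).1 => //; apply: nearW => k; exact: sqiB (sqi_cauchy_L n2 beta_gt (cu k)) sg.
- move=> [sf sg [u [cu uf Lug]]]; split; [exact/Lfun2P|exact/Lfun2P|].
  exists u; split=> //.
    apply/(L2norm_cvg0 _).2 => //; apply: nearW => k; exact: sqiB (sqi_Cc n2 beta_gt (cu k)) sf.
  apply/(L2norm_cvg0 _).2 => //; apply: nearW => k; exact: sqiB (sqi_cauchy_L n2 beta_gt (cu k)) sg.
Qed.

Lemma cauchy_dom_Cc f : Cc_infty f -> cauchy_dom n beta f (L f).
Proof.
move=> cf; apply/cauchy_domP; split; [exact: sqi_Cc|exact: sqi_cauchy_L|].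
exists (fun=> f); split=> //.
  by rewrite nrm_subxx; exact: cvg_cst.
by rewrite nrm_subxx; exact: cvg_cst.
Qed.

Lemma graph_approx_ip f g f' g' u v : sqi f -> sqi g -> sqi f' -> sqi g' ->
  graph_approx f g u -> graph_approx f' g' v ->
  [/\ ip (u k) (v k) @[k --> \oo] --> ip f f',
      ip (u k) (L (v k)) @[k --> \oo] --> ip f g' &
      ip (L (u k)) (L (v k)) @[k --> \oo] --> ip g g'].
Proof.
move=> sf sg sf' sg' [cu uf ug] [cv vf vg].
have su k := sqi_Cc n2 beta_gt (cu k); have sv k := sqi_Cc n2 beta_gt (cv k).
have sLu k := sqi_cauchy_L n2 beta_gt (cu k); have sLv k := sqi_cauchy_L n2 beta_gt (cv k).
by split; [apply: (cvg_nrm_ip _ _ sf sf' uf vf)|apply: (cvg_nrm_ip _ _ sf sg' uf vg)|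
  apply: (cvg_nrm_ip _ _ sg sg' ug vg)]; apply: nearW.
Qed.

(** Symmetry survives the closure because all inner products converge along graph approximations. It
    identifies the derivative of <f_t, L f_t> as 2 |L f_t|^2. *)
Lemma cauchy_dom_sym f g f' g' : cauchy_dom n beta f g -> cauchy_dom n beta f' g' ->
  ip f g' = ip g f'.
Proof.
move=> /cauchy_domP[sf sg [u ug]] /cauchy_domP[sf' sg' [v vg]].
have [_ h1 _] := graph_approx_ip sf sg sf' sg' ug vg.
have [_ h2 _] := graph_approx_ip sf' sg' sf sg vg ug.
rewrite [ip g f']ipC; apply: (cvg_unique (@Rhausdorff R) h1).
apply: (cvg_trans _ h2); apply: near_eq_cvg; apply: nearW => k.
by have [cu _ _] := ug; have [cv _ _] := vg; exact: ip_cauchy_LC.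
Qed.

Lemma cauchy_dom_mean f g : cauchy_dom n beta f g -> \int[mu]_x g x = 0.
Proof.
move=> /cauchy_domP[sf sg [u [cu uf ug]]]; rewrite -ip_cst1.
have h : ip (L (u k)) (fun=> 1) @[k --> \oo] --> ip g (fun=> 1).
  apply: (@cvg_nrm_ip _ _ _ mu _ _ _ (fun k => L (u k)) (fun=> fun=> 1)) => //.
  - by apply: nearW => k; exact: sqi_cauchy_L.
  - exact: nearW.
  - by rewrite nrm_subxx; exact: cvg_cst.
apply: (cvg_unique (@Rhausdorff R) h); apply: cvg_near_cst; apply: nearW => k.
by rewrite ip_cst1 mean_cauchy_L.
Qed.

(** The inequalities for test functions are closed conditions in the graph norm. Along the semigroup
    they become the hypotheses of the decay argument. *)
Lemma cauchy_dom_energy f g : cauchy_dom n beta f g ->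
  [/\ 0 <= - ip f g, lambda * variance_of mu f <= - ip f g & lambda * - ip f g <= ip g g].
Proof.
move=> /cauchy_domP[sf sg [u ug]]; have [cu uf _] := ug.
have [h1 h2 h3] := graph_approx_ip sf sg sf sg ug ug.
have h2' : - ip (u k) (L (u k)) @[k --> \oo] --> - ip f g by exact: cvgN.
have e k : - ip (u k) (L (u k)) = dform beta (u k) (u k).
  by rewrite (dformE n2 beta_gt (cu k) (Cc_smooth (cu k))).
have hm : ip (u k) (fun=> 1) @[k --> \oo] --> ip f (fun=> 1).
  apply: (@cvg_nrm_ip _ _ _ mu _ _ _ u (fun=> fun=> 1)) => //.
  - by apply: nearW => k; exact: sqi_Cc.
  - exact: nearW.
  - by rewrite nrm_subxx; exact: cvg_cst.
split.
- by apply: (cvgr_to_ge h2'); apply: nearW => k; rewrite e dform_ge0.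
- rewrite variance_ip// -ip_cst1.
  apply: (ler_cvg_to (cvgM (cvg_cst lambda) (cvgB h1 (cvgM hm hm))) h2').
  apply: nearW => k; rewrite /= e; apply: le_trans (poincare_Cc n2 beta_gt beta_le (cu k)).
  by rewrite variance_ip//; [rewrite -ip_cst1 expr2|exact: sqi_Cc].
- apply: (ler_cvg_to (cvgM (cvg_cst lambda) h2') h3).
  by apply: nearW => k; rewrite /= e dform_le_L.
Qed.

Lemma spectral_gap_ge : (lambda%:E <= spectral_gap n beta)%E.
Proof.
apply: le_ereal_inf_tmp => _ [f [g [fg v0 ->]]]; rewrite lee_fin.
have [e0 e1 _] := cauchy_dom_energy fg.
have v1 : 0 < variance_of mu f.
  rewrite lt_def v0; apply: Rintegral_ge0 => x _; exact: sqr_ge0.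
rewrite ler_pdivlMr//; apply: le_trans e1 _.
have /cauchy_domP[sf sg _] := fg.
rewrite -[- ip f g]mulN1r -(ipZl _ sf sg) /ip.
by under eq_Rintegral do rewrite mulN1r.
Qed.

End closure.

(** * Weak derivatives on the domain *)

Lemma dominated_cvg_Rintegral d (T : measurableType d) (R : realType)
    (mu : {measure set T -> \bar R}) (u : nat -> T -> R) f g :
  (forall k, measurable_fun setT (u k)) -> measurable_fun setT f ->
  mu.-integrable setT (EFin \o g) -> (forall k x, `|u k x| <= g x) ->
  (forall x, u k x @[k --> \oo] --> (f x : R)) ->
  \int[mu]_x u k x @[k --> \oo] --> (\int[mu]_x f x : R).
Proof.
move=> mu_ mf ig ug uf.
have [|||||i1 _ c] := @dominated_convergence _ _ _ mu setT measurableT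
    (fun k x => (u k x)%:E) (fun x => (f x)%:E) (EFin \o g).
- by move=> k; apply/measurable_EFinP.
- exact/measurable_EFinP.
- by apply/aeW => x _; apply: cvg_EFin; [exact: nearW|exact: uf].
- exact: ig.
- by apply/aeW => x k _; rewrite lee_fin.
have fin := integrable_fin_num measurableT i1.
rewrite /Rintegral; apply: fine_cvg; rewrite fineK//.
Qed.

(** * The fundamental lemma of the calculus of variations *)

Section variational_lemma.
Context (R : realType) (n : nat).
Local Notation rV := 'rV[R]_n.
Local Notation lam := (@lebesgue_rV R n).
Implicit Types (h phi : rV -> R).

(** Since [theta 1] (k t) tends to the indicator of t > 0, these smooth functions tend to the
    indicator of t < b on ]-N, N[ while staying between 0 and 1 and supported in that interval. *)
Let bump (N b : R) (k : nat) (t : R) : R :=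
  theta 1 (k.+1%:R * (b - t)) * (theta 1 (k.+1%:R * (N - t)) * theta 1 (k.+1%:R * (t + N))).

Let theta01 (t : R) : 0 <= theta 1 t <= 1.
Proof.
rewrite /theta; case: ifPn => [t0|_]; last by rewrite lexx ler01.
rewrite hornerC mul1r expR_ge0/= -[leRHS]expR0 ler_expR oppr_le0 invr_ge0.
exact: ltW.
Qed.

Let theta_cvg (t : R) : theta 1 (k.+1%:R * t) @[k --> \oo] --> ((0 < t)%R%:R : R).
Proof.
have [t0|t0] := ltP 0 t; last first.
  apply: cvg_near_cst; apply: nearW => k; rewrite /theta ifF//.
  by apply/negbTE; rewrite -leNgt pmulr_rle0.
rewrite (_ : (fun k : nat => theta 1 (k.+1%:R * t)) = fun k : nat => expR (- (k.+1%:R^-1 * t^-1))).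
  rewrite -[X in _ --> X]expR0 -oppr0.
  apply: continuous_cvg; first exact: continuous_expR.
  apply: cvgN; rewrite -[X in _ --> X](mul0r t^-1); apply: cvgM; last exact: cvg_cst.
  exact: cvg_harmonic.
by apply/funext => k; rewrite /theta pmulr_rgt0// t0 hornerC mul1r invfM.
Qed.

Let smooth_bump N b k i : smooth (fun x : rV => bump N b k (coord i x)).
Proof.
have aff (c d : R) : smooth (fun x : rV => k.+1%:R * (c + d * coord i x)).
  exact: smoothZ (smoothD (@smooth_cst _ _ c) (smoothZ d (@smooth_coord _ _ i))).
have th (c d : R) := smooth_comp (@smooth1_theta R 1) (aff c d).
have := smoothM (th b (-1)) (smoothM (th N (-1)) (th N 1)).
congr smooth; apply/funext => x; rewrite /bump.
by rewrite !mulN1r mul1r [coord i x + N]addrC.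
Qed.

Let bump01 N b k t : 0 <= bump N b k t <= 1.
Proof.
have /andP[a a'] := theta01 (k.+1%:R * (b - t)).
have /andP[c c'] := theta01 (k.+1%:R * (N - t)).
have /andP[e e'] := theta01 (k.+1%:R * (t + N)).
rewrite /bump !mulr_ge0//=.
by rewrite mulr_ile1 ?mulr_ge0// mulr_ile1.
Qed.

Let bump_supp N b k t : bump N b k t != 0 -> - N < t < N.
Proof.
rewrite /bump !mulf_eq0 !negb_or /theta => /and3P[_].
case: ifPn => [|_]; last by rewrite eqxx.
case: ifPn => [|_]; last by rewrite eqxx.
rewrite !pmulr_rgt0// subr_gt0 => tN Nt _ _.
by rewrite Nt andbT -subr_gt0 opprK.
Qed.

Let bump_cvg N b t : bump N b k t @[k --> \oo] --> (((t < b) && (- N < t < N))%R%:R : R).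
Proof.
rewrite (_ : _%:R = (0 < b - t)%R%:R * ((0 < N - t)%R%:R * (0 < t + N)%R%:R)).
  by apply: cvgM; [|apply: cvgM]; exact: theta_cvg.
have -> : (0 < t + N) = (- N < t) by rewrite -[RHS]subr_gt0 opprK.
rewrite !subr_gt0; case: (t < b); case: (- N < t); case: (t < N) => //=;
by rewrite ?(mulr0, mul0r, mul1r).
Qed.

Lemma loc_integrable_bsupp h phi (C : R) : loc_integrable h -> measurable_fun setT phi ->
  (forall x, `|phi x| <= C) -> bsupp phi -> lam.-integrable setT (EFin \o (fun x => h x * phi x)).
Proof.
move=> [mh ih] mphi phiC [M hM].
have := ih _ (@compact_box R n M).
move=> /(integrable_mkcond _ (measurable_box _)).1 i1.
have i2 := @integrableZl _ _ _ lam setT measurableT C _ i1.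
apply: le_integrable i2 => //; first by apply/measurable_EFinP; exact: measurable_funM.
move=> x _; rewrite /= restrict_EFin -EFinM lee_fin/= !normrM mulrC.
have [->|/hM Bx] := eqVneq (phi x) 0; first by rewrite normr0 mul0r mulr_ge0.
rewrite patchE mem_set// ler_wpM2r//.
by apply: le_trans (phiC x) _; exact: ler_norm.
Qed.

(** Products of bumps show that h has zero integral over the part of each orthant inside a cube;
    Dynkin's lemma extends this to all measurable sets, which forces h = 0 almost everywhere on the
    cube. *)
Lemma loc_integrable_ae_eq0 h : loc_integrable h ->
  (forall phi, Cc_infty phi -> \int[lam]_x (h x * phi x) = 0) ->
  {ae lam, forall x, h x = 0}.
Proof.
move=> lh h0; have [mh _] := lh.
suff H (N : nat) : {ae lam, forall x : rV, (forall i, `|x ord0 i| < N%:R) -> h x = 0}.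
  have := ae_foralln H; apply: filterS => x hx.
  apply: (hx (Num.trunc (\sum_(i < n) `|x ord0 i|)).+1) => i.
  apply: le_lt_trans (truncnS_gt _).
  by rewrite (bigD1 i)//= lerDl sumr_ge0.
(* Truncation to a cube makes h integrable, and its absolute value then dominates in every limit
   below. *)
pose B := [set x : rV | forall i, - N%:R < x ord0 i < N%:R].
have mB : measurable B.
  rewrite (_ : B = [set x : rV | forall i, `](- N%:R), N%:R[%classic (x ord0 i)]).
    by apply: (@measurable_coords _ _ (fun=> `](- N%:R), N%:R[%classic)) => i.
  by apply/seteqP; split=> x Bx i; have := Bx i; rewrite /= in_itv.
pose hN x := h x * \1_B x.
have mhN : measurable_fun setT hN.
  by apply: measurable_funM => //; exact: measurable_indic.
have ihN : lam.-integrable setT (EFin \o hN).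
  apply: (@loc_integrable_bsupp h (\1_B) 1) => //.
    by move=> x; rewrite indicE; case: (_ \in _); rewrite ?normr1 ?normr0.
  exists N%:R => x; rewrite indicE pnatr_eq0 eqb0 negbK inE => Bx i.
  by rewrite ler_norml; have /andP[/ltW -> /ltW ->] := Bx i.
have ihA A : measurable A -> lam.-integrable setT (EFin \o (fun x => hN x * \1_A x)).
  move=> mA; apply: le_integrable ihN => //.
    by apply/measurable_EFinP; apply: measurable_funM => //; exact: measurable_indic.
  move=> x _; rewrite /= lee_fin normrM ler_piMr// indicE.
  by case: (_ \in _); rewrite ?normr1 ?normr0.
have ahN : lam.-integrable setT (EFin \o (fun x => `|hN x|)) by exact: (integrable_abse ihN).
have orth (b : rV) : \int[lam]_x (hN x * \1_[set x : rV | forall i, x ord0 i < b ord0 i] x) = 0.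
  pose ph k (x : rV) := \prod_(i < n) bump N%:R (b ord0 i) k (coord i x).
  have ph01 k x : 0 <= ph k x <= 1.
    apply/andP; split; first by apply: prodr_ge0 => i _; case/andP: (bump01 N%:R (b ord0 i) k (coord i x)).
    by apply: prodr_ile1 => i _; exact: bump01.
  have phB k x : ph k x != 0 -> B x.
    move=> /prodf_neq0 Hx i; exact: bump_supp (Hx i isT).
  have cph k : Cc_infty (ph k).
    apply/Cc_inftyP; split; first by apply: smooth_prod => i; exact: smooth_bump.
    by exists N%:R => x /phB Bx i; rewrite ler_norml; have /andP[/ltW -> /ltW ->] := Bx i.
  have hph k x : h x * ph k x = hN x * ph k x.
    rewrite /hN; have [->|/phB Bx] := eqVneq (ph k x) 0; first by rewrite !mulr0.
    by rewrite indicE mem_set// mulr1.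
  have c : \int[lam]_x (h x * ph k x) @[k --> \oo] -->
      \int[lam]_x (hN x * \1_[set x : rV | forall i, x ord0 i < b ord0 i] x).
    apply: (@dominated_cvg_Rintegral _ _ _ lam _ _ (fun x => `|hN x|)) => //.
    - move=> k; apply: measurable_funM => //; apply: continuous_measurable_rV.
      exact: smooth_continuous (Cc_smooth (cph k)).
    - by apply: measurable_funM => //; apply: measurable_indic; exact: measurable_orthant.
    - move=> k x; rewrite hph normrM ler_piMr//.
      by have /andP[p0 p1] := ph01 k x; rewrite ger0_norm.
    - move=> x; have -> : (fun k => h x * ph k x) = fun k => h x * (\1_B x * ph k x).
        by apply/funext => k; rewrite hph mulrA.
      rewrite -mulrA.
      apply: cvgM; first exact: cvg_cst.
      have : \1_B x * ph k x @[k --> \oo] --> \1_B x *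
          \prod_(i < n) (((x ord0 i < b ord0 i) && (- N%:R < x ord0 i < N%:R))%R%:R : R).
        apply: cvgM; first exact: cvg_cst.
        apply: cvg_big => [|i _]; last exact: bump_cvg.
        exact: mul_continuous.
      rewrite [X in _ --> X -> _](_ : _ = \1_B x * \1_[set x : rV | forall i, x ord0 i < b ord0 i] x)//.
      rewrite [\1_B x]indicE; have [|] := boolP (x \in B); last by rewrite !mul0r.
      rewrite inE => Bx; rewrite !mul1r indicE.
      have [|/negP ox] := boolP (x \in _).
        by rewrite inE/= => ox; rewrite big1// => i _; rewrite ox; have := Bx i => ->.
      have /existsNP[i /negP/negbTE xi] : ~ forall i, x ord0 i < b ord0 i by move: ox; rewrite inE.
      by rewrite (bigD1 i)//= xi mul0r.
  apply: (cvg_unique (@Rhausdorff R) c); apply: cvg_near_cst; apply: nearW => k.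
  exact: h0.
have all0 A : measurable A -> \int[lam]_x (hN x * \1_A x) = 0.
  move=> mA; suff [] : measurable A /\ \int[lam]_x (hN x * \1_A x) = 0 by [].
  apply: (@orthant_dynkin _ _ (fun A => measurable A /\ \int[lam]_x (hN x * \1_A x) = 0)) => //.
    split.
    - by move=> C _.
    - split=> //; rewrite -(orth (\row_(i < n) N%:R)); apply: eq_Rintegral => x _.
      rewrite /hN [\1_B x]indicE; have [|] := boolP (x \in B); last by rewrite !(mulr0, mul0r).
      rewrite inE => Bx; congr (_ * _); rewrite !indicE !mem_set//= => i.
      by rewrite mxE; have /andP[] := Bx i.
    - move=> C D DC [mC C0] [mD D0]; split; first exact: measurableD.
      rewrite -[RHS](subrr 0) -{1}C0 -D0 -RintegralB//; [|exact: ihA|exact: ihA].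
      apply: eq_Rintegral => x _; rewrite -mulrBr; congr (_ * _); rewrite !indicE.
      have [YD|/negP YD] := boolP (x \in D); have [YC|/negP YC] := boolP (x \in C).
      + by rewrite memNset ?subrr// => -[_]; rewrite inE in YD.
      + by move: YD YC; rewrite !inE => /DC.
      + by rewrite mem_set ?subr0//; split; [move: YC|move: YD]; rewrite inE.
      + by rewrite memNset ?subr0// => -[YC' _]; apply: YC; rewrite inE.
    - move=> F ndF F0; have mF : measurable (\bigcup_k F k).
        by apply: bigcup_measurable => k _; exact: (F0 k).1.
      split=> //.
      have c : \int[lam]_x (hN x * \1_(F k) x) @[k --> \oo] --> \int[lam]_x (hN x * \1_(\bigcup_k F k) x).
        apply: (@dominated_cvg_Rintegral _ _ _ lam _ _ (fun x => `|hN x|)) => //.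
        + by move=> k; apply: measurable_funM => //; apply: measurable_indic; exact: (F0 k).1.
        + by apply: measurable_funM => //; exact: measurable_indic.
        + move=> k x; rewrite normrM ler_piMr// indicE.
          by case: (_ \in _); rewrite ?normr1 ?normr0.
        + move=> x; apply: cvgM; first exact: cvg_cst.
          have [[k _ FkY]|nF] := pselect ((\bigcup_k F k) x).
            apply: cvg_near_cst; exists k => // j /= kj.
            rewrite !indicE !mem_set//; first by exists k.
            by move: FkY; exact/subsetPset/ndF.
          apply: cvg_near_cst; exists 0%N => // j _.
          by rewrite !indicE !memNset// => Fj; apply: nF; exists j.
      apply: (cvg_unique (@Rhausdorff R) c); apply: cvg_near_cst; apply: nearW => k.
      exact: (F0 k).2.
  by move=> b; split; [exact: measurable_orthant|exact: orth].
have ae0 : ae_eq lam setT (EFin \o hN) (fun=> 0%E).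
  apply: integral_ae_eq => //.
  move=> E _ mE; rewrite integral0.
  have := congr1 EFin (all0 _ mE); rewrite /Rintegral fineK; last first.
    exact: integrable_fin_num (ihA _ mE).
  move=> E0; apply: etrans E0; rewrite integral_mkcond; apply: eq_integral => x _.
  rewrite patchE indicE; case: ifP => xE; first by rewrite mulr1.
  by rewrite mulr0.
apply: filterS ae0 => x /(_ I) [hx] xN; move: hx; rewrite /hN indicE mem_set ?mulr1//.
by move=> i; rewrite -ltr_norml.
Qed.

Lemma is_weak_partial_uniq i f g g' : is_weak_partial i f g -> is_weak_partial i f g' ->
  {ae lam, forall x, g x = g' x}.
Proof.
move=> [lf [mg ig] fg] [_ [mg' ig'] fg'].
have lD : loc_integrable (fun x => g x - g' x).
  split=> [|K cK]; first exact: measurable_funB.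
  have mK := compact_measurable_rV cK.
  exact: (integrableB mK (ig K cK) (ig' K cK)).
have : {ae lam, forall x, g x - g' x = 0}.
  apply: loc_integrable_ae_eq0 => // phi cphi.
  have gi (u : rV -> R) : loc_integrable u -> lam.-integrable setT (EFin \o (fun x => u x * phi x)).
    have [C _ hC] := continuous_bounded_bsupp (smooth_continuous (Cc_smooth cphi)) (Cc_bsupp cphi).
    move=> lu; apply: loc_integrable_bsupp lu _ hC (Cc_bsupp cphi).
    exact: smooth_measurable (Cc_smooth cphi).
  under eq_Rintegral do rewrite mulrBl.
  rewrite RintegralB//; [|exact: gi|exact: gi].
  by apply/eqP; rewrite subr_eq0 -eqr_opp -fg// -fg'.
by apply: filterS => x /eqP; rewrite subr_eq0 => /eqP.
Qed.

End variational_lemma.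

(** * Weak derivatives and the quadratic form on the domain of L *)

Section weak_derivatives.
Context (R : realType) (n : nat) (beta : R).
Hypothesis n2 : (2 <= n)%N.
Hypothesis beta_gt : n%:R / 2 < beta.
Hypothesis beta_le : beta <= n%:R / 2 + 2.
Local Notation rV := 'rV[R]_n.
Local Notation mu := (@cauchy_measure R n beta).
Local Notation lam := (@lebesgue_rV R n).
Local Notation L := (cauchy_L beta).
Local Notation sqi := (sqi mu).
Local Notation nrm := (nrm mu).
Local Notation ip := (ip mu).
Implicit Types (f g h phi : rV -> R).

Let n0 : (0 < n)%N. Proof. exact: ltn_trans n2. Qed.

(** The reciprocal of the density. It turns a Lebesgue pairing with a test function into an inner
    product of L^2(mu) with another test function. *)
Definition inv_pdf (x : rV) : R := cauchy_Z n beta * omega x `^ beta.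

Let Cc_inv_pdf phi : Cc_infty phi -> Cc_infty (fun x => inv_pdf x * phi x).
Proof.
move=> cphi; apply: CcMr cphi _.
exact: smoothM (@smooth_cst _ _ _) (@smooth_omega_pow _ _ _).
Qed.

Let inv_pdfE (x : rV) : inv_pdf x * cauchy_pdf beta x = 1.
Proof.
have Z0 : cauchy_Z n beta != 0 by rewrite gt_eqF// cauchy_Z_gt0.
rewrite /inv_pdf /cauchy_pdf mulrACA divff// mul1r -powRD ?subrr ?powRr0//.
by rewrite (gt_eqF (omega_gt0 x)) implybT.
Qed.

Lemma Rintegral_Cc_ip h phi : sqi h -> Cc_infty phi ->
  \int[lam]_x (h x * phi x) = ip h (fun x => inv_pdf x * phi x).
Proof.
move=> sh cphi; have cp := Cc_inv_pdf cphi.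
rewrite /ip cauchy_Rintegral_density//; last first.
  by apply: measurable_funM sh.1 _; exact: smooth_measurable (Cc_smooth cp).
apply: eq_Rintegral => x _; have := inv_pdfE x.
by move: (inv_pdf x) (cauchy_pdf beta x) => a b ab; rewrite -[LHS]mulr1 -ab; ring.
Qed.

(** On a compact set the density is bounded below, so integrability against the Cauchy measure gives
    integrability against Lebesgue measure. *)
Lemma sqi_loc_integrable h : sqi h -> loc_integrable h.
Proof.
move=> sh; split; first exact: sh.1.
move=> K cK; have mK := compact_measurable_rV cK.
have sp : smooth inv_pdf by exact: smoothM (@smooth_cst _ _ _) (@smooth_omega_pow _ _ _).
have [C [_ hC]] : bounded_set (inv_pdf @` K).
  apply: compact_bounded; apply: continuous_compact => //.
  by apply: continuous_subspaceT; exact: smooth_continuous.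
have := (cauchy_integrable_density beta sh.1).1 (sqi_integrable n2 beta_gt sh).
move=> /(integrableS measurableT mK (@subsetT _ _)) iK.
have iCK := @integrableZl _ _ _ lam K mK (C + 1) _ iK.
apply: le_integrable iCK => //.
  by apply/measurable_EFinP; exact: measurable_funTS sh.1.
move=> x Kx; have e : h x = inv_pdf x * (h x * cauchy_pdf beta x).
  by rewrite mulrCA inv_pdfE mulr1.
rewrite /= lee_fin {1}e [leLHS]normrM [leRHS]normrM ler_wpM2r//; apply: le_trans (ler_norm _).
by apply: (hC (C + 1)); [rewrite ltrDl|exists x].
Qed.

(** Weak differentiation is closed: both sides of the integration by parts of u_k against a test
    function are inner products in L^2(mu), and pass to the limit. *)
Lemma weak_partial_cvg i f g (u : nat -> rV -> R) : sqi f -> sqi g ->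
  (forall k, Cc_infty (u k)) ->
  nrm (fun x => u k x - f x) @[k --> \oo] --> (0 : R) ->
  nrm (fun x => partial i (u k) x - g x) @[k --> \oo] --> (0 : R) ->
  is_weak_partial i f g.
Proof.
move=> sf sg cu uf ug; split; [exact: sqi_loc_integrable..|] => phi cphi.
have cdphi := Cc_partial i cphi.
rewrite (Rintegral_Cc_ip sf cdphi) (Rintegral_Cc_ip sg cphi).
have cpu k := Cc_partial i (cu k).
have key (v : nat -> rV -> R) w psi : sqi w -> (forall k, Cc_infty (v k)) -> Cc_infty psi ->
    nrm (fun x => v k x - w x) @[k --> \oo] --> (0 : R) ->
    ip (v k) (fun x => inv_pdf x * psi x) @[k --> \oo] --> ip w (fun x => inv_pdf x * psi x).
  move=> sw cv cpsi vw; have spsi := sqi_Cc n2 beta_gt (Cc_inv_pdf cpsi).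
  apply: (@cvg_nrm_ip _ _ _ mu _ _ _ v (fun=> fun x => inv_pdf x * psi x)) => //.
  - by apply: nearW => k; exact: sqi_Cc.
  - exact: nearW.
  - by rewrite nrm_subxx; exact: cvg_cst.
have c1 := key _ _ _ sf cu cdphi uf.
have c2 : - ip (partial i (u k)) (fun x => inv_pdf x * phi x) @[k --> \oo] -->
    - ip g (fun x => inv_pdf x * phi x) by apply: cvgN; exact: key _ _ _ sg cpu cphi ug.
suff e : (fun k => ip (u k) (fun x => inv_pdf x * partial i phi x)) =
    fun k => - ip (partial i (u k)) (fun x => inv_pdf x * phi x).
  by rewrite e in c1; exact: (cvg_unique (@Rhausdorff R) c1 c2).
apply/funext => k.
rewrite -(Rintegral_Cc_ip (sqi_Cc n2 beta_gt (cu k)) cdphi).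
rewrite -(Rintegral_Cc_ip (sqi_Cc n2 beta_gt (cpu k)) cphi).
have su := Cc_smooth (cu k); have sphi := Cc_smooth cphi.
have cM := CcMl (cu k) sphi.
have := Cc_integral_partial0 i cM.
have e x : partial i (fun x => u k x * phi x) x = u k x * partial i phi x + partial i (u k) x * phi x.
  by rewrite (partialM _ _ su sphi) [phi x * _]mulrC.
under eq_Rintegral do rewrite e.
have iC (w : rV -> R) : Cc_infty w -> lam.-integrable setT (EFin \o w).
  by move=> cw; apply: integrable_bsupp; [exact: smooth_continuous (Cc_smooth cw)|exact: Cc_bsupp].
rewrite RintegralD//; [|exact: iC (CcMr cdphi su)|exact: iC (CcMr cphi (Cc_smooth (cpu k)))].
by move/eqP; rewrite addr_eq0 => /eqP.
Qed.

Lemma weak_partialE i f g : is_weak_partial i f g ->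
  is_weak_partial i f (weak_partial i f) /\ {ae mu, forall x, weak_partial i f x = g x}.
Proof.
move=> fg; have : [set h | is_weak_partial i f h] (weak_partial i f) by apply: xgetPex; exists g.
move=> fw; split=> //; apply: ae_lebesgue_cauchy; exact: is_weak_partial_uniq fw fg.
Qed.

Lemma is_weak_partial_ae i f f' g : is_weak_partial i f g -> loc_integrable f' ->
  {ae lam, forall x, f x = f' x} -> is_weak_partial i f' g.
Proof.
move=> [lf lg fg] lf' ff'; split=> // phi cphi; rewrite -(fg _ cphi).
have mphi := smooth_measurable (Cc_smooth (Cc_partial i cphi)).
rewrite /Rintegral; congr fine; apply: ae_eq_integral => //.
- by apply/measurable_EFinP; exact: measurable_funM lf'.1 mphi.
- by apply/measurable_EFinP; exact: measurable_funM lf.1 mphi.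
- by apply: filterS ff' => x -> _.
Qed.

Let eps : R := n%:R / 2 + 2 - beta.

Let eps_ge0 : 0 <= eps. Proof. by rewrite /eps; move: beta_le; lra. Qed.

Let K_ge0 (a b : R) : 2 <= a ->
  0 <= (a - 2) * (4 * b ^+ 2 - 4 * (a - 2) * b + (a + 2) ^+ 2) / (8 * (a - 1)).
Proof.
by move=> a2; apply: divr_ge0; [apply: mulr_ge0; [lra|have := sqr_ge0 (2 * b - (a - 2)); nra]|lra].
Qed.

(** With S and T the square norm and the trace of the matrix in the form, n/(n-1) >= 1 >= 1/(n-1)
    gives S <= Q + T^2. The trace T is L u plus a multiple of x.g, and (x.g)^2 <= omega |g|^2;
    removing the tensor part from the matrix costs another multiple of omega |g|^2. *)
Lemma hess_bound (x g : rV) (H : 'M[R]_n) i j :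
  (omega x * H i j) ^+ 2 <= 2 * gamma2_form beta x g H +
    4 * (omega x * (\sum_(k < n) H k k) - 2 * (beta - 1) * (\sum_(k < n) x ord0 k * g ord0 k)) ^+ 2 +
    (4 * (2 * (beta - 1) + eps) ^+ 2 + 2 * eps ^+ 2) * (omega x * \sum_(k < n) g ord0 k ^+ 2).
Proof.
have n1 : 0 < n%:R - 1 :> R by rewrite subr_gt0 ltr1n.
have n2' : 2 <= n%:R :> R by rewrite (ler_nat _ 2).
have CS (a b : 'I_n -> R) : (\sum_i a i * b i) ^+ 2 <= (\sum_i a i ^+ 2) * (\sum_i b i ^+ 2).
  exact: sum_CauchySchwarz.
have term (a : 'I_n -> R) k : a k ^+ 2 <= \sum_i a i ^+ 2.
  by rewrite (bigD1 k)//= lerDl sumr_ge0// => l _; exact: sqr_ge0.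
have r_le : \sum_(k < n) x ord0 k ^+ 2 <= omega x by rewrite omegaE lerDr.
pose A := \sum_(k < n) g ord0 k ^+ 2.
have A0 : 0 <= A by apply: sumr_ge0 => k _; exact: sqr_ge0.
pose m k l := omega x * H k l + eps / 2 * (g ord0 k * x ord0 l + x ord0 k * g ord0 l).
pose S := \sum_(k < n) \sum_(l < n) m k l ^+ 2.
have S0 : 0 <= S by apply: sumr_ge0 => k _; apply: sumr_ge0 => l _; exact: sqr_ge0.
pose B := \sum_(k < n) x ord0 k * g ord0 k.
have BA : B ^+ 2 <= omega x * A.
  by apply: le_trans (CS _ _) _; rewrite ler_wpM2r.
pose T := \sum_(k < n) (omega x * H k k + eps * (g ord0 k * x ord0 k)).
pose l := omega x * (\sum_(k < n) H k k) - 2 * (beta - 1) * B.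
have TE : T = l + (2 * (beta - 1) + eps) * B.
  rewrite /T big_split/= -!mulr_sumr.
  have -> : \sum_(k < n) g ord0 k * x ord0 k = B by apply: eq_bigr => k _; rewrite mulrC.
  by rewrite /l; ring.
have QS : S <= gamma2_form beta x g H + T ^+ 2.
  rewrite gamma2_formE -/eps -/A -/S -/T.
  have K0 : 0 <= (n%:R - 2) * (4 * (beta - 1) ^+ 2 - 4 * (n%:R - 2) * (beta - 1) + (n%:R + 2) ^+ 2) /
      (8 * (n%:R - 1)) * (\sum_(i < n) \sum_(j < n) (g ord0 i * x ord0 j) ^+ 2 -
         (\sum_(i < n) g ord0 i * x ord0 i) ^+ 2).
    apply: mulr_ge0; last by rewrite sum_mul_sqr subr_ge0.
    exact: K_ge0.
  have e0 : 0 <= eps * (beta + n%:R / 2) * A.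
    by rewrite !mulr_ge0// addr_ge0 ?divr_ge0// ltW// (lt_trans ltr01 (beta_gt1 n2 beta_gt)).
  have S1 : S <= n%:R / (n%:R - 1) * S.
    by rewrite ler_peMl// ler_pdivlMr// mul1r; lra.
  have T1 : 1 / (n%:R - 1) * T ^+ 2 <= T ^+ 2.
    by rewrite ler_piMl ?sqr_ge0// ler_pdivrMr// mul1r; lra.
  by lra.
have mS : m i j ^+ 2 <= S.
  apply: le_trans (term (m i) j) _; rewrite /S [leRHS](bigD1 i)//= lerDl sumr_ge0// => k _.
  by apply: sumr_ge0 => k' _; exact: sqr_ge0.
have gx k k' : (g ord0 k * x ord0 k') ^+ 2 <= omega x * A.
  rewrite exprMn mulrC.
  have h1 := le_trans (term (fun k => x ord0 k) k') r_le.
  exact: ler_pM (sqr_ge0 _) (sqr_ge0 _) h1 (term (fun k => g ord0 k) k).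
have HE : omega x * H i j = m i j - eps / 2 * (g ord0 i * x ord0 j + x ord0 i * g ord0 j).
  by rewrite /m; ring.
rewrite -/A -/B -/l HE; have := gx i j; have := gx j i.
rewrite [g ord0 j * x ord0 i]mulrC.
move: (g ord0 i * x ord0 j) (x ord0 i * g ord0 j) => p q h2 h1.
have step1 : (m i j - eps / 2 * (p + q)) ^+ 2 <= 2 * m i j ^+ 2 + eps ^+ 2 * (p ^+ 2 + q ^+ 2).
  have := sqr_ge0 (m i j + eps / 2 * (p + q)); have := sqr_ge0 (eps * (p - q)).
  by move: (m i j) => M; lra.
have step2 : eps ^+ 2 * (p ^+ 2 + q ^+ 2) <= 2 * eps ^+ 2 * (omega x * A).
  by have := sqr_ge0 eps; nra.
have step3 : T ^+ 2 <= 2 * l ^+ 2 + 2 * (2 * (beta - 1) + eps) ^+ 2 * (omega x * A).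
  rewrite TE; have := sqr_ge0 (l - (2 * (beta - 1) + eps) * B).
  have := ler_wpM2l (sqr_ge0 (2 * (beta - 1) + eps)) BA.
  by move: (2 * (beta - 1) + eps) => c; lra.
apply: le_trans step1 _; have := sqr_ge0 eps; have := sqr_ge0 (2 * (beta - 1) + eps).
move: (2 * (beta - 1) + eps) step3 => c step3.
by lra.
Qed.

Definition wgrad i u (x : rV) := omega x `^ 2^-1 * partial i u x.
Definition whess i j u (x : rV) := omega x * partial i (partial j u) x.

Lemma Cc_wgrad i u : Cc_infty u -> Cc_infty (wgrad i u).
Proof. by move=> cu; exact: CcMr (Cc_partial i cu) (@smooth_omega_pow _ _ _). Qed.

Lemma Cc_whess i j u : Cc_infty u -> Cc_infty (whess i j u).
Proof. by move=> cu; exact: CcMr (Cc_partial i (Cc_partial j cu)) (@smooth_omega _ _). Qed.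

Let wE (x : rV) : omega x `^ 2^-1 ^+ 2 = omega x.
Proof.
by rewrite -powR_mulrn ?powR_ge0// -powRrM mulVf// powRr1// ltW// omega_gt0.
Qed.

Let gdotE u (x : rV) : gdot u u x = \sum_(k < n) grad u x ord0 k ^+ 2.
Proof.
Transparent gdot.
by apply: eq_bigr => i _; rewrite mxE expr2.
Qed.
Opaque gdot.

Let iCc u : Cc_infty u -> mu.-integrable setT (EFin \o u).
Proof. by move=> cu; exact: sqi_integrable (sqi_Cc n2 beta_gt cu). Qed.

Let CcX2 u : Cc_infty u -> Cc_infty (fun x : rV => u x ^+ 2).
Proof. by move=> cu; under eq_fun do rewrite expr2; exact: CcMl cu (Cc_smooth cu). Qed.

Lemma ip_wgrad i u : Cc_infty u -> ip (wgrad i u) (wgrad i u) <= - ip u (L u).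
Proof.
move=> cu; rewrite -(dformE n2 beta_gt cu (Cc_smooth cu)) /dform.
have cw := CcX2 (Cc_wgrad i cu).
have -> : ip (wgrad i u) (wgrad i u) = \int[mu]_x (wgrad i u x ^+ 2).
  by apply: eq_Rintegral => x _; rewrite expr2.
apply: le_Rintegral => //; [exact: iCc|exact: iCc (Cc_dform cu (Cc_smooth cu))|].
move=> x _; rewrite /wgrad exprMn wE ler_wpM2l//; first exact/ltW/omega_gt0.
rewrite gdotE (bigD1 i)//= mxE lerDl sumr_ge0// => j _; exact: sqr_ge0.
Qed.

Let C0 := 4 * (2 * (beta - 1) + eps) ^+ 2 + 2 * eps ^+ 2.
Let C0_ge0 : 0 <= C0. Proof. by rewrite addr_ge0// mulr_ge0// sqr_ge0. Qed.

(** Integration of [hess_bound]: twice int Q <= |L u|^2 and four times |L u|^2 add up to the factor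
    6. *)
Lemma ip_whess i j u : Cc_infty u ->
  ip (whess i j u) (whess i j u) <= 6 * ip (L u) (L u) + C0 * - ip u (L u).
Proof.
move=> cu; have su := Cc_smooth cu; have cL := Cc_cauchy_L beta cu.
have dE := dformE n2 beta_gt cu su.
have d0 := dform_ge0 beta u.
have cw := CcX2 (Cc_whess i j cu).
have -> : ip (whess i j u) (whess i j u) = \int[mu]_x (whess i j u x ^+ 2).
  by apply: eq_Rintegral => x _; rewrite expr2.
pose Q x := gamma2_form beta x (grad u x) (hess u x).
have cQ : Cc_infty Q by apply/Cc_inftyP; split; [exact: smooth_gamma2|exact: bsupp_gamma2].
have iQ : mu.-integrable setT (EFin \o (fun x => 2 * Q x)) by apply: iCc; exact: CcZ.
have iL : mu.-integrable setT (EFin \o (fun x => 4 * (L u x ^+ 2))) by apply: iCc; apply: CcZ; exact: CcX2.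
have iD : mu.-integrable setT (EFin \o (fun x => C0 * (omega x * gdot u u x))).
  by apply: iCc; apply: CcZ; exact: Cc_dform.
have iQL : mu.-integrable setT (EFin \o (fun x => 2 * Q x + 4 * (L u x ^+ 2))).
  exact: (integrableD measurableT iQ iL).
have iT : mu.-integrable setT (EFin \o (fun x => 2 * Q x + 4 * (L u x ^+ 2) + C0 * (omega x * gdot u u x))).
  exact: (integrableD measurableT iQL iD).
apply: (@le_trans _ _ (\int[mu]_x (2 * Q x + 4 * (L u x ^+ 2) + C0 * (omega x * gdot u u x)))).
  apply: le_Rintegral => //; first exact: iCc.
  move=> x _; have := hess_bound x (grad u x) (hess u x) i j.
  rewrite -gdotE -/(Q x) /whess [hess u x i j]mxE => /le_trans; apply.
  rewrite lerD2r lerD2l ler_wpM2l//.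
rewrite RintegralD// RintegralD// !RintegralZl//; first last.
- exact: iCc cQ.
- exact: iCc (CcX2 cL).
- exact: iCc (Cc_dform cu su).
rewrite (integral_gamma2 n2 beta_gt cu) -/(dform beta u u).
have -> : \int[mu]_x (L u x ^+ 2) = ip (L u) (L u) by apply: eq_Rintegral => x _; rewrite expr2.
have l0 : 0 <= (beta - n%:R / 2) ^+ 2 by exact: sqr_ge0.
by rewrite -dE; have := mulr_ge0 l0 d0; lra.
Qed.


Lemma nrm_le f g : measurable_fun setT f -> (forall x, `|f x| <= `|g x|) -> sqi g ->
  nrm f <= nrm g.
Proof.
move=> mf fg sg; have sf := le_sqi mf fg sg.
rewrite ler_wsqrtr//; apply: le_Rintegral => //.
- exact: (sqi_integrableM sf sf).
- exact: (sqi_integrableM sg sg).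
- by move=> x _; rewrite -!expr2 -(real_normK (num_real (f x))) -(real_normK (num_real (g x))) lerXn2r ?nnegrE.
Qed.

(** Maps that are additive and bounded in the graph norm on test functions, hence extend to the
    domain. The term - <u, L u> is the energy and is bounded by |u| |L u|. *)
Definition graph_bounded (F : (rV -> R) -> rV -> R) := exists2 C, 0 <= C &
  [/\ forall u, Cc_infty u -> sqi (F u),
      forall u v (x : rV), Cc_infty u -> Cc_infty v -> F (fun y => u y - v y) x = F u x - F v x &
      forall u, Cc_infty u -> ip (F u) (F u) <= C * (ip (L u) (L u) - ip u (L u))].

Lemma cauchy_LB u v (x : rV) : Cc_infty u -> Cc_infty v ->
  L (fun y => u y - v y) x = L u x - L v x.
Proof.
move=> cu cv; have cv' := CcZ (-1) cv.
have -> : (fun y => u y - v y) = (fun y => u y + -1 * v y) by apply/funext => y; rewrite mulN1r.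
rewrite (cauchy_LD _ _ (Cc_smooth cu) (Cc_smooth cv')) (cauchy_LZ _ _ _ (Cc_smooth cv)).
by rewrite mulN1r.
Qed.

Lemma cvg_nrm_cauchy f (u : nat -> rV -> R) : sqi f -> (forall k, sqi (u k)) ->
  nrm (fun x => u k x - f x) @[k --> \oo] --> (0 : R) ->
  forall e, 0 < e -> exists N, forall m k, (N <= m)%N -> (N <= k)%N ->
    nrm (fun x => u m x - u k x) <= e.
Proof.
move=> sf su uf e e0; have e20 : 0 < e / 2 by rewrite divr_gt0.
have [N _ hN] : \forall k \near \oo, nrm (fun x => u k x - f x) < e / 2.
  exact: cvgr_lt uf _ e20.
exists N => m k Nm Nk; apply: le_trans (nrm_triangle (su m) sf (su k)) _.
by rewrite [in X in _ + X <= _]nrmBC (splitr e) lerD// ltW//; apply: hN.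
Qed.

Let graph_bounded_arith (C a b c q d : R) : 0 <= C -> - (a * b) <= q -> 0 < d -> a <= d -> b <= d ->
  0 <= a -> 0 <= b -> 0 <= c -> c ^+ 2 <= C * (b ^+ 2 - q) -> c <= d * (C + C + 1).
Proof.
move=> C1 CS d0 ad bd a0 b0 c0 h; have d1 := ltW d0.
have h1 : b ^+ 2 - q <= 2 * d ^+ 2 by nra.
have h2 := ler_wpM2l C1 h1; rewrite -ler_sqr ?nnegrE ?mulr_ge0 ?addr_ge0//.
apply: le_trans h _; apply: le_trans h2 _; rewrite exprMn mulrCA mulrA [leRHS]mulrC.
rewrite -subr_ge0 -mulrBl mulr_ge0 ?sqr_ge0//; nra.
Qed.

Lemma graph_bounded_cvg F f g u : graph_bounded F -> sqi f -> sqi g ->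
  graph_approx beta f g u -> exists2 h, sqi h & nrm (fun x => F (u k) x - h x) @[k --> \oo] --> (0 : R).
Proof.
move=> [C C0' [sF linF hF]] sf sg [cu uf ug].
have su k := sqi_Cc n2 beta_gt (cu k); have sLu k := sqi_cauchy_L n2 beta_gt (cu k).
apply: L2_complete => [k|e e0]; first exact: sF.
(* If |u| and |L u| are at most d for the difference u of two approximants, then |F u|^2 <= 2 C d^2
   <= ((2 C + 1) d)^2. *)
pose d := e / (C + C + 1).
have C1 : 0 < C + C + 1 by rewrite ltr_wpDl// addr_ge0.
have d0 : 0 < d by rewrite divr_gt0.
have [N1 h1] := cvg_nrm_cauchy sf su uf d0; have [N2 h2] := cvg_nrm_cauchy sg sLu ug d0.
exists (maxn N1 N2) => m k; rewrite !geq_max => /andP[m1 m2] /andP[k1 k2].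
have cB := CcB (cu m) (cu k); have sB := sqi_Cc n2 beta_gt cB.
have -> : (fun x => F (u m) x - F (u k) x) = F (fun y => u m y - u k y).
  by apply/funext => x; rewrite linF.
have {}h1 := h1 _ _ m1 k1; have {}h2 := h2 _ _ m2 k2.
have LE : L (fun y => u m y - u k y) = fun x => L (u m) x - L (u k) x.
  by apply/funext => x; rewrite cauchy_LB.
rewrite -LE in h2; have := hF _ cB.
have sLB := sqi_cauchy_L n2 beta_gt cB.
have := CauchySchwarz sB sLB; rewrite -!sqr_nrm ler_norml => /andP[CS _].
have a0 := nrm_ge0 mu (fun y => u m y - u k y).
have b0 := nrm_ge0 mu (L (fun y => u m y - u k y)).
have c0 := nrm_ge0 mu (F (fun y => u m y - u k y)).
have ed : e = d * (C + C + 1) by rewrite divfK// gt_eqF.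
move: CS h1 h2 a0 b0 c0; move: (ip _ _) (nrm (L _)) (nrm (F _)) (nrm _) => q b c a CS.
rewrite ed => h1 h2 a0 b0 c0; exact: (graph_bounded_arith C0' CS d0 h1 h2 a0 b0 c0).
Qed.

Lemma graph_bounded_wgrad i : graph_bounded (wgrad i).
Proof.
exists 1 => //; split=> [u cu|u v x cu cv|u cu].
- exact: sqi_Cc (Cc_wgrad i cu).
- by rewrite /wgrad (partialB _ _ (Cc_smooth cu) (Cc_smooth cv)) mulrBr.
- rewrite mul1r; apply: le_trans (ip_wgrad i cu) _.
  by rewrite lerDr ip_ge0.
Qed.

Let whess_arith (c X Y : R) : 0 <= c -> 0 <= X -> 0 <= Y -> 6 * X + c * Y <= (6 + c) * (X + Y).
Proof. by nra. Qed.

Lemma graph_bounded_whess i j : graph_bounded (whess i j).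
Proof.
exists (6 + C0) => [|]; first exact: addr_ge0.
split=> [u cu|u v x cu cv|u cu].
- exact: sqi_Cc (Cc_whess i j cu).
- rewrite /whess; have -> : partial j (fun y => u y - v y) = fun y => partial j u y - partial j v y.
    by apply/funext => y; exact: partialB (Cc_smooth cu) (Cc_smooth cv).
  have pu := Cc_smooth (Cc_partial j cu); have pv := Cc_smooth (Cc_partial j cv).
  by rewrite (partialB _ _ pu pv) mulrBr.
- apply: le_trans (ip_whess i j cu) _.
  have h1 := ip_ge0 mu (L u); have h2 : 0 <= - ip u (L u).
    by rewrite -(dformE n2 beta_gt cu (Cc_smooth cu)) dform_ge0.
  exact: whess_arith.
Qed.

Definition cvgL2 (v : nat -> rV -> R) w := [/\ forall k, sqi (v k), sqi w &
  nrm (fun x => v k x - w x) @[k --> \oo] --> (0 : R)].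

(** Convergence of integrals together with integrability. It is stable under linear combinations and
    holds for squares of L^2-convergent sequences, which is all that a quadratic form needs. *)
Definition cvgI (v : nat -> rV -> R) w := [/\ forall k, mu.-integrable setT (EFin \o v k),
  mu.-integrable setT (EFin \o w) & \int[mu]_x v k x @[k --> \oo] --> \int[mu]_x w x].

Lemma cvgL2D v w v' w' : cvgL2 v w -> cvgL2 v' w' ->
  cvgL2 (fun k x => v k x + v' k x) (fun x => w x + w' x).
Proof.
move=> [sv sw vw] [sv' sw' vw']; split; [by move=> k; exact: sqiD|exact: sqiD|].
apply: (@squeeze_cvgr _ _ _ _ (fun=> 0) (fun k => nrm (fun x => v k x - w x) + nrm (fun x => v' k x - w' x))).
- apply: nearW => k; rewrite nrm_ge0/=.
  have -> : (fun x : rV => v k x + v' k x - (w x + w' x)) =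
      fun x => (v k x - w x) + (v' k x - w' x) by apply/funext => x; ring.
  exact: nrmD (sqiB (sv k) sw) (sqiB (sv' k) sw').
- exact: cvg_cst.
- by rewrite -[X in _ --> X]addr0; exact: cvgD.
Qed.

Lemma cvgL2M (b : rV -> R) v w : measurable_fun setT b -> (forall x, `|b x| <= 1) -> cvgL2 v w ->
  cvgL2 (fun k x => b x * v k x) (fun x => b x * w x).
Proof.
move=> mb b1 [sv sw vw].
have H h : sqi h -> sqi (fun x => b x * h x) /\ nrm (fun x => b x * h x) <= nrm h.
  move=> sh; have mbh := measurable_funM mb sh.1.
  have bh (x : rV) : `|b x * h x| <= `|h x| by rewrite normrM ler_piMl.
  by split; [exact: le_sqi sh|exact: nrm_le].
split=> [k||]; [exact: (H _ (sv k)).1|exact: (H _ sw).1|].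
apply: (@squeeze_cvgr _ _ _ _ (fun=> 0) (fun k => nrm (fun x => v k x - w x))) => //.
- apply: nearW => k; rewrite nrm_ge0/=.
  under [in X in nrm X]eq_fun do rewrite -mulrBr.
  exact: (H _ (sqiB (sv k) sw)).2.
- exact: cvg_cst.
Qed.

Lemma cvgL2Z c v w : cvgL2 v w -> cvgL2 (fun k x => c * v k x) (fun x => c * w x).
Proof.
move=> [sv sw vw]; split; [by move=> k; exact: sqiZ|exact: sqiZ|].
have -> : (fun k => nrm (fun x => c * v k x - c * w x)) = fun k => `|c| * nrm (fun x => v k x - w x).
  apply/funext => k; rewrite -nrmZ; last exact: sqiB.
  by congr nrm; apply/funext => x; rewrite mulrBr.
by rewrite -[X in _ --> X](mulr0 `|c|); apply: cvgM vw; exact: cvg_cst.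
Qed.

Lemma cvgL2_sum (I : Type) (s : seq I) (v : I -> nat -> rV -> R) (w : I -> rV -> R) :
  (forall i, cvgL2 (v i) (w i)) ->
  cvgL2 (fun k x => \sum_(i <- s) v i k x) (fun x => \sum_(i <- s) w i x).
Proof.
move=> vw; elim: s => [|i s IH].
  have -> : (fun (k : nat) (x : rV) => \sum_(i <- [::]) v i k x) = fun k x => 0.
    by apply/funext => k; apply/funext => x; rewrite big_nil.
  have -> : (fun x : rV => \sum_(i <- [::]) w i x) = fun x => 0.
    by apply/funext => x; rewrite big_nil.
  by split=> [k||]; [exact: sqi0|exact: sqi0|rewrite nrm_subxx; exact: cvg_cst].
have -> : (fun (k : nat) (x : rV) => \sum_(j <- i :: s) v j k x) = fun k x => v i k x + \sum_(j <- s) v j k x.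
  by apply/funext => k; apply/funext => x; rewrite big_cons.
have -> : (fun x : rV => \sum_(j <- i :: s) w j x) = fun x => w i x + \sum_(j <- s) w j x.
  by apply/funext => x; rewrite big_cons.
exact: cvgL2D.
Qed.

Lemma cvgI_sqr v w : cvgL2 v w -> cvgI (fun k x => v k x ^+ 2) (fun x => w x ^+ 2).
Proof.
move=> [sv sw vw]; split=> [k||]; [exact: (sv k).2|exact: sw.2|].
have e (h : rV -> R) : \int[mu]_x (h x ^+ 2) = ip h h.
  by apply: eq_Rintegral => x _; rewrite expr2.
rewrite e; under eq_cvg do rewrite e.
by apply: (cvg_nrm_ip _ _ sw sw vw vw); apply: nearW.
Qed.

Lemma cvgID v w v' w' : cvgI v w -> cvgI v' w' ->
  cvgI (fun k x => v k x + v' k x) (fun x => w x + w' x).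
Proof.
move=> [iv iw vw] [iv' iw' vw']; split=> [k||].
- exact: (integrableD measurableT (iv k) (iv' k)).
- exact: (integrableD measurableT iw iw').
- rewrite RintegralD//; under eq_cvg do rewrite RintegralD//.
  exact: cvgD.
Qed.

Lemma cvgIZ c v w : cvgI v w -> cvgI (fun k x => c * v k x) (fun x => c * w x).
Proof.
move=> [iv iw vw]; split=> [k||].
- exact: (@integrableZl _ _ _ mu setT measurableT c _ (iv k)).
- exact: (@integrableZl _ _ _ mu setT measurableT c _ iw).
- rewrite RintegralZl//; under eq_cvg do rewrite RintegralZl//.
  by apply: cvgM => //; exact: cvg_cst.
Qed.

Lemma cvgI_sum (I : Type) (s : seq I) (v : I -> nat -> rV -> R) (w : I -> rV -> R) :
  (forall i, cvgI (v i) (w i)) ->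
  cvgI (fun k x => \sum_(i <- s) v i k x) (fun x => \sum_(i <- s) w i x).
Proof.
move=> vw; elim: s => [|i s IH].
  have -> : (fun (k : nat) (x : rV) => \sum_(i <- [::]) v i k x) = fun k x => 0.
    by apply/funext => k; apply/funext => x; rewrite big_nil.
  have -> : (fun x : rV => \sum_(i <- [::]) w i x) = fun x => 0.
    by apply/funext => x; rewrite big_nil.
  by split=> [k||]; [exact: integrable0|exact: integrable0|exact: cvg_cst].
have -> : (fun (k : nat) (x : rV) => \sum_(j <- i :: s) v j k x) = fun k x => v i k x + \sum_(j <- s) v j k x.
  by apply/funext => k; apply/funext => x; rewrite big_cons.
have -> : (fun x : rV => \sum_(j <- i :: s) w j x) = fun x => w i x + \sum_(j <- s) w j x.
  by apply/funext => x; rewrite big_cons.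
exact: cvgID.
Qed.

Let y j (x : rV) : R := omega x `^ (- 2^-1) * coord j x.
Let wi (x : rV) : R := omega x `^ (- 2^-1).

Let wiM (x : rV) : omega x `^ 2^-1 * wi x = 1.
Proof.
rewrite /wi -powRD ?subrr ?powRr0//.
by rewrite (gt_eqF (omega_gt0 x)) implybT.
Qed.

Let wi1 x : `|wi x| <= 1.
Proof.
rewrite ger0_norm ?powR_ge0// -[leRHS](powRr0 (omega x)).
by rewrite /wi ler_powR ?omega_ge1// oppr_le0 invr_ge0.
Qed.

Let y1 j x : `|y j x| <= 1.
Proof.
rewrite /y normrM (ger0_norm (powR_ge0 _ _)).
apply: le_trans (ler_wpM2l (powR_ge0 _ _) (coord_le_omega j x)) _.
by rewrite mulrC -/(wi x) wiM.
Qed.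

Let mwi : measurable_fun setT wi. Proof. exact: measurable_omega_pow. Qed.
Let my j : measurable_fun setT (y j).
Proof. by apply: measurable_funM mwi _; exact: measurable_coord. Qed.

(** The form in the variables A = omega^(1/2) du and W = omega Hess u: the coefficients x_j
    omega^(-1/2) and omega^(-1/2) are at most 1 in absolute value, so the form is continuous under
    L^2 convergence of A and W. *)
Let gform (A : 'I_n -> rV -> R) (W : 'I_n -> 'I_n -> rV -> R) (x : rV) : R :=
  n%:R / (n%:R - 1) * (\sum_(i < n) \sum_(j < n)
    (W i j x + eps / 2 * (y j x * A i x + y i x * A j x)) ^+ 2) +
  - (1 / (n%:R - 1)) * (\sum_(i < n) (W i i x + eps * (y i x * A i x))) ^+ 2 +
  (n%:R - 2) * (4 * (beta - 1) ^+ 2 - 4 * (n%:R - 2) * (beta - 1) + (n%:R + 2) ^+ 2) / (8 * (n%:R - 1)) *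
    (\sum_(i < n) \sum_(j < n) (y j x * A i x) ^+ 2 + -1 * (\sum_(i < n) y i x * A i x) ^+ 2) +
  eps * (beta + n%:R / 2) * \sum_(i < n) (wi x * A i x) ^+ 2.

Let gformE A W (g : rV) (H : 'M[R]_n) (x : rV) : (forall i, g ord0 i = wi x * A i x) ->
  (forall i j, omega x * H i j = W i j x) -> gamma2_form beta x g H = gform A W x.
Proof.
move=> gE HE; rewrite gamma2_formE /gform -/eps mulN1r mulNr.
have gx i j : g ord0 i * x ord0 j = y j x * A i x.
  by rewrite gE /y /coord /wi; ring.
congr (_ * _ - _ * _ ^+ 2 + _ * (_ - _ ^+ 2) + _ * _).
- apply: eq_bigr => i _; apply: eq_bigr => j _.
  by rewrite HE [x ord0 i * _]mulrC !gx.
- by apply: eq_bigr => i _; rewrite HE gx.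
- by apply: eq_bigr => i _; apply: eq_bigr => j _; rewrite gx.
- by apply: eq_bigr => i _; rewrite gx.
- by apply: eq_bigr => i _; rewrite gE.
Qed.

Let cvg_gform A W (A' : nat -> 'I_n -> rV -> R) (W' : nat -> 'I_n -> 'I_n -> rV -> R) :
  (forall i, cvgL2 (fun k => A' k i) (A i)) -> (forall i j, cvgL2 (fun k => W' k i j) (W i j)) ->
  cvgI (fun k => gform (A' k) (W' k)) (gform A W).
Proof.
move=> cA cW.
have cyA i j : cvgL2 (fun k x => y j x * A' k i x) (fun x => y j x * A i x).
  exact: cvgL2M (my j) (y1 j) (cA i).
apply: cvgID; [apply: cvgID; [apply: cvgID|]|]; apply: cvgIZ.
- apply: cvgI_sum => i; apply: cvgI_sum => j; apply: cvgI_sqr.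
  apply: cvgL2D; first exact: cW.
  by apply: cvgL2Z; apply: cvgL2D.
- apply: cvgI_sqr; apply: cvgL2_sum => i; apply: cvgL2D; first exact: cW.
  exact: cvgL2Z.
- apply: cvgID; last by apply: cvgIZ; apply: cvgI_sqr; exact: cvgL2_sum.
  by apply: cvgI_sum => i; apply: cvgI_sum => j; exact: cvgI_sqr.
- apply: cvgI_sum => i; apply: cvgI_sqr; exact: cvgL2M mwi wi1 (cA i).
Qed.

(** The weighted derivatives of the approximants converge in L^2(mu). Dividing the limits by the
    weights gives weak derivatives of f, and the identity for test functions passes to the limit
    through [gform]. *)
Lemma cauchy_dom_derivatives f g : cauchy_dom n beta f g ->
  exists (G : 'I_n -> rV -> R) (H : 'I_n -> 'I_n -> rV -> R),
  [/\ forall i, is_weak_partial i f (G i), forall i j, is_weak_partial i (G j) (H i j) &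
    (\int[mu]_x (gamma2_form beta x (\row_i G i x) (\matrix_(i, j) H i j x))%:E)%E =
      (ip g g + (beta - n%:R / 2) ^+ 2 * ip f g)%:E].
Proof.
move=> /(cauchy_domP n2 beta_gt)[sf sg [u ug]]; have [cu uf Lug] := ug.
have /choice[A hA] : forall i, exists h, sqi h /\
    nrm (fun x => wgrad i (u k) x - h x) @[k --> \oo] --> (0 : R).
  by move=> i; have [h sh c] := graph_bounded_cvg (graph_bounded_wgrad i) sf sg ug; exists h.
have /choice[W hW] : forall ij, exists h, sqi h /\
    nrm (fun x => whess ij.1 ij.2 (u k) x - h x) @[k --> \oo] --> (0 : R).
  by move=> ij; have [h sh c] := graph_bounded_cvg (graph_bounded_whess ij.1 ij.2) sf sg ug; exists h.
have cA i : cvgL2 (fun k => wgrad i (u k)) (A i).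
  by have [sA c] := hA i; split=> // k; exact: sqi_Cc (Cc_wgrad i (cu k)).
have cW i j : cvgL2 (fun k => whess i j (u k)) (W (i, j)).
  by have [sW c] := hW (i, j); split=> // k; exact: sqi_Cc (Cc_whess i j (cu k)).
pose G i x := wi x * A i x; pose H i j x := (omega x)^-1 * W (i, j) x.
have w0 (x : rV) : omega x != 0 by rewrite gt_eqF// omega_gt0.
have cG i : cvgL2 (fun k => partial i (u k)) (G i).
  have := cvgL2M mwi wi1 (cA i); congr cvgL2; apply/funext => k; apply/funext => x.
  by rewrite /wgrad mulrA [wi x * _]mulrC wiM mul1r.
have mw : measurable_fun setT (fun x : rV => (omega x)^-1).
  apply: (@eq_measurable_fun _ _ _ _ _ (fun x : rV => omega x `^ (-1))).
    by move=> x _; rewrite powR_inv1// ltW// omega_gt0.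
  exact: measurable_omega_pow.
have w1 (x : rV) : `|(omega x)^-1| <= 1.
  by rewrite ger0_norm ?invr_ge0 ?(ltW (omega_gt0 x))// invf_le1 ?omega_gt0// omega_ge1.
have cH i j : cvgL2 (fun k => partial i (partial j (u k))) (H i j).
  have := cvgL2M mw w1 (cW i j); congr cvgL2; apply/funext => k; apply/funext => x.
  by rewrite /whess mulKf.
exists G, H; split.
- move=> i; have [_ sG c] := cG i; exact: weak_partial_cvg uf c.
- move=> i j; have [_ sG c] := cG j; have [_ sH c'] := cH i j.
  exact: weak_partial_cvg sG sH (fun k => Cc_partial j (cu k)) c c'.
have [_ iQ cQ] := cvg_gform cA cW.
have -> : (fun x => (gamma2_form beta x (\row_i G i x) (\matrix_(i, j) H i j x))%:E) =
    EFin \o gform A (fun i j => W (i, j)).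
  apply/funext => x; congr EFin; apply: gformE => [i|i j]; rewrite mxE// /H mulrA divff ?mul1r//.
rewrite -(fineK (integrable_fin_num measurableT iQ)); congr EFin.
apply: (cvg_unique (@Rhausdorff R) cQ).
have [_ c1 c2] := graph_approx_ip n2 beta_gt sf sg sf sg ug ug.
have -> : (fun k => \int[mu]_x gform (fun i => wgrad i (u k)) (fun i j => whess i j (u k)) x) =
    fun k => ip (L (u k)) (L (u k)) + (beta - n%:R / 2) ^+ 2 * ip (u k) (L (u k)).
  apply/funext => k; have := integral_gamma2 n2 beta_gt (cu k).
  rewrite (dformE n2 beta_gt (cu k) (Cc_smooth (cu k))) mulrN opprK => <-.
  apply: eq_Rintegral => x _; apply/esym/gformE => [i|i j]; rewrite mxE ?/whess//.
  by rewrite /wgrad mulrA [wi x * _]mulrC wiM mul1r.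
by apply: cvgD c2 _; apply: cvgM c1; exact: cvg_cst.
Qed.

Let measurable_gamma2 (G : 'I_n -> rV -> R) (H : 'I_n -> 'I_n -> rV -> R) :
  (forall i, measurable_fun setT (G i)) -> (forall i j, measurable_fun setT (H i j)) ->
  measurable_fun setT (fun x => gamma2_form beta x (\row_i G i x) (\matrix_(i, j) H i j x)).
Proof.
move=> mG mH; under eq_fun do rewrite gamma2_formE.
have mo : measurable_fun setT (@omega R n) by exact: measurable_omega.
have mc i : measurable_fun setT (fun x : rV => x ord0 i) by exact: measurable_coord.
have mG' i : measurable_fun setT (fun x => (\row_i G i x) ord0 i).
  by under eq_fun do rewrite mxE; exact: mG.
have mH' i j : measurable_fun setT (fun x => (\matrix_(i, j) H i j x) i j).
  by under eq_fun do rewrite mxE; exact: mH.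
apply: measurable_funD; [apply: measurable_funD; [apply: measurable_funB|]|];
  apply: measurable_funM => //.
- apply: measurable_sum => i; apply: measurable_sum => j; apply: measurable_funX.
  by apply: measurable_funD; apply: measurable_funM => //; apply: measurable_funD; exact: measurable_funM.
- apply: measurable_funX; apply: measurable_sum => i.
  by apply: measurable_funD; apply: measurable_funM => //; exact: measurable_funM.
- apply: measurable_funB.
    by apply: measurable_sum => i; apply: measurable_sum => j; apply: measurable_funX; exact: measurable_funM.
  by apply: measurable_funX; apply: measurable_sum => i; exact: measurable_funM.
- by apply: measurable_sum => i; exact: measurable_funX.
Qed.

(** [weak_hess] differentiates the representative chosen by [weak_partial], not the limit G; so G is
    first exchanged for that representative under the second derivative, and then all derivatives
    are identified outside a null set. *)
Lemma cauchy_dom_gamma2 f g : cauchy_dom n beta f g ->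
  (\int[mu]_x (gamma2_form beta x (weak_grad f x) (weak_hess f x))%:E)%E =
    (ip g g + (beta - n%:R / 2) ^+ 2 * ip f g)%:E.
Proof.
move=> fg; have [G [H [wG wH <-]]] := cauchy_dom_derivatives fg.
have wG' i : is_weak_partial i f (weak_partial i f) := (weak_partialE (wG i)).1.
have wH' i j : is_weak_partial i (weak_partial j f) (H i j).
  apply: is_weak_partial_ae (wH i j) _ _; first by have [_ ? _] := wG' j.
  exact: is_weak_partial_uniq (wG j) (wG' j).
have aG i := (weak_partialE (wG i)).2.
have aH i j := (weak_partialE (wH' i j)).2.
have wH2 i j := (weak_partialE (wH' i j)).1.
have mG i : measurable_fun setT (G i) by have [_ [? _] _] := wG i.
have mH i j : measurable_fun setT (H i j) by have [_ [? _] _] := wH i j.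
have mG' i : measurable_fun setT (weak_partial i f) by have [_ [? _] _] := wG' i.
have mH' i j : measurable_fun setT (weak_partial i (weak_partial j f)) by have [_ [? _] _] := wH2 i j.
apply: ae_eq_integral => //.
- by apply/measurable_EFinP; exact: measurable_gamma2.
- by apply/measurable_EFinP; exact: measurable_gamma2.
- have aG' : {ae mu, forall x, forall i, weak_partial i f x = G i x} by exact: filter_forall.
  have aH' : {ae mu, forall x, forall ij : 'I_n * 'I_n,
      weak_partial ij.1 (weak_partial ij.2 f) x = H ij.1 ij.2 x}.
    by apply: filter_forall => -[i j]; exact: aH.
  apply: filterS2 aG' aH' => x hG hH _.
  have -> : weak_grad f x = \row_i G i x by apply/rowP => i; rewrite !mxE hG.
  have -> // : weak_hess f x = \matrix_(i, j) H i j x.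
  by apply/matrixP => i j; rewrite !mxE (hH (i, j)).
Qed.

End weak_derivatives.

(** * Strongly continuous semigroups *)

Section right_limits.
Context (R : realType).

Lemma cvg_right0_le (q : R -> R) : q t @[t --> 0^'+] --> (0 : R) ->
  forall e : R, 0 < e -> exists d : R, 0 < d /\ forall t, 0 < t -> t < d -> q t <= e.
Proof.
move=> q0 e e0.
have : \forall t \near 0^'+, q t <= e by exact: (cvgr_le 0 q0).
move=> /nbhs_ballP[d /= d0 hd]; exists d; split => // t t0 td.
by apply: hd => //; rewrite /ball/= sub0r normrN gtr0_norm.
Qed.

Lemma cvg_dnbhs0 (q : R -> R) : (forall t, 0 <= q t) ->
  (forall e : R, 0 < e -> exists d : R, 0 < d /\ forall t, t != 0 -> `|t| < d -> q t <= e) ->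
  q t @[t --> 0^'] --> (0 : R).
Proof.
move=> q0 h; apply/cvgrPdist_le => e e0; have [d [d0 hd]] := h _ e0.
near=> t; rewrite sub0r normrN ger0_norm//; apply: hd.
  by near: t; exact: nbhs_dnbhs_neq.
by near: t; exact: dnbhs0_lt.
Unshelve. all: by end_near. Qed.

Lemma cvg_right0 (q : R -> R) : (forall t, 0 <= q t) ->
  (forall e : R, 0 < e -> exists d : R, 0 < d /\ forall t, 0 < t -> t < d -> q t <= e) ->
  q t @[t --> 0^'+] --> (0 : R).
Proof.
move=> q0 h; apply/cvgrPdist_le => e e0; have [d [d0 hd]] := h _ e0.
near=> t; rewrite sub0r normrN ger0_norm//; exact: hd.
Unshelve. all: by end_near. Qed.

End right_limits.

(** * Differentiable curves in L^2 *)

Section curves.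
Context d (T : measurableType d) (R : realType) (mu : {measure set T -> \bar R}).
Local Notation sqi := (sqi mu).
Local Notation ip := (ip mu).
Local Notation nrm := (nrm mu).

(** Strong two-sided differentiability in L^2. Square integrability is asked only near t, since P_t
    is constrained for t >= 0 alone. *)
Definition curve_deriv (a : R -> T -> R) (t : R) (a' : T -> R) := [/\
  \forall h \near (0 : R)^', sqi (a (t + h)), sqi (a t), sqi a',
  nrm (fun x => a (t + h) x - a t x) @[h --> 0^'] --> (0 : R) &
  nrm (fun x => h^-1 * (a (t + h) x - a t x) - a' x) @[h --> 0^'] --> (0 : R)].

Lemma is_derive_ip a a' b b' (t : R) : curve_deriv a t a' -> curve_deriv b t b' ->
  is_derive t 1 (fun t => ip (a t) (b t)) (ip a' (b t) + ip (a t) b').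
Proof.
move=> [sah sa sa' ca da] [sbh sb sb' cb db].
have c1 : ip (fun x => h^-1 * (a (t + h) x - a t x)) (b (t + h)) @[h --> 0^'] --> ip a' (b t).
  apply: cvg_nrm_ip => //.
  by near=> h; apply: sqiZ; apply: sqiB => //; near: h.
have c2 : ip (a t) (fun x => h^-1 * (b (t + h) x - b t x)) @[h --> 0^'] --> ip (a t) b'.
  apply: (@cvg_nrm_ip _ _ _ _ _ _ _ (fun=> a t)) => //.
  - by near=> h.
  - by near=> h; apply: sqiZ; apply: sqiB => //; near: h.
  - by rewrite nrm_subxx; exact: cvg_cst.
have c : h^-1 *: (ip (a (h *: 1 + t)) (b (h *: 1 + t)) - ip (a t) (b t)) @[h --> 0^'] -->
    ip a' (b t) + ip (a t) b'.
  apply: cvg_trans (cvgD c1 c2); apply: near_eq_cvg; near=> h.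
  have sah' : sqi (a (t + h)) by near: h.
  have sbh' : sqi (b (t + h)) by near: h.
  rewrite /GRing.scale/= mulr1 [h + t]addrC.
  rewrite [LHS]/=; have sBa := sqiB sah' sa; have sBb := sqiB sbh' sb.
  by rewrite fctE ipZl// ipBl// ipZr// ipBr//; ring.
apply: DeriveDef; last exact: cvg_lim c.
by apply/cvg_ex; exists (ip a' (b t) + ip (a t) b').
Unshelve. all: by end_near. Qed.

Lemma curve_deriv_cst (t : R) f : sqi f -> curve_deriv (fun=> f) t (fun=> 0).
Proof.
move=> sf; split => //.
- exact: nearW.
- exact: sqi0.
- by rewrite nrm_subxx; exact: cvg_cst.
- rewrite (_ : (fun h => _) = fun=> 0); first exact: cvg_cst.
  apply/funext => h; rewrite -[RHS](nrm_subxx mu (fun=> 0)); congr nrm; apply/funext => x.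
  by rewrite !subrr mulr0 subrr.
Qed.

End curves.

(** * Semigroups with a given generator *)

Section semigroups.
Context d (T : measurableType d) (R : realType) (mu : {measure set T -> \bar R}).
Context (A : (T -> R) -> (T -> R) -> Prop) (P : R -> (T -> R) -> (T -> R)).
Hypothesis sg : semigroup_generated_by mu A P.
Local Notation sqi := (sqi mu).
Local Notation ip := (ip mu).
Local Notation nrm := (nrm mu).
Implicit Types (f g : T -> R) (s t : R).

Lemma sg_sqi t f : 0 <= t -> sqi f -> sqi (P t f).
Proof. by move=> t0 /Lfun2P sf; apply/Lfun2P; exact: (sg_L2 sg). Qed.

Let msg t f : 0 <= t -> sqi f -> measurable_fun setT (P t f).
Proof. by move=> t0 sf; have [] := sg_sqi t0 sf. Qed.

Lemma sg_nrm_le t : 0 <= t ->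
  exists M : R, 0 <= M /\ forall f, sqi f -> nrm (P t f) <= M * nrm f.
Proof.
move=> t0; have [M hM] := sg_bounded sg t0; exists `|M|; split => // f sf.
have := hM f; rewrite (L2norm_nrm sf) (L2norm_nrm (sg_sqi t0 sf)) -EFinM lee_fin.
move=> H; apply: le_trans (H _) _; first exact/Lfun2P.
by rewrite ler_wpM2r ?nrm_ge0// ler_norm.
Qed.

Lemma sgB t f g : 0 <= t -> sqi f -> sqi g ->
  {ae mu, forall x, P t (fun y => f y - g y) x = P t f x - P t g x}.
Proof.
move=> t0 sf sg'.
have := sg_linear sg (-1) t0 (proj2 (Lfun2P mu g) sg') (proj2 (Lfun2P mu f) sf).
rewrite (_ : (fun y => -1 * g y + f y) = fun y => f y - g y); last first.
  by apply/funext => y; rewrite mulN1r addrC.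
by apply: filterS => x ->; rewrite mulN1r addrC.
Qed.

(** The laws of the semigroup hold almost everywhere only; here and below their consequences are
    stated between norms, where null sets disappear. *)
Lemma nrm_sgB t f g : 0 <= t -> sqi f -> sqi g ->
  nrm (fun x => P t f x - P t g x) = nrm (P t (fun y => f y - g y)).
Proof.
move=> t0 sf sg'; apply: nrm_ae_eq; last by apply: msg => //; exact: sqiB.
  by apply: filterS (sgB t0 sf sg') => x ->.
by apply: measurable_funB; exact: msg.
Qed.

Lemma sg_cvg0 f e : sqi f -> 0 < e ->
  exists d : R, 0 < d /\ forall t, 0 <= t -> t < d -> nrm (fun x => P t f x - f x) <= e.
Proof.
move=> sf e0; have fL := proj2 (Lfun2P mu f) sf.
have : nrm (fun x => P t f x - f x) @[t --> 0^'+] --> (0 : R).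
  apply/L2norm_cvg0; last exact: (sg_continuous sg).
  by near=> t; apply: sqiB => //; apply: sg_sqi => //; near: t; exact: nbhs_right_ge.
move=> /cvg_right0_le /(_ _ e0)[d' [d0 hd]]; exists d'; split => // t.
rewrite le_eqVlt => /orP[/eqP <- _|]; last exact: hd.
have sP := sg_sqi (lexx 0) sf.
have [mf _] := sf; have [mP _] := sP.
rewrite (@nrm_ae_eq _ _ _ mu _ (fun=> 0)) ?ltW//.
- by rewrite /nrm ip0l sqrtr0.
- by apply: filterS (sg_0 sg fL) => x ->; rewrite subrr.
- exact: measurable_funB.
Unshelve. all: by end_near. Qed.

Lemma nrm_sg0 f : sqi f -> nrm (P 0 f) = nrm f.
Proof.
by move=> sf; apply: nrm_ae_eq; [exact/(sg_0 sg)/Lfun2P|exact: msg|case: sf].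
Qed.

Lemma nrm_sgDB s t f g : 0 <= s -> 0 <= t -> sqi f -> sqi g ->
  nrm (fun x => P (s + t) f x - P s g x) = nrm (P s (fun x => P t f x - g x)).
Proof.
move=> s0 t0 sf sg'; have sP := sg_sqi t0 sf.
have sB : sqi (fun x => P t f x - g x) by exact: sqiB.
apply: nrm_ae_eq; last exact: msg.
  apply: filterS2 (sg_add sg s0 t0 (proj2 (Lfun2P mu f) sf)) (sgB s0 sP sg') => x.
  by move=> -> ->.
by apply: measurable_funB; apply: msg => //; exact: addr_ge0.
Qed.

Lemma nrm_sgD s t f : 0 <= s -> 0 <= t -> sqi f -> nrm (P (s + t) f) = nrm (P s (P t f)).
Proof.
move=> s0 t0 sf; have sP := sg_sqi t0 sf; apply: nrm_ae_eq.
- by apply: (sg_add sg) => //; exact/Lfun2P.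
- by apply: msg => //; exact: addr_ge0.
- exact: msg.
Qed.

(* Gliding hump: if the operators [P t] were unbounded near 0, one could build
   [x] and [t_k -> 0] with [nrm (P t_k x) >= k], against strong continuity. *)
Let sg_continuous_unbounded :
  (forall M s : R, 0 <= M -> 0 < s ->
    exists t f, [/\ 0 <= t, t <= s, sqi f & M * nrm f < nrm (P t f)]) -> False.
Proof.
move=> unb.
pose S := ((T -> R) * R)%type.
(* One move of the construction. From a centre x and a radius r at stage k it yields a time t <=
   1/(k+1), a centre z within r of x with |P_t z| >= k + 1, and a radius so small that all later
   moves together change P_t z by at most 1. *)
have step (kz : nat * S) : exists tz : R * S, sqi kz.2.1 -> 0 < kz.2.2 ->
    [/\ [/\ 0 <= tz.1, tz.1 <= kz.1.+1%:R^-1 & sqi tz.2.1],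
        [/\ 0 < tz.2.2, 4 * tz.2.2 <= kz.2.2 & nrm (fun y => tz.2.1 y - kz.2.1 y) <= kz.2.2],
        kz.1.+1%:R <= nrm (P tz.1 tz.2.1) &
        forall y, sqi y -> nrm y <= 2 * tz.2.2 -> nrm (P tz.1 y) <= 1].
  case: kz => k [x r] /=.
  have [[sx r0]|nh] := pselect (sqi x /\ 0 < r); last by exists (0, (x, r)) => sx r0; case: nh.
  have k0 : 0 < k.+1%:R :> R by rewrite ltr0n.
  (* Scaled to norm r, a function violating this bound satisfies |P_t f| >= 2 (k + 1), so P_t is at
     least k + 1 in norm at x or at x + f. *)
  have M0 : 0 <= 2 * k.+1%:R / r by rewrite divr_ge0 ?mulr_ge0// ltW.
  have ik0 : 0 < k.+1%:R^-1 :> R by rewrite invr_gt0.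
  have [t [f [t0 tk sf fM]]] := unb _ _ M0 ik0.
  have [Mt [Mt0 hMt]] := sg_nrm_le t0.
  (* The quarter keeps the total of later displacements below twice the current radius; the other
     bound makes P_t at most 1 in norm on the ball of radius 2 r'. *)
  pose r' := Num.min (r / 4) (2 * (Mt + 1))^-1.
  have r'0 : 0 < r'.
    by rewrite lt_min divr_gt0//= invr_gt0 mulr_gt0// ltr_wpDl.
  have r'r : 4 * r' <= r by rewrite mulrC -ler_pdivlMr// ge_min lexx.
  have small y : sqi y -> nrm y <= 2 * r' -> nrm (P t y) <= 1.
    move=> sy yr; apply: (le_trans (hMt _ sy)).
    have p : 0 < Mt + 1 by rewrite ltr_wpDl.
    have : 2 * r' <= (Mt + 1)^-1.
      have : r' <= (2 * (Mt + 1))^-1 by rewrite ge_min lexx orbT.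
      by rewrite invfM -ler_pdivlMl ?invr_gt0// invrK.
    move=> /(le_trans yr); rewrite -(ler_pM2l p) divff ?gt_eqF//.
    by apply: le_trans; rewrite ler_wpM2r ?nrm_ge0// lerDl.
  have [xk|xk] := leP k.+1%:R (nrm (P t x)).
    exists (t, (x, r')) => _ _; split => //; split => //=.
    by rewrite nrm_subxx ltW.
  have f0 : 0 < nrm f.
    rewrite lt_neqAle nrm_ge0 andbT; apply/eqP => f0.
    by have := le_lt_trans (le_trans (hMt _ sf) _) fM; rewrite -f0 !mulr0 lexx ltxx => /(_ isT).
  pose c := r / nrm f.
  have c0 : 0 < c by rewrite divr_gt0.
  have sx' : sqi (fun y => c * f y + x y) by apply: sqiD => //; exact: sqiZ.
  exists (t, (fun y => c * f y + x y, r')) => _ _; split => //=; [split => //|].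
    rewrite (_ : (fun y => _) = fun y => c * f y); last by apply/funext => y; rewrite addrK.
    by rewrite nrmZ// gtr0_norm// /c divfK// gt_eqF.
  have sPf := sg_sqi t0 sf; have sPx := sg_sqi t0 sx; have sPx' := sg_sqi t0 sx'.
  have : nrm (fun y => c * P t f y) <= nrm (P t (fun y => c * f y + x y)) + nrm (P t x).
    apply: le_trans (nrmB sPx' sPx).
    rewrite le_eqVlt; apply/orP; left; apply/eqP; apply: nrm_ae_eq.
    - have := sg_linear sg c t0 (proj2 (Lfun2P mu f) sf) (proj2 (Lfun2P mu x) sx).
      by apply: filterS => y ->; rewrite addrK.
    - by have [] := sqiZ c sPf.
    - by have [] := sqiB sPx' sPx.
  rewrite nrmZ// gtr0_norm// => H.
  have H2 : 2 * k.+1%:R <= c * nrm (P t f).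
    have := ltW fM => h; rewrite -(ler_pM2l c0) in h; apply: (le_trans _ h).
    rewrite /c le_eqVlt; apply/orP; left; apply/eqP; field.
    by rewrite !gt_eqF.
  rewrite -(lerD2r (nrm (P t x))); apply: le_trans H; apply: le_trans H2.
  by rewrite mulr_natl mulr2n lerD2l ltW.
have /choice[F hF] := step.
pose z := fix z k : S := if k is j.+1 then (F (j, z j)).2 else (fun=> 0, 1).
pose t k := (F (k, z k)).1.
have hz k : sqi (z k).1 /\ 0 < (z k).2.
  elim: k => [|k [IH1 IH2]]; first by split => //; exact: sqi0.
  by have [[_ _ ?] [? _ _] _ _] := hF (k, z k) IH1 IH2.
have zF k := hF (k, z k) (hz k).1 (hz k).2.
have zd k m : nrm (fun x => (z (k + m)%N).1 x - (z k).1 x) <= 2 * ((z k).2 - (z (k + m)%N).2).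
  elim: m => [|m IH]; first by rewrite addn0 subrr mulr0 nrm_subxx.
  rewrite addnS; apply: (le_trans (nrm_triangle (hz _).1 (hz (k + m)%N).1 (hz k).1)).
  have [_ [_ r4 d1] _ _] := zF (k + m)%N.
  have := lerD d1 IH; have := (hz (k + m).+1).2; rewrite /= in r4 *.
  by move: r4; set a := (z (k + m)%N).2; set b := (F _).2.2; lra.
have z4 k : (z k).2 <= 4^-1 ^+ k.
  elim: k => [|k IH]; first by rewrite expr0.
  rewrite exprS ler_pdivlMl//; apply: le_trans IH.
  by have [_ [_ r4 _] _ _] := zF k.
have zc k m : (k <= m)%N -> nrm (fun x => (z m).1 x - (z k).1 x) <= 2 * (z k).2.
  move=> /subnKC <-; apply: le_trans (zd _ _) _; rewrite ler_pM2l// gerBl ltW//.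
  by have [] := hz (k + (m - k))%N.
have [x sx zx] : exists2 f, sqi f & nrm (fun x => (z k).1 x - f x) @[k --> \oo] --> (0 : R).
  apply: L2_complete => [k|e e0]; first by have [] := hz k.
  have : (fun k => 4^-1 ^+ k : R) @ \oo --> (0 : R) by apply: cvg_expr; rewrite ger0_norm// invf_lt1// ltr1n.
  move=> /cvgr0_norm_le /(_ (e / 4)); rewrite divr_gt0// => /(_ isT)[N _ hN].
  have zN : (z N).2 <= e / 4.
    have := hN N (leqnn N); apply: le_trans; apply: le_trans (z4 N) _.
    exact: ler_norm.
  exists N => m k Nm Nk; apply: le_trans (nrm_triangle (hz _).1 (hz N).1 (hz _).1) _.
  rewrite [X in _ + X]nrmBC; have := lerD (zc _ _ Nm) (zc _ _ Nk); move: zN.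
  by set a := (z N).2; lra.
have xz k : nrm (fun y => x y - (z k).1 y) <= 2 * (z k).2.
  apply/ler_addgt0Pr => e e0.
  move: zx => /cvgr0_norm_le /(_ e e0)[N _ hN].
  have := hN (maxn N k) (leq_maxl _ _); rewrite ger0_norm ?nrm_ge0// => h1.
  have h2 := zc _ _ (leq_maxr N k).
  apply: le_trans (nrm_triangle sx (hz (maxn N k)).1 (hz k).1) _.
  by rewrite addrC nrmBC lerD// nrmBC.
have [d' [d0 hd]] := sg_cvg0 sx ltr01.
have [k hk1 hk2] : exists2 k : nat, k.+1%:R^-1 < d' & 1 + nrm x < k%:R :> R.
  exists (maxn (Num.trunc d'^-1) (Num.trunc (1 + nrm x)).+1).
    rewrite invf_plt ?posrE//.
    apply: lt_le_trans (truncnS_gt _) _.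
    by rewrite ler_nat ltnS leq_maxl.
  apply: lt_le_trans (truncnS_gt _) _.
  by rewrite ler_nat leq_maxr.
have [[t0 tk sz] _ Pz h1] := zF k.
have td := le_lt_trans tk hk1.
have b1 : nrm (P (t k) x) <= 1 + nrm x.
  have := nrmD (sqiB (sg_sqi t0 sx) sx) sx.
  rewrite (_ : (fun y => _ + _) = P (t k) x); last by apply/funext => y; rewrite subrK.
  by move=> /le_trans; apply; rewrite lerD2r; exact: hd.
have b2 : nrm (fun y => P (t k) x y - P (t k) (z k.+1).1 y) <= 1.
  rewrite nrm_sgB//; apply: h1; [exact: sqiB|exact: xz k.+1].
have sPz := sg_sqi t0 sz; have sPx := sg_sqi t0 sx.
have b3 : nrm (P (t k) (z k.+1).1) <= nrm (P (t k) x) + 1.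
  have := nrmB sPx (sqiB sPx sPz).
  rewrite (_ : (fun y => _ - _) = P (t k) (z k.+1).1); last by apply/funext => y; rewrite opprB addrC subrK.
  by move=> /le_trans; apply; rewrite lerD2l.
move: b1 b3 Pz hk2; rewrite /= -/(t k) -[k.+1]addn1 natrD.
by move: (nrm (P (t k) x)) (nrm (P (t k) _)) (nrm x) => a1 a2 a3; lra.
Qed.

(** The gliding hump gives a bound M on some [0, tau]; a longer time t is cut into k equal steps
    shorter than tau, which costs M^k. *)
Lemma sg_locally_bounded (s : R) : exists M : R, 0 <= M /\
  forall t f, 0 <= t -> t <= s -> sqi f -> nrm (P t f) <= M * nrm f.
Proof.
have [M [tau [M0 tau0 hM]]] : exists M tau : R, [/\ 0 <= M, 0 < tau &
    forall t f, 0 <= t -> t <= tau -> sqi f -> nrm (P t f) <= M * nrm f].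
  apply: contrapT => nb; apply: sg_continuous_unbounded => M tau M0 tau0.
  apply: contrapT => nh; apply: nb; exists M, tau; split => // t f t0 tt sf.
  by rewrite leNgt; apply/negP => h; apply: nh; exists t, f.
have it k t f : 0 <= t -> t <= tau -> sqi f -> nrm (P (k%:R * t) f) <= M ^+ k * nrm f.
  move=> t0 tt sf; elim: k => [|k IH]; first by rewrite mul0r nrm_sg0// expr0 mul1r.
  have kt0 : 0 <= k%:R * t by rewrite mulr_ge0.
  rewrite -add1n natrD mulrDl mul1r nrm_sgD// (le_trans (hM _ _ t0 tt (sg_sqi kt0 sf)))//.
  by rewrite exprD expr1 -mulrA ler_wpM2l.
pose k := (Num.trunc (s / tau)).+1.
have k0 : 0 < k%:R :> R by rewrite ltr0n.
exists (M ^+ k); split; first exact: exprn_ge0.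
move=> t f t0 ts sf; have := it k (t / k%:R) f; rewrite mulrCA divff ?gt_eqF// mulr1; apply => //.
  by rewrite divr_ge0// ltW.
rewrite ler_pdivrMr// mulrC -ler_pdivrMr//.
apply: le_trans (ltW (truncnS_gt _)).
by rewrite ler_wpM2r// invr_ge0 ltW.
Qed.

Let eps_bound (M e : R) : 0 <= M -> 0 < e -> 0 < e / (M + 1) /\ M * (e / (M + 1)) <= e.
Proof.
move=> M0 e0; have p : 0 < M + 1 by rewrite ltr_wpDl.
split; first exact: divr_gt0.
by rewrite mulrCA ger_pMr// ler_pdivrMr// mul1r lerDl.
Qed.

(** P_(s+t) f - P_s f = P_s (P_t f - f), and P_s is bounded uniformly on [0, s'], so the modulus
    does not depend on s. *)
Lemma sg_uniform_continuity (s' : R) f e : sqi f -> 0 < e ->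
  exists d : R, 0 < d /\ forall s t, 0 <= s -> s <= s' -> 0 <= t -> t < d ->
    nrm (fun x => P (s + t) f x - P s f x) <= e.
Proof.
move=> sf e0; have [M [M0 hM]] := sg_locally_bounded s'.
have [e'0 e'e] := eps_bound M0 e0; have [d' [d0 hd]] := sg_cvg0 sf e'0.
exists d'; split => // s t s0 ss t0 td; have sP := sg_sqi t0 sf.
rewrite nrm_sgDB//; apply: le_trans (hM _ _ s0 ss (sqiB sP sf)) _.
by apply: le_trans e'e; rewrite ler_wpM2l// hd.
Qed.

Lemma sgZ t c f : 0 <= t -> sqi f -> {ae mu, forall x, P t (fun y => c * f y) x = c * P t f x}.
Proof.
move=> t0 /Lfun2P fL; have := sg_linear sg (c - 1) t0 fL fL.
rewrite (_ : (fun y => _) = fun y => c * f y); last by apply/funext => y; rewrite mulrBl mul1r subrK.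
by apply: filterS => x ->; rewrite mulrBl mul1r subrK.
Qed.

Lemma sg_generator_sqi f g : A f g -> sqi f /\ sqi g.
Proof. by move=> /(sg_generator sg)[/Lfun2P ? /Lfun2P ?]. Qed.

Lemma nrm_sg_quotient s t f g : 0 <= s -> 0 < t -> sqi f -> sqi g ->
  nrm (fun x => t^-1 * (P (s + t) f x - P s f x) - P s g x) =
  nrm (P s (fun x => t^-1 * (P t f x - f x) - g x)).
Proof.
move=> s0 /ltW t0 sf sg'; have sP := sg_sqi t0 sf; have sPg := sg_sqi s0 sg'.
have sPs := sg_sqi s0 sf; have sPst := sg_sqi (addr_ge0 s0 t0) sf.
have sB := sqiB sP sf; have sZ := sqiZ t^-1 sB.
apply: nrm_ae_eq.
- have a1 := sg_add sg s0 t0 (proj2 (Lfun2P mu f) sf).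
  have a2 := sgB s0 sP sf; have a3 := sgZ t^-1 s0 sB; have a4 := sgB s0 sZ sg'.
  apply: filterS2 (filterI a1 a2) (filterI a3 a4) => x [e1 e2] [e3 e4].
  by rewrite e4 e3 e2 e1.
- by have [] := sqiB (sqiZ t^-1 (sqiB sPst sPs)) sPg.
- by have [] := sg_sqi s0 (sqiB sZ sg').
Qed.

Lemma sg_uniform_quotient (s' : R) f g e : A f g -> 0 < e ->
  exists d : R, 0 < d /\ forall s t, 0 <= s -> s <= s' -> 0 < t -> t < d ->
    nrm (fun x => t^-1 * (P (s + t) f x - P s f x) - P s g x) <= e.
Proof.
move=> fg e0; have [sf sg'] := sg_generator_sqi fg.
have [M [M0 hM]] := sg_locally_bounded s'.
have [e'0 e'e] := eps_bound M0 e0.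
have /(sg_generator sg)[_ _ lim] := fg.
have sq t : 0 < t -> sqi (fun x => t^-1 * (P t f x - f x) - g x).
  by move=> t0; apply: sqiB => //; apply: sqiZ; apply: sqiB => //; exact/sg_sqi/sf/ltW.
have {}lim : nrm (fun x => t^-1 * (P t f x - f x) - g x) @[t --> 0^'+] --> (0 : R).
  apply/L2norm_cvg0; last exact: lim.
  by near=> t; apply: sq.
have [d' [d0 hd]] := cvg_right0_le lim e'0.
exists d'; split => // s t s0 ss t0 td.
rewrite nrm_sg_quotient//; apply: le_trans (hM _ _ s0 ss (sq _ t0)) _.
by apply: le_trans e'e; rewrite ler_wpM2l// hd.
Unshelve. all: by end_near. Qed.

(** The difference quotient of P_t f is P_t applied to that of f, and P_t is bounded: the domain is
    invariant and P_t commutes with the generator. *)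
Lemma sg_generator_invariant t f g : 0 <= t -> A f g -> A (P t f) (P t g).
Proof.
move=> t0 fg; have [sf sg'] := sg_generator_sqi fg.
have sPf := sg_sqi t0 sf; have sPg := sg_sqi t0 sg'.
apply/(sg_generator sg); split; [exact/Lfun2P|exact/Lfun2P|].
apply/L2norm_cvg0.
  near=> s; apply: sqiB => //; apply: sqiZ; apply: sqiB => //.
  by apply: sg_sqi.
apply: cvg_right0 => [s|e e0]; first exact: nrm_ge0.
have [d' [d0 hd]] := sg_uniform_quotient t fg e0.
exists d'; split => // s s0 sd; have := hd t s t0 (lexx t) s0 sd.
have ts0 := addr_ge0 t0 (ltW s0).
rewrite (@nrm_ae_eq _ _ _ mu _ (fun x => s^-1 * (P s (P t f) x - P t f x) - P t g x))//.
- have := sg_add sg (ltW s0) t0 (proj2 (Lfun2P mu f) sf).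
  by rewrite addrC; apply: filterS => x <-.
- by have [] := sqiB (sqiZ s^-1 (sqiB (sg_sqi ts0 sf) sPf)) sPg.
- by have [] := sqiB (sqiZ s^-1 (sqiB (sg_sqi (ltW s0) sPf) sPf)) sPg.
Unshelve. all: by end_near. Qed.

(** The generator gives right quotients only. For h < 0 the quotient at t is the right quotient at t
    + h with increment -h; uniformity of the limit for base points in [0, 2 t], and continuity of
    P_s g in s, bring it back to t. *)
Lemma curve_deriv_sg t f g : 0 < t -> A f g -> curve_deriv mu (P^~ f) t (P t g).
Proof.
move=> t0 fg; have [sf sg'] := sg_generator_sqi fg.
have sPf := sg_sqi (ltW t0) sf; have sPg := sg_sqi (ltW t0) sg'.
have th h : `|h| < t -> 0 <= t + h.
  by rewrite ltr_norml => /andP[/ltW ht _]; rewrite -lerBlDl sub0r.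
have hle h : `|h| < t -> t + h <= 2 * t.
  by move=> ht; rewrite mulr_natl mulr2n lerD2l (le_trans (ler_norm _))// ltW.
split => //.
- by near=> h; apply: sg_sqi => //; apply: th; near: h; exact: dnbhs0_lt.
- apply: cvg_dnbhs0 => [h|e e0]; first exact: nrm_ge0.
  have [d' [d0 hd]] := sg_uniform_continuity (2 * t) sf e0.
  exists (Num.min t d'); split => [|h h0]; first by rewrite lt_min t0.
  rewrite lt_min => /andP[ht hd'].
  have t2 : t <= 2 * t by rewrite mulr_natl mulr2n lerDl ltW.
  have [hp|hn] := leP 0 h.
    by apply: hd => //; [exact: ltW|rewrite (le_lt_trans _ hd')// ler_norm].
  have hN0 : 0 <= - h by rewrite oppr_ge0 ltW.
  have hNd : - h < d' by rewrite (le_lt_trans _ hd')// -normrN ler_norm.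
  by rewrite nrmBC; have := hd (t + h) (- h) (th _ ht) (hle _ ht) hN0 hNd; rewrite addrK.
- apply: cvg_dnbhs0 => [h|e e0]; first exact: nrm_ge0.
  have e2 : 0 < e / 2 by rewrite divr_gt0.
  have [d1 [d10 hd1]] := sg_uniform_continuity (2 * t) sg' e2.
  have [d2 [d20 hd2]] := sg_uniform_quotient (2 * t) fg e2.
  exists (Num.min t (Num.min d1 d2)); split => [|h h0]; first by rewrite !lt_min t0 d10.
  rewrite !lt_min => /and3P[ht hd' hd''].
  have t2 : t <= 2 * t by rewrite mulr_natl mulr2n lerDl ltW.
  have [hp|hn] := ltP 0 h.
    have := hd2 t h (ltW t0) t2 hp (le_lt_trans (ler_norm _) hd'').
    by move=> /le_trans; apply; rewrite ler_pdivrMr// ler_peMr ?ler1n// ltW.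
  have {hn}hn : h < 0 by rewrite lt_neqAle h0.
  have th0 := th _ ht; have sPth := sg_sqi th0 sg'; have sPthf := sg_sqi th0 sf.
  have hN0 : 0 < - h by rewrite oppr_gt0.
  have hNd2 : - h < d2 by rewrite (le_lt_trans _ hd'')// -normrN ler_norm.
  have hNd1 : - h < d1 by rewrite (le_lt_trans _ hd')// -normrN ler_norm.
  have := hd2 (t + h) (- h) th0 (hle _ ht) hN0 hNd2.
  have := hd1 (t + h) (- h) th0 (hle _ ht) (ltW hN0) hNd1.
  rewrite addrK nrmBC => q1 q2.
  apply: le_trans (nrm_triangle (g := P (t + h) g) _ _ _) _ => //.
    by apply: sqiZ; exact: sqiB.
  rewrite [leRHS](splitr e); apply: lerD => //; apply: le_trans q2.
  rewrite le_eqVlt; apply/orP; left; apply/eqP; congr nrm; apply/funext => x.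
  by rewrite invrN mulNr -mulrN opprB.
Unshelve. all: by end_near. Qed.

Let cvg_nrm_sg f : sqi f -> nrm (fun x => P t f x - f x) @[t --> 0^'+] --> (0 : R).
Proof.
move=> sf; apply: cvg_right0 => [t|e e0]; first exact: nrm_ge0.
by have [d' [d0 hd]] := sg_cvg0 sf e0; exists d'; split => // t /ltW; exact: hd.
Qed.

Lemma cvg_ip_sgl f g : sqi f -> sqi g -> ip (P t f) g @[t --> 0^'+] --> ip f g.
Proof.
move=> sf sg'; apply: (@cvg_nrm_ip _ _ _ _ _ _ _ (P^~ f) (fun=> g)) => //.
- by near=> t; exact: sg_sqi.
- exact: nearW.
- exact: cvg_nrm_sg.
- by rewrite nrm_subxx; exact: cvg_cst.
Unshelve. all: by end_near. Qed.

Lemma cvg_ip_sg f g : sqi f -> sqi g -> ip (P t f) (P t g) @[t --> 0^'+] --> ip f g.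
Proof.
move=> sf sg'; apply: cvg_nrm_ip; [| |exact: sf|exact: sg'|exact: cvg_nrm_sg|exact: cvg_nrm_sg].
- by near=> t; exact: sg_sqi.
- by near=> t; exact: sg_sqi.
Unshelve. all: by end_near. Qed.

Lemma ip_sg0l f g : sqi f -> sqi g -> ip (P 0 f) g = ip f g.
Proof.
move=> sf [mg _]; have [mf _] := sf.
apply: ip_ae_eq => //; [exact/(sg_0 sg)/Lfun2P|exact: aeW|exact: msg].
Qed.

Lemma ip_sg0 f g : sqi f -> sqi g -> ip (P 0 f) (P 0 g) = ip f g.
Proof.
move=> sf sg'; rewrite ip_sg0l//; last exact: sg_sqi.
by rewrite ipC ip_sg0l// ipC.
Qed.

End semigroups.

(** * Decay and integral of the energy, for abstract functions of time *)

Section energy_decay.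
Context (R : realType) (V b c : R -> R) (l : R).
Implicit Types (s t x : R).
Hypothesis l0 : 0 < l.
Hypothesis dV : forall t, 0 < t -> is_derive t 1 V (2 * b t).
Hypothesis db : forall t, 0 < t -> is_derive t 1 b (2 * c t).
Hypothesis dc : forall t, 0 < t -> derivable c t 1.
Hypotheses (cV : V t @[t --> 0^'+] --> V 0) (cb : b t @[t --> 0^'+] --> b 0)
  (cc : c t @[t --> 0^'+] --> c 0).
Hypotheses (V0 : forall t, 0 <= t -> 0 <= V t)
  (Vb : forall t, 0 <= t -> l * V t <= - b t)
  (bc : forall t, 0 <= t -> l * - b t <= c t).

Let decreasing (f f' : R -> R) : (forall t, 0 < t -> is_derive t 1 f (f' t)) ->
  (forall t, 0 < t -> f' t <= 0) -> forall s t, 0 < s -> s <= t -> f t <= f s.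
Proof.
move=> df f'0 s t s0 st.
have p x : x \in `[s, t] -> 0 < x by rewrite in_itv/= => /andP[sx _]; exact: lt_le_trans sx.
have p' x : x \in `]s, t[ -> 0 < x by rewrite in_itv/= => /andP[sx _]; exact: lt_trans sx.
have [|z zi e] := MVT_segment st (fun x xi => df x (p' x xi)).
  by apply: derivable_within_continuous => x /p /df[].
by rewrite -subr_le0 e mulr_le0_ge0// ?subr_ge0// f'0// p.
Qed.

Let b0 t : 0 <= t -> b t <= 0.
Proof. by move=> t0; rewrite -oppr_ge0 (le_trans _ (Vb t0))// mulr_ge0 ?V0// ltW. Qed.

Let c0 t : 0 <= t -> 0 <= c t.
Proof. by move=> t0; rewrite (le_trans _ (bc t0))// mulr_ge0 ?oppr_ge0 ?b0// ltW. Qed.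

(* [V - 2 t b] is nonincreasing, so the energy [- b] decays at least like [1/t]. *)
Let decay t : 1 <= t -> - b t <= (V 1 - 2 * b 1) / 2 * t^-1.
Proof.
move=> t1; have t0 : 0 < t by exact: lt_le_trans t1.
have := @decreasing (fun t => V t - 2 * t * b t) (fun t => - (4 * (t * c t))) _ _ 1 t ltr01 t1.
rewrite mulr1 => H.
have h : V t - 2 * t * b t <= V 1 - 2 * b 1.
  apply: H => [x x0|x x0]; last by rewrite oppr_le0 mulr_ge0// mulr_ge0 ?c0 ?ltW.
  have d1 : is_derive x 1 (fun t : R => 2 * t) 2.
    by have := is_deriveZ 2 (is_derive_id x (1 : R)); rewrite /GRing.scale/= mulr1.
  have := is_deriveB (dV x0) (is_deriveM d1 (db x0)).
  by congr is_derive; rewrite /GRing.scale/=; ring.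
rewrite ler_pdivlMr//; apply: (@le_trans _ _ ((V t - 2 * t * b t) / 2)); last by rewrite ler_pM2r.
by have := V0 (ltW t0); lra.
Qed.

(** (l V + b)/2 is an antiderivative of the nonnegative function c + l b. It tends to 0 because 0 <=
    l V <= - b and - b decays like 1/t, so the improper integral is minus its value at 0. *)
Lemma energy_integral :
  (\int[lebesgue_measure]_(t in `[0%R, +oo[) (c t + l * b t)%:E = (- ((l * V 0 + b 0) / 2))%:E)%E.
Proof.
pose F t := (l * V t + b t) / 2.
have dF t : 0 < t -> is_derive t 1 F (c t + l * b t).
  move=> t0; have := is_deriveZ 2^-1 (is_deriveD (is_deriveZ l (dV t0)) (db t0)).
  rewrite (_ : 2^-1 \*: (l \*: V + b) = F); last first.
    by apply/funext => x; rewrite /F mulrC.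
  by congr is_derive; rewrite /GRing.scale/=; field.
transitivity (0%:E - (F 0)%:E)%E; last by rewrite sub0e.
apply: (@ge0_continuous_FTC2y _ (fun t => c t + l * b t) F 0 0).
- by move=> t t0; have := bc t0; lra.
- apply/continuous_within_itvcyP; split; last first.
    by apply: cvgD => //; apply: cvgM cb; exact: cvg_cst.
  move=> t; rewrite in_itv/= andbT => t0.
  have ct : continuous_at t c by apply/differentiable_continuous/derivable1_diffP/dc.
  have bt : continuous_at t b by apply/differentiable_continuous/derivable1_diffP; case: (db t0).
  by apply: cvgD => //; apply: cvgM bt; exact: cvg_cst.
- apply/cvgrPdist_le => e e0.
  have p : 0 <= (V 1 - 2 * b 1) / 2.
    by rewrite divr_ge0// addr_ge0 ?V0// -mulrN mulr_ge0// oppr_ge0 b0.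
  near=> t; have te : (V 1 - 2 * b 1) / 2 / e <= t by near: t; apply: nbhs_pinfty_ge; exact: num_real.
  have t1 : 1 <= t by near: t; exact: nbhs_pinfty_ge.
  have t0 : 0 < t by exact: lt_le_trans t1.
  have H : (V 1 - 2 * b 1) / 2 * t^-1 <= e.
    by move: te; rewrite !ler_pdivrMr// [e * t]mulrC.
  have := decay t1; have := V0 (ltW t0); have := Vb (ltW t0); have := b0 (ltW t0).
  rewrite /F sub0r normrN => h1 h2 h3 h4; rewrite ler_norml.
  have h5 := le_trans h4 H; have h6 : 0 <= l * V t by rewrite mulr_ge0// ltW.
  by apply/andP; split; lra.
- by move=> t t0; have [] := dF t t0.
- by apply: cvgM; [apply: cvgD cb; apply: cvgM cV; exact: cvg_cst|exact: cvg_cst].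
- move=> t; rewrite in_itv/= andbT => t0; rewrite derive1E.
  exact: (@derive_val _ _ _ _ _ _ _ (dF t t0)).
Unshelve. all: by end_near. Qed.

End energy_decay.

(** * The integrated identity along the semigroup *)

Section main.
Context (R : realType) (n : nat) (beta : R).
Hypotheses (n2 : (2 <= n)%N) (beta_gt : n%:R / 2 < beta) (beta_le : beta <= n%:R / 2 + 2).
Local Notation rV := 'rV[R]_n.
Local Notation mu := (@cauchy_measure R n beta).
Local Notation sqi := (sqi mu).
Local Notation ip := (ip mu).
Local Notation L := (cauchy_L beta).
Let lambda : R := (beta - n%:R / 2) ^+ 2.
Context (P : R -> (rV -> R) -> (rV -> R)).
Hypothesis sg : semigroup_generated_by mu (cauchy_dom n beta) P.
Implicit Types (t : R) (f : rV -> R).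

(** As f is a test function, so are L f and L (L f). Hence P_t f and P_t (L f) both lie in the
    domain, and the variance, <f_t, L f_t> and |L f_t|^2 can all be differentiated in t. *)
Lemma cauchy_semigroup_energy f : Cc_infty f ->
  (\int[lebesgue_measure]_(t in `[0%R, +oo[) \int[mu]_x
     (gamma2_form beta x (weak_grad (P t f) x) (weak_hess (P t f) x))%:E =
   (- ((lambda * variance_of mu f + ip f (L f)) / 2))%:E)%E.
Proof.
move=> cf; have cg := Cc_cauchy_L beta cf; have ch := Cc_cauchy_L beta cg.
have fg : cauchy_dom n beta f (L f) := cauchy_dom_Cc n2 beta_gt cf.
have gh : cauchy_dom n beta (L f) (L (L f)) := cauchy_dom_Cc n2 beta_gt cg.
have sf := sqi_Cc n2 beta_gt cf; have sg' := sqi_Cc n2 beta_gt cg.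
have sh := sqi_Cc n2 beta_gt ch; have s1 : sqi (fun=> 1) := sqi_cst n2 beta_gt 1.
have fgt t : 0 <= t -> cauchy_dom n beta (P t f) (P t (L f)).
  by move=> t0; exact: (sg_generator_invariant sg t0 fg).
have ght t : 0 <= t -> cauchy_dom n beta (P t (L f)) (P t (L (L f))).
  by move=> t0; exact: (sg_generator_invariant sg t0 gh).
(* The mean of f_t thus has zero derivative, and its square does not contribute to the derivative of
   the variance. *)
have mean0 t : 0 <= t -> ip (P t (L f)) (fun=> 1) = 0.
  by move=> t0; rewrite ip_cst1; exact: (cauchy_dom_mean n2 beta_gt (fgt t t0)).
pose m t := ip (P t f) (fun=> 1).
pose V t := ip (P t f) (P t f) - m t ^+ 2.
pose b t := ip (P t f) (P t (L f)).
pose c t := ip (P t (L f)) (P t (L f)).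
have VE t : 0 <= t -> V t = variance_of mu (P t f).
  by move=> t0; rewrite variance_ip// -?ip_cst1//; exact: (sg_sqi sg t0 sf).
have V0 : V 0 = variance_of mu f.
  rewrite (variance_ip n2 beta_gt sf) -ip_cst1 /V (ip_sg0 sg sf sf) /m.
  by rewrite (ip_sg0l sg sf s1).
transitivity (\int[lebesgue_measure]_(t in `[0%R, +oo[) (c t + lambda * b t)%:E)%E.
  apply: eq_integral => t; rewrite inE/= in_itv/= andbT => t0.
  exact: (cauchy_dom_gamma2 n2 beta_gt beta_le (fgt t t0)).
have b0 : b 0 = ip f (L f) by exact: (ip_sg0 sg sf sg').
have l0 : 0 < lambda by rewrite exprn_gt0// subr_gt0.
have dV t : 0 < t -> is_derive t 1 V (2 * b t).
  move=> t0; have df := curve_deriv_sg sg t0 fg.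
  have d1 := is_derive_ip df df.
  have d2 := is_derive_ip df (curve_deriv_cst t s1).
  rewrite (mean0 t (ltW t0)) in d2.
  have := is_deriveB d1 (is_deriveM d2 d2).
  rewrite [ip (P t (L f)) (P t f)]ipC.
  rewrite [ip _ (fun=> 0)]ipC ip0l !addr0 !scaler0 addr0 subr0 -mulr2n (mulr_natl (b t) 2).
  exact: id.
have db t : 0 < t -> is_derive t 1 b (2 * c t).
  move=> t0.
  have := is_derive_ip (curve_deriv_sg sg t0 fg) (curve_deriv_sg sg t0 gh).
  rewrite (cauchy_dom_sym n2 beta_gt (fgt t (ltW t0)) (ght t (ltW t0))).
  by congr is_derive; rewrite mulr_natl.
have dc t : 0 < t -> derivable c t 1.
  move=> t0; have dg := curve_deriv_sg sg t0 gh.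
  by have [] := is_derive_ip dg dg.
have cV : V t @[t --> 0^'+] --> V 0.
  rewrite {2}/V /m (ip_sg0 sg sf sf) (ip_sg0l sg sf s1).
  have c1 := cvg_ip_sgl sg sf s1.
  by apply: cvgB; [exact: (cvg_ip_sg sg sf sf)|exact: (cvgM c1 c1)].
have cb : b t @[t --> 0^'+] --> b 0 by rewrite b0; exact: (cvg_ip_sg sg sf sg').
have cc : c t @[t --> 0^'+] --> c 0.
  by rewrite [c 0](ip_sg0 sg sg' sg'); exact: (cvg_ip_sg sg sg' sg').
have Vge t : 0 <= t -> 0 <= V t.
  by move=> t0; rewrite VE//; apply: Rintegral_ge0 => x _; exact: sqr_ge0.
have Vb t : 0 <= t -> lambda * V t <= - b t.
  by move=> t0; rewrite VE//; have [] := cauchy_dom_energy n2 beta_gt beta_le (fgt t t0).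
have bc t : 0 <= t -> lambda * - b t <= c t.
  by move=> t0; have [] := cauchy_dom_energy n2 beta_gt beta_le (fgt t t0).
by rewrite -V0 -b0; exact: (energy_integral l0 dV db dc cV cb cc Vge Vb bc).
Qed.

Transparent omega gdot.

Lemma gamma_energy f : Cc_infty f ->
  \int[mu]_x (enorm (grad f x) ^+ 2 * (1 + enorm x ^+ 2)) = - ip f (L f).
Proof.
move=> cf; rewrite -(dformE n2 beta_gt cf (Cc_smooth cf)); apply: eq_Rintegral => x _.
rewrite mulrC; congr (_ * _); rewrite sqr_enorm; apply: eq_bigr => i _.
by rewrite mxE expr2.
Qed.

End main.

Theorem corollary4p12 (R : realType) (n : nat) (beta : R)
    (n_ge2 : (2 <= n)%N)
    (beta_gt : n%:R / 2 < beta) (beta_le : beta <= n%:R / 2 + 2) :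
  let mu : {measure set 'rV[R]_n -> \bar R} := cauchy_measure n beta in
  let eps0 := n%:R / 2 + 2 - beta in
  (((beta - n%:R / 2) ^+ 2)%:E <= spectral_gap n beta)%E /\
  forall P : R -> ('rV[R]_n -> R) -> ('rV[R]_n -> R),
    semigroup_generated_by mu (cauchy_dom n beta) P ->
    forall f : 'rV[R]_n -> R, Cc_infty f ->
    ((beta - n%:R / 2) ^+ 2 * variance_of mu f
       - \int[mu]_x (enorm (grad f x) ^+ 2 * (1 + enorm x ^+ 2)))%:E =
    ((- 2)%:E * \int[lebesgue_measure]_(t in `[0%R, +oo[) \int[mu]_x
      (let df := weak_grad (P t f) x in
       let Hf := weak_hess (P t f) x in
       n%:R / (n%:R - 1)
         * hs_norm (omega x *: Hf
             + (eps0 / 2) *: (tensor df x + tensor x df)) ^+ 2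
       - 1 / (n%:R - 1) * (omega x * \tr Hf + eps0 * dot df x) ^+ 2
       + (n%:R - 2) * (4 * (beta - 1) ^+ 2 - 4 * (n%:R - 2) * (beta - 1)
                         + (n%:R + 2) ^+ 2) / (8 * (n%:R - 1))
         * (enorm df ^+ 2 * enorm x ^+ 2 - dot df x ^+ 2)
       + (n%:R / 2 + 2 - beta) * (beta + n%:R / 2) * enorm df ^+ 2)%:E)%E.
Proof.
split=> [|P sg f cf]; first exact: spectral_gap_ge.
have /= -> := cauchy_semigroup_energy n_ge2 beta_gt beta_le sg cf.
by rewrite (gamma_energy n_ge2 beta_gt cf) -EFinM; congr EFin; field.
Qed.
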